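(* Let $p\in[1,\infty]$, let $E$ and $L$ be locally convex spaces, and let $T:E\to L$ be an operator (continuous linear map). Consider the following assertions: (i) $T$ is weakly $p$-convergent; (ii) $T$ maps every (non-empty) weakly sequentially $p$-precompact subset of $E$ to an $\infty$-$(V^\ast)$ subset of $L$; (iii) $T$ maps every (non-empty) weakly sequentially $p$-compact subset of $E$ to an $\infty$-$(V^\ast)$ subset of $L$; (iv) $T$ maps (the range of) every weakly $p$-summable sequence of $E$ to an $\infty$-$(V^\ast)$ subset of $L$; (v) $R\circ T$ is $p$-convergent for every Banach space $Z$ and every $R\in\mathcal{L}(L,Z)$ with weakly sequentially precompact adjoint $R^\ast:Z'_\beta\to L'_\beta$; (vi) $R\circ T$ is $p$-convergent for every $R\in\mathcal{L}(L,c_0)$ with weakly sequentially precompact adjoint $R^\ast:\ell_1\to L'_\beta$; (vii) $R\circ T$ is $p$-convergent for every $R\in\mathcal{L}(L,c_0)$ such that the sequence $\big(R^\ast(e_n^\ast)\big)_{n}$ is weakly null in $L'_\beta$, where $\{e_n^\ast\}$ is the canonical unit basis of $\ell_1=(c_0)'$; (viii) for every normed space $X$ and every weakly sequentially $p$-precompact operator $R:X\to E$, the operator $T\circ R$ is $\infty$-$(V^\ast)$; (ix) for every normed space $X$ and every weakly sequentially $p$-precompact operator $S:X\to E$, the map $S^\ast\circ T^\ast:L'_\beta\to X'_\beta$ is $\infty$-convergent; (x) if $R\in\mathcal{L}(\ell_1^0,E)$ is weakly sequentially $p$-precompact, then $T\circ R$ is $\infty$-$(V^\ast)$; (xi) for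 every normed space $Z$ and every weakly sequentially $p$-compact operator $S:Z\to E$, the composition $T\circ S$ is $\infty$-$(V^\ast)$; (xii) for every $S\in\mathcal{L}(\ell_{p^\ast},E)$, the map $T\circ S$ is $\infty$-$(V^\ast)$. Then: (A) (i)$\Leftrightarrow$(ii)$\Leftrightarrow$(iii)$\Leftrightarrow$(iv); (B) (i)$\Rightarrow$(v)$\Rightarrow$(vi), and if $L$ is $c_0$-barrelled and $L'_\beta$ is weakly sequentially locally $\infty$-complete, then (vi)$\Rightarrow$(i); (C) (i)$\Rightarrow$(vii), and if $L$ is $c_0$-barrelled, then (vii)$\Rightarrow$(i); (D) (ii)$\Rightarrow$(viii)$\Leftrightarrow$(ix)$\Rightarrow$(x), and if $E$ is weakly sequentially locally $p$-complete, then (x)$\Rightarrow$(i); (E) if $1<p<\infty$, then (i)$\Rightarrow$(viii)$\Rightarrow$(xi)$\Rightarrow$(xii), and if moreover $E$ is sequentially complete, then (xii)$\Rightarrow$(i).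
   Context: All locally convex spaces are Hausdorff and over the field $\mathbb{F}\in\{\mathbb{R},\mathbb{C}\}$. ''Operator'' means continuous linear map; $\mathcal{L}(H,L)$ is the set of operators from $H$ to $L$. For a locally convex space $E$: $E'$ is its topological dual and $E'_\beta$ is $E'$ with the strong topology $\beta(E',E)$; ''weakly null in $E'_\beta$'' refers to the weak topology of the locally convex space $E'_\beta$. $T^\ast$ is the adjoint map. $p^\ast$ is defined by $1/p+1/p^\ast=1$. $\ell_1^0$ is the linear span of the canonical unit vectors in $\ell_1$ with the norm induced from $\ell_1$. A sequence $\{x_n\}$ in $E$ is weakly $p$-summable if for every $\chi\in E'$, $(\langle\chi,x_n\rangle)_n\in\ell_p$ if $p<\infty$, and $(\langle\chi,x_n\rangle)_n\in c_0$ if $p=\infty$. It is weakly $p$-convergent to $x\in E$ if $\{x_n-x\}$ is weakly $p$-summable; it is weakly $p$-Cauchy if for each pair of strictly increasing sequences $(k_n),(j_n)$ of natural numbers, $(x_{k_n}-x_{j_n})_n$ is weakly $p$-summable. A subset $A\subseteq E$ is (relatively) weakly sequentially $p$-compact if every sequence in $A$ has a weakly $p$-convergent subsequence with limit in $A$ (resp., in $E$); weakly sequentially $p$-precompact if every sequence in $A$ has a weakly $p$-Cauchy subsequence; weakly sequentially precompact if every sequence in $A$ has a weakly Cauchy subsequence. A non-empty $A\subseteq E$ is an $\infty$-$(V^\ast)$ set if $\sup_{a\in A}|\langle\chi_n,a\rangle|\to0$ for every weakly null sequence $\{\chi_n\}$ in $E'_\beta$. A linear map $T:E\to L$ is: weakly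 $p$-convergent if $\lim_n\langle\eta_n,T(x_n)\rangle=0$ for every weakly null sequence $\{\eta_n\}$ in $L'_\beta$ and every weakly $p$-summable sequence $\{x_n\}$ in $E$; $p$-convergent if it sends weakly $p$-summable sequences of $E$ to null sequences of $L$; weakly sequentially $p$-compact (resp., weakly sequentially $p$-precompact, weakly sequentially precompact, $\infty$-$(V^\ast)$) if there is a neighborhood $U$ of zero in $E$ such that $T(U)$ is a relatively weakly sequentially $p$-compact (resp., weakly sequentially $p$-precompact, weakly sequentially precompact, $\infty$-$(V^\ast)$) subset of $L$. $E$ is $c_0$-barrelled if every $\sigma(E',E)$-null sequence is equicontinuous; sequentially complete if every Cauchy sequence converges; weakly sequentially locally $p$-complete if the closed absolutely convex hull of every weakly $p$-summable sequence in $E$ is weakly sequentially $p$-precompact. *)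

(* Defs.v *)
From HB Require Import structures.
From mathcomp Require Import all_boot all_order all_algebra complex.
From mathcomp Require Import all_classical all_reals all_analysis.
From mathcomp Require Import ess_sup_inf ring.
Set Implicit Arguments.
Unset Strict Implicit.
Unset Printing Implicit Defensive.
Import Order.TTheory GRing.Theory Num.Theory.
Import numFieldNormedType.Exports.
Local Open Scope classical_set_scope.
Local Open Scope ring_scope.

Variant field_kind := RealScalars | ComplexScalars.

Definition scalar_field (R : realType) (k : field_kind) : numFieldType :=
  match k with RealScalars => R | ComplexScalars => R[i] end.

(* The norm of [scalar_field R k] takes its values in [scalar_field R k] itself;
   [modulus] is the same absolute value with values in [R]. *)
Definition modulus (R : realType) (k : field_kind) : scalar_field R k -> R :=
  match k with
  | RealScalars => fun x => `|x|
  | ComplexScalars => fun z => ComplexField.Normc.normc z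
  end.

Definition real_scalar (R : realType) (k : field_kind) : R -> scalar_field R k :=
  match k with RealScalars => id | ComplexScalars => real_complex R end.

Section operator.
Variables (K : numFieldType) (E L : tvsType K).

Definition is_operator : {pred E -> L} :=
  mem [set f : E -> L | linear f /\ continuous f].

Lemma is_operator_submod_closed : submod_closed is_operator.
Proof.
split=> [|a f g /[!inE] -[lf cf] [lg cg]].
  rewrite inE; split; first by move=> c x y; rewrite -[LHS]/(0 : L) -[RHS]/(c *: (0 : L) + 0) scaler0 addr0.
  move=> x; exact: (@cvg_cst L).
split.
  move=> c x y; rewrite -[LHS]/(a *: f (c *: x + y) + g (c *: x + y)) lf lg.
  rewrite -[RHS]/(c *: (a *: f x + g x) + (a *: f y + g y)).
  by rewrite !scalerDr !scalerA [c * a]mulrC addrACA.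
have caf : continuous (fun x => a *: f x).
  move=> x; apply: (@continuous_comp E (K^o * L)%type L (fun x => (a, f x))
    (fun x : K^o * L => x.1 *: x.2)); last exact: scale_continuous.
  by apply: (@cvg_pair _ _ _ _ (nbhs (a : K^o)) (nbhs (f x)));
    [exact: cvg_cst|exact: cf].
move=> x; apply: (@continuous_comp E (L * L)%type L (fun x => (a *: f x, g x))
  (fun x : L * L => x.1 + x.2)); last exact: add_continuous.
by apply: (@cvg_pair _ _ _ _ (nbhs (a *: f x)) (nbhs (g x)));
  [exact: caf|exact: cg].
Qed.

HB.instance Definition _ :=
  GRing.isSubmodClosed.Build K (E -> L) is_operator is_operator_submod_closed.

Record operator := Operator { op_fun :> E -> L ; _ : op_fun \in is_operator }.

HB.instance Definition _ := [isSub for op_fun].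
HB.instance Definition _ := [Choice of operator by <:].
HB.instance Definition _ := [SubChoice_isSubLmodule of operator by <:].

Lemma operatorP (f : operator) : linear f /\ continuous f.
Proof. by have := valP f; rewrite inE. Qed.

End operator.

(* The strong dual: continuous linear functionals with the topology of uniform
   convergence on the bounded subsets of [E]. *)
Section strong_topology.
Variables (K : numFieldType) (E : tvsType K).

Definition tvs_bounded (B : set E) := forall U : set E, nbhs 0 U ->
  exists s : K, 0 < s /\ forall t, s < t -> B `<=` [set t *: u | u in U].

Definition dual := operator E K^o.

Definition strong_dual := dual.

HB.instance Definition _ := GRing.Lmodule.on strong_dual.

Definition strong_ball (f : strong_dual) (B : set E) (e : K) : set strong_dual :=
  [set g : strong_dual | forall x, B x -> `|f x - g x| < e].

Definition strong_nbhs (f : strong_dual) : set_system strong_dual :=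
  filter_from [set Be : set E * K | tvs_bounded Be.1 /\ 0 < Be.2]
    (fun Be => strong_ball f Be.1 Be.2).

HB.instance Definition _ := hasNbhs.Build strong_dual strong_nbhs.

Lemma tvs_boundedU (A B : set E) :
  tvs_bounded A -> tvs_bounded B -> tvs_bounded (A `|` B).
Proof.
move=> bA bB U U0; have [s [s0 sA]] := bA U U0; have [t [t0 tB]] := bB U U0.
exists (s + t); split=> [|r]; first exact: addr_gt0.
move=> str x [|]; [apply: sA|apply: tB]; apply: le_lt_trans str.
  by rewrite lerDl ltW.
by rewrite lerDr ltW.
Qed.

Lemma tvs_bounded_image (B : set E) (f : strong_dual) :
  tvs_bounded B -> exists2 M : K, 0 < M & forall x, B x -> `|f x| <= M.
Proof.
move=> bB; have [lf cf] := operatorP f.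
have f0 : f 0 = 0.
  by have := lf (-1) 0 0; rewrite scaler0 addr0 scaleN1r addNr.
have fZ a x : f (a *: x) = a * f x.
  by have := lf a x 0; rewrite addr0 f0 addr0.
have U0 : nbhs 0 [set x | `|f x| < 1].
  have := cf 0; rewrite /continuous_at f0 => /cvgr0_norm_lt; apply; exact: ltr01.
have [s [s0 sB]] := bB _ U0.
exists (s + 1); first exact: addr_gt0.
move=> x /(sB (s + 1)); rewrite ltrDl => /(_ ltr01)[u /= fu <-].
rewrite fZ normrM gtr0_norm ?addr_gt0// -[leRHS]mulr1 ler_wpM2l// ?ltW//.
exact: addr_gt0.
Qed.

Lemma strong_nbhs_filter (f : strong_dual) : ProperFilter (nbhs f).
Proof.
apply: filter_from_proper => [|[B e] [_ /= e0]]; last first.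
  by exists f => x Bx; rewrite subrr normr0.
apply: filter_from_filter.
  exists (set0, 1); split=> //= U _; exists 1; split=> // t _ x [].
move=> [A a] [B b] [/= bA a0] [/= bB b0].
move=> /=; pose e := a * b / (a + b).
have ab0 : 0 < a + b by exact: addr_gt0.
have ea : e <= a.
  by rewrite ler_pdivrMr// ler_wpM2l ?(ltW a0)// lerDr ltW.
have eb : e <= b.
  by rewrite ler_pdivrMr// mulrC ler_wpM2l ?(ltW b0)// lerDl ltW.
exists (A `|` B, e).
  by split; [exact: tvs_boundedU|rewrite /= !mulr_gt0 ?invr_gt0].
move=> g h; split=> x Ax /=.
  by apply: lt_le_trans ea; apply: h; left.
by apply: lt_le_trans eb; apply: h; right.
Qed.

Lemma strong_nbhs_singleton (f : strong_dual) (A : set strong_dual) :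
  nbhs f A -> A f.
Proof.
by move=> [[B e] [_ /= e0]]; apply => x Bx; rewrite subrr normr0.
Qed.

Lemma strong_nbhs_nbhs (f : strong_dual) (A : set strong_dual) :
  nbhs f A -> nbhs f (nbhs^~ A).
Proof.
move=> [[B e] [/= bB e0] BA].
exists (B, e / 2); first by split; rewrite //= divr_gt0.
move=> g /= fg; exists (B, e / 2); first by split; rewrite //= divr_gt0.
move=> h /= gh; apply: BA => x Bx /=.
rewrite -(subrKA (g x)) (le_lt_trans (ler_normD _ _))//.
by rewrite (splitr e) ltrD// ?fg ?gh.
Qed.

HB.instance Definition _ := Nbhs_isNbhsTopological.Build strong_dual
  strong_nbhs_filter strong_nbhs_singleton strong_nbhs_nbhs.

Lemma strong_add_continuous :
  continuous (fun x : strong_dual * strong_dual => x.1 + x.2).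
Proof.
move=> [f g] A [[B e] [/= bB e0] BA].
exists (strong_ball f B (e / 2), strong_ball g B (e / 2)) => /=.
  by split; exists (B, e / 2) => //; split; rewrite //= divr_gt0.
move=> [f' g'] /= [ff gg]; apply: BA => x Bx.
rewrite /= -[X in `|X|]/((f x + g x) - (f' x + g' x)) opprD addrACA.
rewrite (le_lt_trans (ler_normD _ _))//.
by rewrite (splitr e) ltrD// ?ff ?gg.
Qed.

Lemma strong_scale_continuous :
  continuous (fun z : K^o * strong_dual => z.1 *: z.2).
Proof.
move=> [k f] A [[B e] [/= bB e0] BA].
have [M M0 fM] := tvs_bounded_image f bB.
pose d := e / 2 / M.
have d0 : 0 < d by rewrite !divr_gt0.
pose c := e / 2 / (`|k| + d).
have kd0 : 0 < `|k| + d by rewrite ltr_wpDl.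
have c0 : 0 < c by rewrite !divr_gt0.
exists (ball (k : K^o) d, strong_ball f B c) => /=.
  split; first exact: nbhsx_ballx.
  by exists (B, c).
move=> [k' f'] /= [kk ff]; apply: BA => x Bx.
rewrite /= -[X in `|X|]/((k * f x) - (k' * f' x)).
rewrite -(subrKA (k' * f x)) -mulrBl -mulrBr (le_lt_trans (ler_normD _ _))//.
rewrite !normrM (splitr e) ltr_leD//.
  have : `|k - k'| * M < e / 2 by rewrite -ltr_pdivlMr.
  by apply: le_lt_trans; rewrite ler_wpM2l// fM.
have k'k : `|k'| <= `|k| + d.
  rewrite -lerBlDl (le_trans (lerB_dist _ _))// distrC ltW//.
have : (`|k| + d) * c <= e / 2 by rewrite mulrC divfK// gt_eqF.
by apply: le_trans; apply: ler_pM => //; rewrite ltW// ff.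
Qed.

Lemma strong_locally_convex : exists2 C : set_system strong_dual,
  (forall b, b \in C -> convex_set b) & basis C.
Proof.
pose N (f : strong_dual) (B : set E) (e : K) : set strong_dual :=
  [set g | exists2 d, 0 < d < e & forall x, B x -> `|f x - g x| <= d].
exists [set C | exists f B e, [/\ tvs_bounded B, 0 < e & C = N f B e]].
  move=> C /[!inE] -[f [B [e [bB e0 ->]]]] g h l /[!inE].
  move=> [a /andP[a0 ae] fg] [b /andP[b0 be] fh].
  have l0 : 0 <= l%:num by [].
  have l1 : 0 <= 1 - l%:num by rewrite subr_ge0.
  exists (l%:num * a + (1 - l%:num) * b); last first.
    move=> x Bx.
    rewrite -[X in `|X|]/(f x - (l%:num * g x + (1 - l%:num) * h x)).
    have -> : f x - (l%:num * g x + (1 - l%:num) * h x) =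
        l%:num * (f x - g x) + (1 - l%:num) * (f x - h x).
      by ring.
    rewrite (le_trans (ler_normD _ _))// !normrM (ger0_norm l0) (ger0_norm l1).
    by apply: lerD; apply: ler_wpM2l => //; [exact: fg|exact: fh].
  have [l00|l0'] := eqVneq (l%:num : K) 0.
    by rewrite l00 mul0r add0r subr0 mul1r b0 be.
  have lpos : 0 < l%:num :> K by rewrite lt_def l0' l0.
  rewrite ltr_pwDl ?mulr_gt0//=; last by rewrite mulr_ge0// ltW.
  rewrite [ltRHS](_ : e = l%:num * e + (1 - l%:num) * e); last by ring.
  by rewrite ltr_leD ?ltr_pM2l// ler_wpM2l// ltW.
split.
  move=> C [f [B [e [bB e0 ->]]]]; rewrite openE => g [d /andP[d0 de] fg].
  have r0 : 0 < (e - d) / 2 by rewrite divr_gt0// subr_gt0.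
  exists (B, (e - d) / 2) => // h /= gh; exists (d + (e - d) / 2).
    rewrite addr_gt0//= -ltrBrDl ltr_pdivrMr// mulr_natr mulr2n ltrDl.
    by rewrite subr_gt0.
  move=> x Bx; rewrite -(subrKA (g x)) (le_trans (ler_normD _ _))//.
  by rewrite lerD ?fg// ltW// gh.
move=> f A [[B e] [/= bB e0] BA]; exists (N f B e).
  split; first by exists f, B, e.
  exists (e / 2); first by rewrite divr_gt0//= ltr_pdivrMr// mulr_natr mulr2n ltrDl.
  by move=> x Bx; rewrite subrr normr0 ltW// divr_gt0.
by move=> g [d /andP[d0 de] fg]; apply: BA => x Bx; rewrite (le_lt_trans (fg _ Bx)).
Qed.

HB.instance Definition _ := PreTopologicalLmod_isTvs.Build K strong_dual
  strong_add_continuous strong_scale_continuous strong_locally_convex.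
HB.instance Definition _ := PreTopologicalNmodule_isTopologicalNmodule.Build
  strong_dual strong_add_continuous.
HB.instance Definition _ := TopologicalNmodule_isTopologicalLmodule.Build K
  strong_dual strong_scale_continuous.
HB.instance Definition _ :=
  Uniform_isTvs.Build K strong_dual strong_locally_convex.

End strong_topology.

Section scalar_theory.
Variables (R : realType) (k : field_kind).
Implicit Types x y : scalar_field R k.

Lemma real_scalar_modulus x : real_scalar k (modulus x) = `|x|.
Proof. by case: k x. Qed.

Lemma real_scalarD (a b : R) :
  real_scalar k (a + b) = real_scalar k a + real_scalar k b.
Proof. by case: k => //=; rewrite rmorphD. Qed.

Lemma real_scalarM (a b : R) :
  real_scalar k (a * b) = real_scalar k a * real_scalar k b.
Proof. by case: k => //=; rewrite rmorphM. Qed.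

Lemma real_scalar0 : real_scalar k (0 : R) = 0.
Proof. by case: k. Qed.

Lemma ler_real_scalar (a b : R) : (real_scalar k a <= real_scalar k b) = (a <= b).
Proof. by case: k => //=; rewrite lecR. Qed.

Lemma real_scalar_inj : injective (@real_scalar R k).
Proof. by move=> a b ab; apply/le_anti; rewrite -!ler_real_scalar ab lexx. Qed.

Lemma modulus_ge0 x : 0 <= modulus x.
Proof. by rewrite -ler_real_scalar real_scalar0 real_scalar_modulus. Qed.

Lemma modulusM x y : modulus (x * y) = modulus x * modulus y.
Proof.
by apply: real_scalar_inj; rewrite real_scalarM !real_scalar_modulus normrM.
Qed.

Lemma modulusD x y : modulus (x + y) <= modulus x + modulus y.
Proof.
by rewrite -ler_real_scalar real_scalarD !real_scalar_modulus ler_normD.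
Qed.

Lemma modulus0 : modulus (0 : scalar_field R k) = 0.
Proof.
by apply: real_scalar_inj; rewrite real_scalar_modulus normr0 real_scalar0.
Qed.

Lemma modulus_eq0 x : modulus x = 0 -> x = 0.
Proof.
move=> x0; apply/eqP; rewrite -normr_eq0 -real_scalar_modulus x0.
by rewrite real_scalar0.
Qed.

End scalar_theory.

Section ell.
Variables (R : realType) (k : field_kind) (q : \bar R).
Let K := scalar_field R k.

(* The l_q norm, as the L^q norm for the counting measure; it is +oo off l_q, and
   it is the supremum norm when q = +oo. *)
Definition ell_norm (a : nat -> K^o) : \bar R :=
  ('N[counting]_q [EFin \o (@modulus R k \o a)])%E.

Hypothesis q1 : (1 <= q)%E.

Definition in_ell of (1 <= q)%E : {pred nat -> K^o} :=
  mem [set a | (ell_norm a < +oo)%E].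

Lemma le_Lnorm_counting (f g : nat -> R) : (forall n, `|f n| <= `|g n|) ->
  ('N[counting]_q [EFin \o f] <= 'N[counting]_q [EFin \o g])%E.
Proof.
move=> fg; rewrite unlock; case: q q1 => [r|_|//].
  rewrite lee_fin => r1.
  have r0 : 0 <= r by exact: le_trans r1.
  have ige0 (h : nat -> R) :
      (0 <= \int[counting]_x (`|(EFin \o h) x| `^ r))%E.
    by apply: integral_ge0 => n _; exact: poweR_ge0.
  apply: gt0_ler_poweR; rewrite ?invr_ge0// ?in_itv/= ?leey ?ige0//.
  apply: ge0_le_integral => //.
  by move=> n _ /=; rewrite lee_fin ge0_ler_powR// ?nnegrE.
by case: ifP => // _; apply: le_ess_sup; apply: nearW => n /=; rewrite lee_fin.
Qed.

Lemma ell_normD (a b : nat -> K^o) :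
  (ell_norm (a + b)%R <= ell_norm a + ell_norm b)%E.
Proof.
apply: (@le_trans _ _ ('N[counting]_q
   [EFin \o ((fun n => modulus (a n)) \+ (fun n => modulus (b n)))%R])%E).
  apply: le_Lnorm_counting => n /=.
  by rewrite !ger0_norm ?addr_ge0 ?modulus_ge0// modulusD.
exact: (@eminkowski _ _ _ _ (fun n => modulus (a n)) (fun n => modulus (b n))).
Qed.

Lemma ell_normZ (c : K) (a : nat -> K^o) : a \in in_ell q1 ->
  (ell_norm (c *: a)%R = (modulus c)%:E * ell_norm a)%E.
Proof.
move=> /[!inE] /= fa.
have aL : (fun n => modulus (a n)) \in Lfun (@counting nat R) q.
  by rewrite inE; apply/andP; split; rewrite inE.
have := LnormZ (Lfun_Sub q1 aL) (modulus c).
rewrite ger0_norm ?modulus_ge0// => <-.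
by apply: eq_Lnorm => n; rewrite /= -[(_ *: _) n]/(c * a n) modulusM.
Qed.

Lemma ell_norm0 : ell_norm 0 = 0%E.
Proof.
rewrite -[RHS](@Lnorm0 _ _ _ (@counting nat R) q).
  by apply: eq_Lnorm => n; rewrite /= modulus0.
by rewrite gt_eqF// (lt_le_trans _ q1).
Qed.

Lemma ell_norm_ge0 a : (0 <= ell_norm a)%E.
Proof. exact: Lnorm_ge0. Qed.

Lemma ae_counting (P : nat -> Prop) :
  {ae (@counting nat R), forall n, P n} -> forall n, P n.
Proof.
move=> [N [mN N0 PN]] n; apply: contrapT => nP.
have : (@counting nat R) [set n] = 0%E.
  apply/eqP; rewrite eq_le measure_ge0 andbT -N0 le_measure ?inE//.
  by move=> _ ->; exact: PN.
rewrite /counting/= asboolT ?finite_set1// fset_set1 finmap.cardfs1 => /eqP.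
by rewrite eqe oner_eq0.
Qed.

Lemma ell_norm_eq0 a : ell_norm a = 0%E -> a = 0.
Proof.
move=> a0; apply/funext => n; apply: modulus_eq0.
have /ae_counting/(_ n I) : ae_eq (@counting nat R) setT
    (EFin \o (@modulus R k \o a)) (cst 0%E).
  by apply: Lnorm_eq0_eq0 a0; rewrite ?(lt_le_trans lte01 q1).
by move=> /= [].
Qed.

Lemma in_ell_submod_closed : submod_closed (in_ell q1).
Proof.
split=> [|c a b aq bq]; first by rewrite inE /= ell_norm0.
rewrite inE /= (le_lt_trans (ell_normD _ _))// ell_normZ//.
move: aq bq; rewrite !inE/= => aq bq.
by rewrite lte_add_pinfty// lte_mul_pinfty// lee_fin modulus_ge0.
Qed.

HB.instance Definition _ := GRing.isSubmodClosed.Build K (nat -> K^o)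
  (in_ell q1) in_ell_submod_closed.

Record ell := Ell { ell_seq :> nat -> K^o ; _ : ell_seq \in in_ell q1 }.

HB.instance Definition _ := [isSub for ell_seq].
HB.instance Definition _ := [Choice of ell by <:].
HB.instance Definition _ := [SubChoice_isSubLmodule of ell by <:].

Definition ell_norm_scalar (x : ell) : K := real_scalar k (fine (ell_norm x)).

Lemma ell_norm_fine (x : ell) : ((fine (ell_norm x))%:E = ell_norm x)%E.
Proof.
by rewrite fineK// ge0_fin_numE ?ell_norm_ge0//; have := valP x; rewrite inE.
Qed.

Lemma ler_ell_normD (x y : ell) :
  ell_norm_scalar (x + y) <= ell_norm_scalar x + ell_norm_scalar y.
Proof.
rewrite -real_scalarD ler_real_scalar -lee_fin EFinD !ell_norm_fine.
exact: ell_normD.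
Qed.

Lemma ell_norm_scalarZ (c : K) (x : ell) :
  ell_norm_scalar (c *: x) = `|c| * ell_norm_scalar x.
Proof.
rewrite -real_scalar_modulus -real_scalarM; congr real_scalar.
by apply: EFin_inj; rewrite EFinM !ell_norm_fine -ell_normZ ?(valP x).
Qed.

Lemma ell_norm_scalar_eq0 (x : ell) : ell_norm_scalar x = 0 -> x = 0.
Proof.
rewrite -(real_scalar0 R k) => /real_scalar_inj x0.
apply: val_inj; apply: ell_norm_eq0.
by rewrite -[LHS]ell_norm_fine x0.
Qed.

HB.instance Definition _ := Lmodule_isNormed.Build K ell
  ler_ell_normD ell_norm_scalarZ ell_norm_scalar_eq0.

End ell.

Section subspace.
Variables (K : numFieldType) (V : normedModType K) (S : submodClosed V).

Record subspace := Subspace { subspace_val :> V ; _ : subspace_val \in S }.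

HB.instance Definition _ := [isSub for subspace_val].
HB.instance Definition _ := [Choice of subspace by <:].
HB.instance Definition _ := [SubChoice_isSubLmodule of subspace by <:].

Definition subspace_norm (x : subspace) : K := `|subspace_val x|.

Lemma ler_subspace_normD (x y : subspace) :
  subspace_norm (x + y) <= subspace_norm x + subspace_norm y.
Proof. exact: ler_normD. Qed.

Lemma subspace_normZ (c : K) (x : subspace) :
  subspace_norm (c *: x) = `|c| * subspace_norm x.
Proof. exact: normrZ. Qed.

Lemma subspace_norm_eq0 (x : subspace) : subspace_norm x = 0 -> x = 0.
Proof. by move=> x0; apply: val_inj; apply: normr0_eq0. Qed.

HB.instance Definition _ := Lmodule_isNormed.Build K subspace
  ler_subspace_normD subspace_normZ subspace_norm_eq0.

End subspace.

Section classical_spaces.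
Variables (R : realType) (k : field_kind).
Let K := scalar_field R k.

Definition ell1 := ell k (lexx (1%E : \bar R)).
Definition ell_infty := ell k (leey (1%E : \bar R)).

HB.instance Definition _ := NormedModule.on ell1.
HB.instance Definition _ := NormedModule.on ell_infty.


(* c_0 carries the norm of l_infty, and the span of the unit vectors that of
   l_1. *)
Definition null_seq : {pred ell_infty} :=
  mem [set x : ell_infty | (x : nat -> K^o) @ \oo --> (0 : K^o)].

Lemma null_seq_submod_closed : submod_closed null_seq.
Proof.
split=> [|c x y /[!inE] x0 y0]; first by rewrite inE; exact: cvg_cst.
rewrite /= -[X in _ --> X](addr0 (0 : K^o)).
rewrite -[X in _ --> X + _](scaler0 K^o c).
by apply: (@cvgD K K^o) => //; apply: (@cvgZr K K^o).
Qed.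

HB.instance Definition _ := GRing.isSubmodClosed.Build K ell_infty
  null_seq null_seq_submod_closed.

Definition c0 := subspace null_seq.
HB.instance Definition _ := NormedModule.on c0.

Definition unit_seq (i : nat) : nat -> K^o := fun n => (n == i)%:R.

Definition unit_span : {pred ell1} :=
  mem [set x : ell1 | exists N (c : nat -> K),
    (x : nat -> K^o) = \sum_(i < N) c i *: unit_seq i].

Lemma unit_span_submod_closed : submod_closed unit_span.
Proof.
split.
  by rewrite inE; exists 0%N, (fun=> 0); rewrite big_ord0.
move=> c x y /[!inE].
move=> [N [a xa]] [M [b yb]].
have widen P Q (d : nat -> K) : (P <= Q)%N -> \sum_(i < P) d i *: unit_seq i =
    \sum_(i < Q) (if (i < P)%N then d i else 0) *: unit_seq i.
  move=> PQ; rewrite (big_ord_widen _ (fun i => d i *: unit_seq i) PQ).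
  by rewrite big_mkcond; apply: eq_bigr => i _; case: ifP; rewrite ?scale0r.
exists (maxn N M), (fun i => c * (if (i < N)%N then a i else 0) +
  (if (i < M)%N then b i else 0)).
rewrite -[LHS]/(c *: (x : nat -> K^o) + (y : nat -> K^o)) xa yb.
rewrite (widen _ _ _ (leq_maxl N M)) (widen _ _ _ (leq_maxr N M)).
rewrite scaler_sumr -big_split; apply: eq_bigr => i _ /=.
by rewrite scalerA scalerDl.
Qed.

HB.instance Definition _ := GRing.isSubmodClosed.Build K ell1
  unit_span unit_span_submod_closed.

Definition ell1_0 := subspace unit_span.
HB.instance Definition _ := NormedModule.on ell1_0.

Lemma le_modulus_ell_infty (x : ell_infty) n : `|x n| <= `|x|.
Proof.
rewrite -real_scalar_modulus -[leRHS]/(ell_norm_scalar (x : ell _ _)) ler_real_scalar.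
rewrite -lee_fin ell_norm_fine /ell_norm unlock ifT; last first.
  rewrite lt0e measure_ge0 andbT; apply/eqP => T0.
  have : {ae (@counting nat R), forall m : nat, False} by exists setT.
  by move/ae_counting => /(_ 0%N).
have /ae_counting/(_ n) := ess_sup_ge (@counting nat R)
  (abse \o (EFin \o (@modulus R k \o x))).
by rewrite /= ger0_norm ?modulus_ge0.
Qed.

Lemma c0_coord_is_operator (n : nat) :
  (fun x : c0 => (subspace_val x : ell_infty) n : K^o) \in @is_operator K c0 K^o.
Proof.
rewrite inE; split=> [//|x].
apply/(@cvgrPdist_lt K K^o c0 (nbhs (x : c0))) => e e0.
apply: filterS (nbhsx_ballx (x : c0) e e0) => y; rewrite -ball_normE /=.
exact/le_lt_trans/(le_modulus_ell_infty (subspace_val (x - y))).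
Qed.

Definition c0_coord (n : nat) : strong_dual c0 :=
  Operator (c0_coord_is_operator n).

End classical_spaces.

Section adjoint.
Variables (K : numFieldType) (E L : tvsType K).

Lemma comp_is_operator (G : tvsType K) (f : operator L G) (T : operator E L) :
  (f \o T : E -> G) \in @is_operator K E G.
Proof.
have [lf cf] := operatorP f; have [lT cT] := operatorP T.
rewrite inE; split=> [c x y /=|x]; first by rewrite lT lf.
by apply: continuous_comp; [exact: cT|exact: cf].
Qed.

Definition adjoint (T : operator E L) : strong_dual L -> strong_dual E :=
  fun chi => Operator (comp_is_operator chi T).

End adjoint.

Section sequences_and_sets.
Variables (R : realType) (k : field_kind).
Local Notation K := (scalar_field R k).
Implicit Types (E L : tvsType K) (p : \bar R).

Definition weakly_summable E p (x : nat -> E) := forall chi : dual E,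
  if p == +oo%E then chi (x n) @[n --> \oo] --> (0 : K^o)
  else (ell_norm p (chi \o x) < +oo)%E.

Definition weakly_convergent E p (x : nat -> E) (l : E) :=
  weakly_summable p (fun n => x n - l).

Definition strictly_increasing (s : nat -> nat) := {homo s : m n / (m < n)%N}.

Definition weakly_p_cauchy E p (x : nat -> E) := forall s t : nat -> nat,
  strictly_increasing s -> strictly_increasing t ->
  weakly_summable p (fun n => x (s n) - x (t n)).

Definition weakly_null E (x : nat -> E) := forall chi : dual E,
  chi (x n) @[n --> \oo] --> (0 : K^o).

Definition weakly_cauchy E (x : nat -> E) := forall chi : dual E,
  cauchy ((chi (x n) : K^o) @[n --> \oo]).

Definition weakly_seq_compact E p (A : set E) := forall a : nat -> E,
  (forall n, A (a n)) -> exists s l,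
  [/\ strictly_increasing s, A l & weakly_convergent p (a \o s) l].

Definition rel_weakly_seq_compact E p (A : set E) := forall a : nat -> E,
  (forall n, A (a n)) -> exists s l,
  strictly_increasing s /\ weakly_convergent p (a \o s) l.

Definition weakly_seq_p_precompact E p (A : set E) := forall a : nat -> E,
  (forall n, A (a n)) -> exists s,
  strictly_increasing s /\ weakly_p_cauchy p (a \o s).

Definition weakly_seq_precompact E (A : set E) := forall a : nat -> E,
  (forall n, A (a n)) -> exists s,
  strictly_increasing s /\ weakly_cauchy (a \o s).

Definition infty_Vstar E (A : set E) := A !=set0 /\
  forall chi : nat -> strong_dual E, weakly_null chi ->
  ereal_sup [set (modulus (chi n a))%:E | a in A] @[n --> \oo] --> 0%E.

Definition absolutely_convex E (A : set E) := forall (a b : K) x y,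
  A x -> A y -> `|a| + `|b| <= 1 -> A (a *: x + b *: y).

Definition closed_abs_convex_hull E (A : set E) : set E :=
  smallest [set C | closed C /\ absolutely_convex C] A.

Definition c0_barrelled E := forall chi : nat -> dual E,
  (forall x, chi n x @[n --> \oo] --> (0 : K^o)) ->
  equicontinuous [set: nat] (fun n (x : E) => chi n x : K^o).

(* [tvsType] does not ask its uniformity to be translation invariant, so the
   Cauchy condition is stated through the neighbourhoods of 0 rather than with
   [cauchy]. *)
Definition tvs_cauchy E (x : nat -> E) := forall U : set E, nbhs 0 U ->
  exists N, forall m n, (N <= m)%N -> (N <= n)%N -> U (x m - x n).

Definition sequentially_complete E := forall x : nat -> E,
  tvs_cauchy x -> exists l : E, x @ \oo --> l.

Definition weakly_seq_locally_complete E p := forall x : nat -> E,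
  weakly_summable p x ->
  weakly_seq_p_precompact p (closed_abs_convex_hull (range x)).

Definition weakly_p_convergent_map E L p (T : E -> L) :=
  forall (eta : nat -> strong_dual L) (x : nat -> E),
  weakly_null eta -> weakly_summable p x ->
  eta n (T (x n)) @[n --> \oo] --> (0 : K^o).

Definition p_convergent_map E L p (T : E -> L) := forall x : nat -> E,
  weakly_summable p x -> T (x n) @[n --> \oo] --> (0 : L).

Definition weakly_seq_compact_map E L p (T : E -> L) :=
  exists2 U : set E, nbhs 0 U & rel_weakly_seq_compact p (T @` U).

Definition weakly_seq_p_precompact_map E L p (T : E -> L) :=
  exists2 U : set E, nbhs 0 U & weakly_seq_p_precompact p (T @` U).

Definition weakly_seq_precompact_map E L (T : E -> L) :=
  exists2 U : set E, nbhs 0 U & weakly_seq_precompact (T @` U).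

Definition infty_Vstar_map E L (T : E -> L) :=
  exists2 U : set E, nbhs 0 U & infty_Vstar (T @` U).

End sequences_and_sets.

Section assertions.
Variables (R : realType) (k : field_kind).
Local Notation K := (scalar_field R k).
Variables (E L : tvsType K) (p : \bar R) (p1 : (1 <= p)%E) (T : operator E L).

Definition assertion_i := weakly_p_convergent_map p T.

Definition assertion_ii := forall A : set E, A !=set0 ->
  weakly_seq_p_precompact p A -> infty_Vstar (T @` A).

Definition assertion_iii := forall A : set E, A !=set0 ->
  weakly_seq_compact p A -> infty_Vstar (T @` A).

Definition assertion_iv := forall x : nat -> E,
  weakly_summable p x -> infty_Vstar (T @` range x).

Definition assertion_v :=
  forall (Z : completeNormedModType K) (S : operator L Z),
  weakly_seq_precompact_map (adjoint S) -> p_convergent_map p (S \o T).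

(* The dual of c_0 is used as it is, instead of its isometric copy l_1. *)
Definition assertion_vi := forall S : operator L (c0 R k),
  weakly_seq_precompact_map (adjoint S) -> p_convergent_map p (S \o T).

Definition assertion_vii := forall S : operator L (c0 R k),
  weakly_null (fun n => adjoint S (c0_coord R k n)) ->
  p_convergent_map p (S \o T).

Definition assertion_viii :=
  forall (X : normedModType K) (S : operator X E),
  weakly_seq_p_precompact_map p S -> infty_Vstar_map (T \o S).

Definition assertion_ix :=
  forall (X : normedModType K) (S : operator X E),
  weakly_seq_p_precompact_map p S ->
  p_convergent_map +oo%E (adjoint S \o adjoint T).

Definition assertion_x := forall S : operator (ell1_0 R k) E,
  weakly_seq_p_precompact_map p S -> infty_Vstar_map (T \o S).

Definition assertion_xi :=
  forall (Z : normedModType K) (S : operator Z E),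
  weakly_seq_compact_map p S -> infty_Vstar_map (T \o S).

Definition assertion_xii :=
  forall S : operator (ell k (hoelder_conj_ge1 p1)) E,
  infty_Vstar_map (T \o S).

End assertions.

(* Main.v *)
From HB Require Import structures.
Require Import Defs.
From mathcomp Require Import all_boot all_order all_algebra complex.
From mathcomp Require Import all_classical all_reals all_analysis.
From mathcomp Require Import ring lra.

(** The assertions are compared by moving between three kinds of objects: weakly
    p-summable sequences x of E, weakly null sequences eta of the strong dual of
    L, and operators that encode one or the other.

    The cycle from assertion_i to assertion_iv rests on one extraction of
    subsequences. If eta n stays large at points T (a n), pass to a weakly
    p-Cauchy subsequence and subtract from its m_j-th term its j-th term, with
    m_j so large that the m_j-th functional is already small at the image of the
    subtracted point: the differences are weakly p-summable and still
    contradict assertion_i ([assertion_i_implies_ii]). The way back is short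
    because the range of a weakly p-summable sequence, together with 0, is
    weakly sequentially p-compact ([summable_range_compact]).

    A weakly null sequence eta becomes the operator y |-> (eta n y) from L into
    c0, continuous when L is c0-barrelled ([sequence_operator]). The adjoint of
    that operator maps the dual unit ball into the closed absolutely convex hull
    of the eta n ([adjoint_in_hull]), so that local completeness of the dual
    makes it precompact. In the other direction, an operator R from L into a
    Banach space is tested on norming functionals, and the same extraction of
    subsequences is now made on the side of the functionals
    ([assertion_i_implies_v]).

    A weakly p-summable sequence x becomes the operator a |-> sum of the
    a i *: x i, on the span of the unit vectors of l_1
    ([finite_combination_operator]) or, if 1 < p < oo and E is sequentially
    complete, on l_q for the conjugate exponent q ([series_operator]). It sends
    unit vectors to the terms of x, so a statement about its image of the unit
    ball gives back assertion_iv. Its continuity is an instance of Mackey's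
    theorem that weakly bounded sets are bounded ([weakly_bounded_seminorm]),
    proved from the Hahn-Banach theorem by a gliding hump. Conversely every
    operator on l_q is weakly sequentially p-compact: a bounded sequence of l_q,
    minus its coordinatewise limit, has a subsequence close to disjoint blocks;
    the blocks satisfy an upper q-estimate, and duality of power sums turns the
    estimate into weak p-summability ([ell_operator_compact]). *)

Import Order.TTheory GRing.Theory Num.Theory.
Import numFieldNormedType.Exports.
Local Open Scope classical_set_scope.
Local Open Scope ring_scope.

Set Implicit Arguments.
Unset Strict Implicit.
Unset Printing Implicit Defensive.

(** * Scalars *)

Section scalars.
Variables (R : realType) (k : field_kind).
Local Notation K := (scalar_field R k).
Implicit Types (x y c : K) (r s : R).

Lemma real_scalar1 : real_scalar k (1 : R) = 1.
Proof. by case: k. Qed.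

Lemma real_scalarN r : real_scalar k (- r) = - real_scalar k r.
Proof. by case: k => //=; rewrite rmorphN. Qed.

Lemma ltr_real_scalar r s : (real_scalar k r < real_scalar k s) = (r < s).
Proof. by case: k => //=; rewrite ltcR. Qed.

Lemma modulus_real r : 0 <= r -> modulus (real_scalar k r) = r.
Proof.
move=> r0; apply: (@real_scalar_inj R k); rewrite real_scalar_modulus ger0_norm//.
by rewrite -(real_scalar0 R k) ler_real_scalar.
Qed.

Lemma ge0_real_scalarE x : 0 <= x -> x = real_scalar k (modulus x).
Proof. by move=> x0; rewrite real_scalar_modulus ger0_norm. Qed.

Lemma gt0_modulus x : 0 < x -> 0 < modulus x.
Proof.
by move=> x0; rewrite -ltr_real_scalar real_scalar0 -ge0_real_scalarE// ltW.
Qed.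

Lemma real_scalar_gt0 r : (0 < real_scalar k r) = (0 < r).
Proof. by rewrite -(real_scalar0 R k) ltr_real_scalar. Qed.

Lemma real_scalar_ge0 r : (0 <= real_scalar k r) = (0 <= r).
Proof. by rewrite -(real_scalar0 R k) ler_real_scalar. Qed.

Lemma ltr_norm_real x r : (`|x| < real_scalar k r) = (modulus x < r).
Proof. by rewrite -real_scalar_modulus ltr_real_scalar. Qed.

Lemma ler_norm_real x r : (`|x| <= real_scalar k r) = (modulus x <= r).
Proof. by rewrite -real_scalar_modulus ler_real_scalar. Qed.

Lemma modulus_norm x : modulus `|x| = modulus x.
Proof. by apply: (@real_scalar_inj R k); rewrite !real_scalar_modulus normr_id. Qed.

Lemma modulusN x : modulus (- x) = modulus x.
Proof. by rewrite -modulus_norm normrN modulus_norm. Qed.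

Lemma modulusC x y : modulus (x - y) = modulus (y - x).
Proof. by rewrite -modulusN opprB. Qed.

Lemma modulus1 : modulus (1 : K) = 1.
Proof. by rewrite -[X in modulus X]real_scalar1 modulus_real. Qed.

Lemma modulusV x : modulus x^-1 = (modulus x)^-1.
Proof.
have [->|x0] := eqVneq x 0; first by rewrite invr0 modulus0 invr0.
have mx0 : modulus x != 0 by apply: contraNN x0 => /eqP/modulus_eq0 ->.
by apply: (mulfI mx0); rewrite -modulusM !divff// modulus1.
Qed.

Lemma modulus_gt0 x : (0 < modulus x) = (x != 0).
Proof.
rewrite lt_def modulus_ge0 andbT; congr negb; apply/eqP/eqP => [/modulus_eq0//|->].
exact: modulus0.
Qed.

Lemma modulus_sum (I : Type) (s : seq I) (P : pred I) (F : I -> K) :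
  modulus (\sum_(i <- s | P i) F i) <= \sum_(i <- s | P i) modulus (F i).
Proof.
apply: (big_ind2 (fun x r => modulus x <= r)) => //; first by rewrite modulus0.
by move=> x r y r' xr yr'; apply: (le_trans (modulusD _ _)); exact: lerD.
Qed.

Lemma modulus_triangle x y c : modulus (x - c) <= modulus (x - y) + modulus (y - c).
Proof. by apply: le_trans (modulusD _ _); rewrite subrKA. Qed.

(** The norm of a complex scalar is a complex number; this trades it for a
    real one, so that every later estimate takes place in R. *)
Lemma near_modulusP (T : Type) (F : set_system T) {FF : Filter F}
    (f : T -> K^o) (l : K) :
  f @ F --> (l : K^o) <-> forall e : R, 0 < e -> \forall t \near F, modulus (f t - l) < e.
Proof.
split=> [/cvgrPdist_lt fl e e0|fl].
  have := fl (real_scalar k e); rewrite real_scalar_gt0 => /(_ e0).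
  by apply: filterS => t; rewrite ltr_norm_real modulusC.
apply/cvgrPdist_lt => e e0; have := fl _ (gt0_modulus e0).
by apply: filterS => t; rewrite modulusC -ltr_norm_real -ge0_real_scalarE ?ltW.
Qed.

Lemma cvgn_modulusP (u : nat -> K^o) (l : K) :
  u @ \oo --> (l : K^o) <->
  forall e : R, 0 < e -> exists N, forall n, (N <= n)%N -> modulus (u n - l) < e.
Proof.
split=> [/near_modulusP ul e /ul|ul].
  by move=> [N _ uN]; exists N => n; exact: uN.
by apply/near_modulusP => e /ul [N uN]; exists N => // n; exact: uN.
Qed.

Lemma cvgn0_modulusP (u : nat -> K^o) :
  u @ \oo --> (0 : K^o) <->
  forall e : R, 0 < e -> exists N, forall n, (N <= n)%N -> modulus (u n) < e.
Proof.
split=> [/cvgn_modulusP u0 e /u0 [N uN]|u0].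
  by exists N => n /uN; rewrite subr0.
by apply/cvgn_modulusP => e /u0 [N uN]; exists N => n /uN; rewrite subr0.
Qed.

Lemma realType_seq_complete (u : nat -> R) :
  (forall e : R, 0 < e ->
    exists N, forall m n, (N <= m)%N -> (N <= n)%N -> `|u m - u n| < e) ->
  exists l : R, forall e : R, 0 < e ->
    exists N, forall n, (N <= n)%N -> `|u n - l| < e.
Proof.
move=> cu; have uc : cauchy (u @ \oo).
  apply/cauchy_ballP => e e0; have [N uN] := cu e e0.
  exists ([set x | exists2 n, (N <= n)%N & x = u n],
          [set x | exists2 n, (N <= n)%N & x = u n]).
    by split; exists N => // n /= Nn; exists n.
  by move=> [_ _] [/= [m Nm ->] [n Nn ->]]; exact: uN.
have [l ul] : exists l : R, u @ \oo --> l by apply/cvg_ex; exact: cauchy_cvg.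
exists l => e e0; have /cvgrPdist_lt/(_ e e0)[N _ uN] := ul.
by exists N => n /uN; rewrite distrC.
Qed.

End scalars.

Lemma le_modulus_Re (R : realType) (z : R[i]) :
  `|complex.Re z| <= modulus (z : scalar_field R ComplexScalars).
Proof.
case: z => a b /=; rewrite -sqrtr_sqr ler_wsqrtr// lerDl sqr_ge0//.
Qed.

Lemma le_modulus_Im (R : realType) (z : R[i]) :
  `|complex.Im z| <= modulus (z : scalar_field R ComplexScalars).
Proof.
case: z => a b /=; rewrite -sqrtr_sqr ler_wsqrtr// lerDr sqr_ge0//.
Qed.

Lemma modulus_le_ReIm (R : realType) (z : R[i]) :
  modulus (z : scalar_field R ComplexScalars) <= `|complex.Re z| + `|complex.Im z|.
Proof.
case: z => a b /=; rewrite -[leRHS]ger0_norm ?addr_ge0// -sqrtr_sqr ler_wsqrtr//.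
rewrite sqrrD !real_normK ?num_real// -addrA lerD2l lerDr mulrn_wge0// mulr_ge0//.
Qed.

Lemma scalar_seq_complete (R : realType) (k : field_kind) (u : nat -> scalar_field R k) :
  (forall e : R, 0 < e ->
    exists N, forall m n, (N <= m)%N -> (N <= n)%N -> modulus (u m - u n) < e) ->
  exists l, (u : nat -> (scalar_field R k)^o) @ \oo --> (l : (scalar_field R k)^o).
Proof.
case: k u => u cu.
  have [l ul] := realType_seq_complete cu.
  by exists l; apply/(@cvgn_modulusP R RealScalars).
have [|a ra] := @realType_seq_complete R (fun n => complex.Re (u n)).
  move=> e /cu [N uN]; exists N => m n Nm Nn.
  by apply: le_lt_trans (uN _ _ Nm Nn); rewrite -raddfB le_modulus_Re.
have [|b rb] := @realType_seq_complete R (fun n => complex.Im (u n)).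
  move=> e /cu [N uN]; exists N => m n Nm Nn.
  by apply: le_lt_trans (uN _ _ Nm Nn); rewrite -raddfB le_modulus_Im.
exists (a +i* b)%C; apply/(@cvgn_modulusP R ComplexScalars) => e e0.
have e20 : 0 < e / 2 by rewrite divr_gt0.
have [N aN] := ra _ e20; have [M bM] := rb _ e20.
exists (maxn N M) => n; rewrite geq_max => /andP[Nn Mn].
apply: le_lt_trans (modulus_le_ReIm _) _; rewrite [ltRHS]splitr ltrD//.
  by rewrite raddfB; exact: aN.
by rewrite raddfB; exact: bM.
Qed.

(** * Seminorms and the Hahn-Banach theorem *)

Section seminorms.
Variables (R : realType) (k : field_kind).
Local Notation K := (scalar_field R k).

Definition seminorm (E : lmodType K) (q : E -> R) :=
  (forall x y, q (x + y) <= q x + q y) /\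
  (forall c x, q (c *: x) = modulus c * q x).

Variables (E : lmodType K) (q : E -> R).
Hypothesis sq : seminorm q.

Lemma seminormD x y : q (x + y) <= q x + q y. Proof. exact: sq.1. Qed.
Lemma seminormZ c x : q (c *: x) = modulus c * q x. Proof. exact: sq.2. Qed.

Lemma seminorm0 : q 0 = 0.
Proof. by rewrite -(scale0r 0) seminormZ modulus0 mul0r. Qed.

Lemma seminormN x : q (- x) = q x.
Proof. by rewrite -scaleN1r seminormZ modulusN modulus1 mul1r. Qed.

Lemma seminorm_ge0 x : 0 <= q x.
Proof.
by have := seminormD x (- x); rewrite subrr seminorm0 seminormN -mulr2n pmulrn_lge0.
Qed.

Lemma seminorm_sum (I : Type) (s : seq I) (P : pred I) (F : I -> E) :
  q (\sum_(i <- s | P i) F i) <= \sum_(i <- s | P i) q (F i).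
Proof.
apply: (big_ind2 (fun x r => q x <= r)) => //; first by rewrite seminorm0.
by move=> x r y r' xr yr'; apply: (le_trans (seminormD _ _)); exact: lerD.
Qed.

Lemma seminormB x y : q (x - y) <= q x + q y.
Proof. by rewrite -(seminormN y) seminormD. Qed.

End seminorms.

Section hahn_banach.
Variables (R : realType) (k : field_kind).
Local Notation K := (scalar_field R k).
Local Notation rs := (@real_scalar R k).
Variables (E : lmodType K) (q : E -> R).
Hypothesis sq : seminorm q.
Implicit Types (x y : E) (r s t : R).

(** Graphs of real-linear functionals defined on real subspaces and lying
    below q. Single-valuedness is a consequence, as q vanishes at 0, and
    extension of functionals is inclusion of graphs. *)
Definition dominated_graph (G : set (E * R)) :=
  (forall x y r s t, G (x, r) -> G (y, s) -> G (x + rs t *: y, r + t * s)) /\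
  (forall x r, G (x, r) -> r <= q x).

Lemma dominated_graph0 (G : set (E * R)) : dominated_graph G -> G !=set0 -> G (0, 0).
Proof.
move=> [GD _] [[x r] Gxr]; have := GD _ _ _ _ (-1) Gxr Gxr.
by rewrite mulN1r real_scalarN real_scalar1 scaleN1r !subrr.
Qed.

Lemma dominated_graph_line (a : E) :
  dominated_graph [set z | exists t, z = (rs t *: a, t * q a)].
Proof.
split=> [x y r s t [t1 [-> ->]] [t2 [-> ->]]|x r [t [-> ->]]].
  exists (t1 + t * t2); rewrite real_scalarD real_scalarM scalerDl scalerA.
  by rewrite mulrDl mulrA.
rewrite (seminormZ sq); apply: ler_wpM2r; first exact: (seminorm_ge0 sq).
have [t0|t0] := leP 0 t; first by rewrite modulus_real.
by rewrite (le_trans (ltW t0))// modulus_ge0.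
Qed.

(** The value c at the new direction x0 has to lie above every r - q (y - x0)
    and below every s - q (z + x0). Subadditivity of q puts each of the former
    below each of the latter, and c is the supremum of the former. *)
Lemma dominated_graph_extend (G : set (E * R)) (x0 : E) :
  dominated_graph G -> G !=set0 ->
  exists c, dominated_graph [set z | exists x r t,
    G (x, r) /\ z = (x + rs t *: x0, r + t * c)].
Proof.
move=> gG G0; have [GD Gq] := gG; have G00 := dominated_graph0 gG G0.
pose S := [set s | exists y r, G (y, r) /\ s = r - q (y - x0)].
have Sub z s : G (z, s) -> ubound S (q (z + x0) - s).
  move=> Gz _ [y [r [Gy ->]]]; rewrite lerBlDr addrAC lerBrDr.
  have := GD _ _ _ _ 1 Gy Gz; rewrite real_scalar1 scale1r mul1r => /Gq h.
  apply: (le_trans h).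
  have -> : y + z = (z + x0) + (y - x0) by rewrite addrC addrACA subrr addr0.
  exact: (seminormD sq).
have S0 : S !=set0 by exists (0 - q (0 - x0)), 0, 0.
have Sbd : has_ubound S by exists (q (0 + x0) - 0); exact: Sub.
pose c := sup S.
have cl y r : G (y, r) -> r - q (y - x0) <= c.
  by move=> Gy; apply: ub_le_sup => //; exists y, r.
have cu z s : G (z, s) -> c <= q (z + x0) - s.
  by move=> Gz; apply: ge_sup => //; exact: Sub.
have GZ y r t : G (y, r) -> G (rs t *: y, t * r).
  by move=> Gy; have := GD _ _ _ _ t G00 Gy; rewrite !add0r.
exists c; split=> [x y r s t|x r [y [s [t [Gy [-> ->]]]]]].
  move=> [x' [r' [t1 [Gx [-> ->]]]]] [y' [s' [t2 [Gy [-> ->]]]]].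
  exists (x' + rs t *: y'), (r' + t * s'), (t1 + t * t2); split; first exact: GD.
  congr (_, _); last by ring.
  by rewrite scalerDr addrACA real_scalarD real_scalarM scalerDl !scalerA.
(* For t nonzero, division by the modulus of t leaves one of the two bounds
   that define c. *)
have [t0|t0|->] := ltgtP t 0; last first.
- by rewrite real_scalar0 scale0r mul0r !addr0; exact: Gq.
- have := cu _ _ (GZ _ _ t^-1 Gy); rewrite -(ler_pM2l t0) mulrBr mulVKf ?gt_eqF//.
  rewrite -{2}(modulus_real k (ltW t0)) -(seminormZ sq) scalerDr scalerA.
  rewrite -real_scalarM divff ?gt_eqF// real_scalar1 scale1r.
  by rewrite lerBrDl.
- have nt0 : 0 < - t by rewrite oppr_gt0.
  have := cl _ _ (GZ _ _ (- t)^-1 Gy); rewrite -(ler_pM2l nt0) mulrBr mulVKf ?gt_eqF//.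
  rewrite -{1}(modulus_real k (ltW nt0)) -(seminormZ sq) scalerBr scalerA.
  rewrite -real_scalarM divff ?gt_eqF// real_scalar1 scale1r.
  rewrite real_scalarN scaleNr opprK mulNr.
  by rewrite lerBlDr addrC lerBrDr.
Qed.

(** Zorn applied to the dominated graphs that are empty or contain (a, q a);
    allowing the empty graph gives the empty chain its union. *)
Lemma real_hahn_banach (a : E) : exists u : E -> R,
  [/\ forall x y, u (x + y) = u x + u y, forall t x, u (rs t *: x) = t * u x,
      forall x, u x <= q x & u a = q a].
Proof.
pose P := [set G | dominated_graph G /\ (G !=set0 -> G (a, q a))].
have line0 : [set z | exists t, z = (rs t *: a, t * q a)] (a, q a).
  by exists 1; rewrite real_scalar1 scale1r mul1r.
have [F FP Ftot|A [[gA A0] Amax]] := @Zorn_bigcup _ P.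
  split; last by move=> [z [G FG Gz]]; exists G => //; apply: (FP _ FG).2; exists z.
  split=> [x y r s t [G FG Gx] [H FH Hy]|x r [G FG]]; last exact: (FP _ FG).1.2.
  have [GH|HG] := Ftot _ _ FG FH.
    by exists H => //; apply: (FP _ FH).1.1 => //; exact: GH.
  by exists G => //; apply: (FP _ FG).1.1 => //; exact: HG.
have Aa : A (a, q a).
  apply: A0; apply: contrapT => nA; have {}nA : A = set0.
    by rewrite -subset0 => z Az; apply: nA; exists z.
  apply: (Amax [set z | exists t, z = (rs t *: a, t * q a)]).
    by rewrite nA; split=> // h; have := h _ line0.
  by split=> //; exact: dominated_graph_line.
have An0 : A !=set0 by exists (a, q a).
have Atot x : exists r, A (x, r).
  apply: contrapT => nx; have [c gB] := dominated_graph_extend x gA An0.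
  apply: (Amax _ _ (conj gB _)).
    split=> [[y r] Ay|h].
      by exists y, r, 0; rewrite real_scalar0 scale0r mul0r !addr0.
    apply: nx; exists c; apply: h; exists 0, 0, 1.
    by rewrite real_scalar1 scale1r mul1r !add0r; split=> //; exact: dominated_graph0.
  by move=> _; exists a, (q a), 0; rewrite real_scalar0 scale0r mul0r !addr0.
have [AD Aq] := gA.
have Ale x r s : A (x, r) -> A (x, s) -> r <= s.
  move=> Ar As; have := Aq _ _ (AD _ _ _ _ (-1) Ar As).
  by rewrite real_scalarN real_scalar1 scaleN1r subrr (seminorm0 sq) mulN1r subr_le0.
have Auniq x r s : A (x, r) -> A (x, s) -> r = s.
  by move=> Ar As; apply/le_anti; rewrite !(Ale x).
have [u Au] := choice Atot; exists u.
have A00 := dominated_graph0 gA An0.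
split=> [x y|t x|x|]; last 2 first.
- exact: Aq.
- exact: (Auniq a).
- apply: (Auniq (x + y)) => //.
  by have := AD _ _ _ _ 1 (Au x) (Au y); rewrite real_scalar1 scale1r mul1r.
- apply: (Auniq (rs t *: x)) => //.
  by have := AD _ _ _ _ t A00 (Au x); rewrite !add0r.
Qed.

End hahn_banach.

(** A complex functional is determined by its real part u as u x - i u (i x).
    Multiplying x by a scalar of modulus 1 makes f x real, so that |f x|
    becomes a value of u and is bounded by q x. *)
Lemma hahn_banach (R : realType) (k : field_kind) (E : lmodType (scalar_field R k))
    (q : E -> R) (sq : seminorm q) (a : E) :
  exists f : E -> (scalar_field R k)^o,
    [/\ linear f, forall x, modulus (f x) <= q x & q a <= modulus (f a)].
Proof.
case: k E q sq a => E q sq a; have [u [uD uZ uq ua]] := real_hahn_banach sq a.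
  have uN x : u (- x) = - u x.
    by rewrite -scaleN1r (uZ (-1)) mulN1r.
  exists u; split=> [c x y|x|]; first by rewrite uD uZ.
    by rewrite /= ler_norml uq andbT lerNl -uN -(seminormN sq) uq.
  by rewrite /= -ua ler_norm.
have uN x : u (- x) = - u x.
  by have := uZ (-1) x; rewrite real_scalarN real_scalar1 scaleN1r mulN1r.
pose f x : R[i]^o := (u x +i* - u ('i *: x))%C.
have fl : linear f.
  move=> c x y; rewrite /f; case: c => r s.
  have cE : (r +i* s)%C *: x = real_scalar ComplexScalars r *: x +
     real_scalar ComplexScalars s *: ('i *: x).
    rewrite scalerA -scalerDl; congr (_ *: _); apply/eqP.
    by rewrite eq_complex /= ; simpc.
  have iE : 'i *: ((r +i* s)%C *: x) = real_scalar ComplexScalars r *: ('i *: x) -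
     real_scalar ComplexScalars s *: x.
    rewrite !scalerA -scalerBl; congr (_ *: _); apply/eqP.
    by rewrite eq_complex /= ; simpc.
  rewrite scalerDr !uD iE cE !uD uN !uZ; apply/eqP.
  by rewrite eq_complex /=; apply/andP; split; apply/eqP; ring.
have fq x : modulus (f x : scalar_field R ComplexScalars) <= q x.
  have [->|fx0] := eqVneq (f x) 0.
    by rewrite (modulus0 R ComplexScalars) (seminorm_ge0 sq).
  pose c : scalar_field R ComplexScalars := `|f x| / f x.
  have c1 : modulus c = 1.
    by rewrite modulusM modulusV modulus_norm divff// gt_eqF// modulus_gt0.
  have fc : f (c *: x) = real_scalar ComplexScalars (modulus (f x : scalar_field R ComplexScalars)).
    rewrite real_scalar_modulus -[RHS](divfK fx0) -/c.
    by have := fl c x 0; rewrite addr0 => ->; rewrite [f 0](_ : _ = 0) ?addr0//;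
      have := fl (-1) 0 0; rewrite scaler0 addr0 scaleN1r addNr.
  by rewrite -[leRHS]mul1r -c1 -(seminormZ sq)
    -[leLHS]/(complex.Re (real_scalar ComplexScalars _)) -fc uq.
exists f; split => //.
rewrite -ua; apply: le_trans (ler_norm _) _.
exact: (le_modulus_Re (f a)).
Qed.

(** * Continuous seminorms of locally convex spaces *)

Section operator_algebra.
Variables (K : numFieldType) (E L : tvsType K) (f : operator E L).

Lemma operator0 : f 0 = 0.
Proof.
have [lf _] := operatorP f.
by have := lf (-1) 0 0; rewrite scaler0 addr0 scaleN1r addNr.
Qed.

Lemma operatorD x y : f (x + y) = f x + f y.
Proof. by have [lf _] := operatorP f; have := lf 1 x y; rewrite !scale1r. Qed.

Lemma operatorZ c x : f (c *: x) = c *: f x.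
Proof.
by have [lf _] := operatorP f; have := lf c x 0; rewrite operator0 !addr0.
Qed.

Lemma operatorN x : f (- x) = - f x.
Proof. by rewrite -scaleN1r operatorZ scaleN1r. Qed.

Lemma operatorB x y : f (x - y) = f x - f y.
Proof. by rewrite operatorD operatorN. Qed.

Lemma operator_sum (I : Type) (s : seq I) (P : pred I) (F : I -> E) :
  f (\sum_(i <- s | P i) F i) = \sum_(i <- s | P i) f (F i).
Proof. exact: (big_morph _ operatorD operator0). Qed.

Lemma operator_nbhs0 (V : set L) : nbhs 0 V -> nbhs 0 [set x | V (f x)].
Proof. by have [_ cf] := operatorP f; move: (cf 0 V); rewrite operator0. Qed.

End operator_algebra.

(** Neighbourhoods are translates of neighbourhoods of 0, addition being
    continuous. *)
Lemma linear_continuous0 (K : numFieldType) (E L : tvsType K) (f : E -> L) :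
  linear f -> (forall V, nbhs 0 V -> nbhs 0 [set x | V (f x)]) -> continuous f.
Proof.
move=> lf cf x A Afx.
have fD y z : f (y + z) = f y + f z by have := lf 1 y z; rewrite !scale1r.
have /cf W : nbhs 0 [set y | A (f x + y)].
  apply: filterS (_ : nbhs 0 (+%R (- f x) @` A)) => [_ [y Ay <-]|].
    by rewrite /= addNKr.
  by rewrite -(addNr (f x)); exact: nbhsB.
apply: filterS (nbhsT x W) => _ [y /= Ay <-].
by rewrite /= fD.
Qed.

Section continuous_seminorms.
Variables (R : realType) (k : field_kind).
Local Notation K := (scalar_field R k).
Local Notation rs := (@real_scalar R k).

Definition continuous_seminorm (E : tvsType K) (q : E -> R) :=
  seminorm q /\ forall e : R, 0 < e -> nbhs 0 [set x | q x < e].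

Lemma continuous_seminorm_comp (E L : tvsType K) (f : operator E L) q :
  continuous_seminorm q -> continuous_seminorm (q \o f).
Proof.
move=> [sq q0]; split; last by move=> e e0; exact: (operator_nbhs0 f (q0 e e0)).
split=> [x y|c x] /=; first by rewrite operatorD (seminormD sq).
by rewrite operatorZ (seminormZ sq).
Qed.

Lemma continuous_seminormZ (E : tvsType K) (q : E -> R) (M : R) :
  0 < M -> continuous_seminorm q -> continuous_seminorm (fun x => M * q x).
Proof.
move=> M0 [sq q0]; split; [split=> [x y|c x]|move=> e e0].
- by rewrite -mulrDr ler_wpM2l ?(ltW M0)// (seminormD sq).
- by rewrite (seminormZ sq) mulrCA.
- apply: filterS (q0 (e / M) _) => [x|]; last by rewrite divr_gt0.
  by rewrite /= ltr_pdivlMr// mulrC.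
Qed.

Section gauge.
Variables (E : tvsType K) (C : set E).
Hypotheses (C0 : nbhs 0 C) (Cconvex : convex_set C).

(* The largest balanced subset of C; scaling being continuous at (0, 0), it is
   still a neighbourhood of 0, and it inherits the convexity of C. *)
Let U : set E := [set x | forall c : K, modulus c <= 1 -> C (c *: x)].

Let S (x : E) : set R := [set t | 0 < t /\ U (rs t^-1 *: x)].

(* The gauge of U. *)
Let q (x : E) : R := inf (S x).

Let UZ c x : modulus c <= 1 -> U x -> U (c *: x).
Proof.
by move=> c1 Ux d d1; rewrite scalerA; apply: Ux; rewrite modulusM mulr_ile1 ?modulus_ge0.
Qed.

Let Uconvex x y (t : R) : 0 <= t <= 1 -> U x -> U y ->
  U (rs t *: x + rs (1 - t) *: y).
Proof.
move=> /andP[t0 t1] Ux Uy c c1; rewrite scalerDr !scalerA ![c * _]mulrC -!scalerA.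
have p0 : 0 <= rs t by rewrite real_scalar_ge0.
have p1 : rs t <= 1 by rewrite -(real_scalar1 R k) ler_real_scalar.
have := @Cconvex (c *: x) (c *: y) (Itv01 p0 p1).
rewrite !inE => /(_ (Ux c c1) (Uy c c1)).
by rewrite real_scalarD real_scalarN real_scalar1.
Qed.

Let U0 : nbhs 0 U.
Proof.
have := @scale_continuous K E (0, 0) C; rewrite /= scaler0 => /(_ C0).
move=> [[A B] /= [/nbhs_ballP[d /= d0 dA] B0] ABC].
pose t := modulus d / 2.
have t0 : 0 < t by rewrite divr_gt0// gt0_modulus.
have rt0 : rs t != 0 by rewrite gt_eqF// real_scalar_gt0.
apply: filterS (nbhs0Z rt0 B0) => _ [b Bb <-] c c1.
rewrite scalerA; apply: (ABC (c * rs t, b)); split => //=; apply: dA.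
rewrite -ball_normE /= sub0r normrN (ge0_real_scalarE (ltW d0)) ltr_norm_real.
rewrite modulusM modulus_real ?ltW//; apply: (@le_lt_trans _ _ t).
  by rewrite ler_piMl// ltW.
by rewrite /t ltr_pdivrMr// ltr_pMr ?ltr1n// gt0_modulus.
Qed.

Let S_nonempty x : S x !=set0.
Proof.
have := @scale_continuous K E (0, x) U; rewrite /= scale0r => /(_ U0).
move=> [[A B] /= [/nbhs_ballP[d /= d0 dA] Bx] ABC].
have dm := gt0_modulus d0; pose t := modulus d / 2.
have t0 : 0 < t by rewrite divr_gt0.
exists t^-1; split; first by rewrite invr_gt0.
rewrite invrK; apply: (ABC (rs t, x)); split => /=; last exact: nbhs_singleton Bx.
apply: dA; rewrite -ball_normE /= sub0r normrN (ge0_real_scalarE (ltW d0)) ltr_norm_real.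
by rewrite modulus_real ?ltW// /t ltr_pdivrMr// ltr_pMr ?ltr1n.
Qed.

Let S_lb x : has_lbound (S x).
Proof. by exists 0 => t [t0 _]; exact: ltW. Qed.

Let q_le x t : S x t -> q x <= t.
Proof. by move=> St; apply: ge_inf. Qed.

Let le_q x (m : R) : (forall t, S x t -> m <= t) -> m <= q x.
Proof. by move=> h; apply: lb_le_inf. Qed.

Let q_scale_le c x : c != 0 -> q (c *: x) <= modulus c * q x.
Proof.
move=> c0; have mc : 0 < modulus c by rewrite modulus_gt0.
rewrite mulrC -ler_pdivrMr//; apply: le_q => t [t0 Ut].
rewrite ler_pdivrMr//; apply: q_le; split; first by rewrite mulr_gt0.
rewrite invfM real_scalarM scalerA -mulrA mulrC -scalerA; apply: UZ => //.
rewrite modulusM modulus_real ?invr_ge0 ?modulus_ge0//.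
by rewrite mulVf// gt_eqF.
Qed.

Lemma convex_nbhs_seminorm : exists2 q : E -> R, continuous_seminorm q &
  [set x | q x < 1] `<=` C.
Proof.
have q0 : q 0 = 0.
  apply/le_anti/andP; split; last by apply: le_q => t [/ltW].
  apply/ler_addgt0Pl => e e0; rewrite addr0; apply: q_le; split=> //.
  by rewrite scaler0; exact: nbhs_singleton U0.
exists q.
  split; [split|].
  - move=> x y; rewrite -lerBlDr; apply: le_q => t [t0 Ut].
    rewrite lerBlDr -lerBlDl; apply: le_q => s [s0 Us].
    rewrite lerBlDl (addrC t s); apply: q_le; have st0 : 0 < s + t by rewrite addr_gt0.
    split=> //.
    have h : 0 <= t / (s + t) <= 1.
      by rewrite (divr_ge0 (ltW t0) (ltW st0))/= ler_pdivrMr// mul1r lerDr ltW.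
    have := Uconvex h Ut Us; rewrite !scalerA -!real_scalarM.
    have -> : (1 - t / (s + t)) * s^-1 = (s + t)^-1 by field; rewrite !gt_eqF.
    have -> : t / (s + t) * t^-1 = (s + t)^-1 by field; rewrite !gt_eqF.
    by rewrite -scalerDr.
  - move=> c x; have [->|c0] := eqVneq c 0.
      by rewrite scale0r modulus0 mul0r q0.
    apply/le_anti; rewrite q_scale_le//=.
    rewrite -ler_pdivlMl ?modulus_gt0// -modulusV.
    have := @q_scale_le c^-1 (c *: x); rewrite invr_eq0 c0 scalerA mulVf// scale1r.
    exact.
  - move=> e e0; have e20 : 0 < e / 2 by rewrite divr_gt0.
    have re : rs (e / 2) != 0 by rewrite gt_eqF// real_scalar_gt0.
    apply: filterS (nbhs0Z re U0) => _ [u Uu <-] /=.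
    apply: (@le_lt_trans _ _ (e / 2)); last by rewrite ltr_pdivrMr// ltr_pMr ?ltr1n.
    apply: q_le; split=> //.
    by rewrite scalerA -real_scalarM mulVf ?gt_eqF// real_scalar1 scale1r.
move=> x /= qx1.
have [t [t0 Ut] t1] : exists2 t, S x t & t < 1.
  apply: contrapT => h; move: qx1; apply/negP; rewrite -leNgt; apply: le_q => t St.
  by rewrite leNgt; apply/negP => t1; apply: h; exists t.
have := Ut (rs t); rewrite modulus_real ?ltW// => /(_ isT).
by rewrite scalerA -real_scalarM divff ?gt_eqF// real_scalar1 scale1r.
Qed.

End gauge.

Lemma nbhs0_seminorm (E : tvsType K) (V : set E) : nbhs 0 V ->
  exists2 q : E -> R, continuous_seminorm q & [set x | q x < 1] `<=` V.
Proof.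
have [B Bconvex [Bopen Bbasis]] := @locally_convex K E.
move=> /Bbasis[C [BC C0] CV].
have [|q cq qC] := @convex_nbhs_seminorm E C _ (Bconvex _ (mem_set BC)).
  by apply: open_nbhs_nbhs; split => //; exact: Bopen.
by exists q => // x /qC /CV.
Qed.

(** Continuity between locally convex spaces is domination of seminorms. *)
Lemma dominated_linear_continuous (E L : tvsType K) (f : E -> L) : linear f ->
  (forall q, continuous_seminorm q -> exists2 r, continuous_seminorm r &
     forall x, q (f x) <= r x) -> continuous f.
Proof.
move=> lf fq; apply: linear_continuous0 => // V /nbhs0_seminorm[q cq qV].
have [r [_ r0] fr] := fq q cq.
by apply: filterS (r0 1 ltr01) => x /= rx; apply: qV; apply: le_lt_trans rx.
Qed.

End continuous_seminorms.

(** * Weakly bounded sets *)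

Section bounded_sets.
Variables (R : realType) (k : field_kind).
Local Notation K := (scalar_field R k).
Local Notation rs := (@real_scalar R k).

Lemma dominated_functional (E : tvsType K) (q : E -> R) (f : E -> K^o) :
  linear f -> continuous_seminorm q -> (forall x, modulus (f x) <= q x) ->
  f \in @is_operator K E K^o.
Proof.
move=> lf [_ q0] fq; rewrite inE; split=> //; apply: linear_continuous0 => // V.
move=> /nbhs_ballP[d /= d0 dV]; apply: filterS (q0 _ (gt0_modulus d0)) => x /= qx.
apply: dV; rewrite -ball_normE /= sub0r normrN (ge0_real_scalarE (ltW d0)) ltr_norm_real.
exact: le_lt_trans qx.
Qed.

(** Hahn-Banach for a continuous seminorm, with the continuous functional that
    it provides. *)
Lemma seminorm_functional (E : tvsType K) (q : E -> R) (a : E) :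
  continuous_seminorm q ->
  exists f : dual E, (forall x, modulus (f x) <= q x) /\ q a <= modulus (f a).
Proof.
move=> cq; have [f [lf fq fa]] := hahn_banach cq.1 a.
by exists (Operator (dominated_functional lf cq fq)).
Qed.

Lemma functional_seminorm (E : tvsType K) (chi : dual E) :
  continuous_seminorm (fun x => modulus (chi x)).
Proof.
split; [split=> [x y|c x]|move=> e e0].
- by rewrite operatorD modulusD.
- by rewrite operatorZ modulusM.
- have : nbhs (0 : K^o) (ball (0 : K^o) (rs e)).
    by apply: nbhsx_ballx; rewrite real_scalar_gt0.
  move=> /(operator_nbhs0 chi); apply: filterS => x /=.
  by rewrite -ball_normE /= sub0r normrN ltr_norm_real.
Qed.

Section weakly_bounded.
Variables (E : tvsType K) (A : set E) (q : E -> R).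
Hypotheses (cq : continuous_seminorm q)
  (wA : forall chi : dual E, exists M : R, forall a, A a -> modulus (chi a) <= M)
  (uq : forall M : R, exists2 a, A a & M < q a).

Let bound_dual (chi : dual E) : exists M : R, 0 <= M /\ forall a, A a -> modulus (chi a) <= M.
Proof.
have [M hM] := wA chi; exists (Num.max 0 M); split=> [|a /hM aM].
  by rewrite le_max lexx.
by rewrite le_max aM orbT.
Qed.

(** With f = af.2, the summand 4 ^- n f has at the point af.1 a modulus at
    least twice the sum of n and of B ng.2, the bound for what the functional
    ng.2 can contribute there. *)
Let hump (B : dual E -> R) (ng : nat * dual E) : exists af : E * dual E,
  [/\ A af.1, forall x, modulus (af.2 x) <= q x,
      2 * 4 ^+ ng.1 * (B ng.2 + ng.1%:R) <= q af.1 & q af.1 <= modulus (af.2 af.1)].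
Proof.
have [a Aa qa] := uq (2 * 4 ^+ ng.1 * (B ng.2 + ng.1%:R)).
have [f [fq fa]] := seminorm_functional a cq.
by exists (a, f); split => //; exact: ltW.
Qed.

Section limit_functional.
Variables (g : nat -> dual E) (g00 : forall x, g 0%N x = 0).
Hypothesis gS : forall n x, modulus (g n.+1 x - g n x) <= 4^-1 ^+ n * q x.

Let g_tail n j x :
  modulus (g (n + j)%N x - g n x) <= 4 / 3 * (4^-1 ^+ n - 4^-1 ^+ (n + j)) * q x.
Proof.
elim: j => [|j ih]; first by rewrite addn0 !subrr modulus0 mulr0 mul0r.
apply: (le_trans (modulus_triangle _ (g (n + j)%N x) _)); rewrite addnS addrC.
apply: (le_trans (lerD ih (gS _ _))); rewrite -mulrDl ler_wpM2r//.
  exact: (seminorm_ge0 cq.1).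
by rewrite exprS; lra.
Qed.

(** The increments are at most 4 ^- n q, and the sum of 4 ^- j over j >= n is
    4 / 3 times 4 ^- n. *)
Lemma limit_functional : exists h : dual E, forall n x,
  modulus (h x - g n x) <= 4 / 3 * 4^-1 ^+ n * q x.
Proof.
have q0 := seminorm_ge0 cq.1.
have g_le n j x : modulus (g (n + j)%N x - g n x) <= 4 / 3 * 4^-1 ^+ n * q x.
  apply: (le_trans (g_tail n j x)); rewrite ler_wpM2r// ler_wpM2l//.
  by rewrite lerBlDr lerDl exprn_ge0.
have small (c e : R) : 0 <= c -> 0 < e -> exists n, 4 / 3 * 4^-1 ^+ n * c < e.
  move=> c0 e0.
  have d0 : 0 < e / (4 / 3 * (c + 1)) by rewrite divr_gt0// mulr_gt0// ltr_wpDl.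
  have h41 : `|4^-1 : R| < 1 by rewrite gtr0_norm// invf_lt1// ltr1n.
  have /cvgrPdist_lt/(_ _ d0)[N _ /(_ N (leqnn N))] := cvg_expr h41.
  rewrite /= sub0r normrN ger0_norm ?exprn_ge0// => h; exists N.
  move: h; rewrite ltr_pdivlMr ?mulr_gt0// ?ltr_wpDl// => h; apply: le_lt_trans h.
  rewrite mulrA [_ * (4/3)]mulrC ler_wpM2l ?mulr_ge0 ?exprn_ge0//.
  by rewrite lerDl.
have cv x : exists l : K, (fun n => g n x : K^o) @ \oo --> (l : K^o).
  apply: scalar_seq_complete => e e0.
  have [N hN] := small (q x) (e / 2) (q0 _) (divr_gt0 e0 (ltr0n _ 2)).
  exists N => m n Nm Nn; apply: (le_lt_trans (modulus_triangle _ (g N x) _)).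
  rewrite (splitr e) ltrD//.
    by rewrite -(subnKC Nm); exact: le_lt_trans (g_le _ _ _) hN.
  by rewrite modulusC -(subnKC Nn); exact: le_lt_trans (g_le _ _ _) hN.
have [h gh] := choice cv.
have hg n x : modulus (h x - g n x) <= 4 / 3 * 4^-1 ^+ n * q x.
  apply/ler_addgt0Pr => e e0; have [N hN] := (cvgn_modulusP _ _).1 (gh x) e e0.
  apply: (le_trans (modulus_triangle _ (g (n + N)%N x) _)); rewrite addrC.
  by apply: lerD; [exact: g_le|rewrite modulusC ltW// hN// leq_addl].
have lh : linear (h : E -> K^o).
  move=> c x y; apply: (cvg_unique (@norm_hausdorff _ _) (gh (c *: x + y))).
  rewrite [X in X @ _](_ : _ = (fun n => c *: (g n x : K^o) + g n y)); last first.
    by apply/funext => n; rewrite operatorD operatorZ.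
  by apply: cvgD; [apply: cvgZr; exact: gh|exact: gh].
have hq x : modulus (h x) <= 4 / 3 * q x.
  by have := hg 0%N x; rewrite g00 subr0 expr0 mulr1.
have cq' : continuous_seminorm (fun x => 4 / 3 * q x) by exact: continuous_seminormZ.
by exists (Operator (dominated_functional lh cq' hq)).
Qed.

End limit_functional.

(** A gliding hump. In h = sum of 4 ^- n f_n, the n-th summand has modulus at
    least u = 4 ^- n q(a_n) at the point a_n, the later ones contribute at
    most u / 3, and the earlier ones at most B (g n), while u >= 2 (B (g n) +
    n). So |h (a_n)| >= n for all n, although h is bounded on A. *)
Lemma weakly_bounded_not_unbounded : False.
Proof.
have q0 := seminorm_ge0 cq.1.
have [B /all_and2[B0 BA]] := choice bound_dual.
have [aF haF] := choice (hump B).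
pose g := fix g n : dual E := if n is m.+1
  then rs (4^-1 ^+ m) *: (aF (m, g m)).2 + g m else 0.
have gE n x : g n.+1 x = rs (4^-1 ^+ n) * (aF (n, g n)).2 x + g n x by [].
have [//|n x|h hg] := @limit_functional g.
  rewrite gE addrK modulusM modulus_real ?exprn_ge0//.
  by rewrite ler_wpM2l ?exprn_ge0//; have [_ + _ _] := haF (n, g n); exact.
suff nB n : n%:R <= B h.
  have := archi_boundP (B0 h); rewrite ltNge => /negP; apply; exact: nB.
have [/= Aa Fq aB aF'] := haF (n, g n).
set a := (aF (n, g n)).1 in Aa aB aF'; set F := (aF (n, g n)).2 in Fq aF'.
apply: le_trans (BA h a Aa).
have h1 : 4^-1 ^+ n * q a <= modulus (g n.+1 a - g n a).
  by rewrite gE addrK modulusM modulus_real ?exprn_ge0// ler_wpM2l ?exprn_ge0.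
have h2 := hg n.+1 a; rewrite modulusC in h2.
have h3 := BA (g n) a Aa.
have h4 : modulus (g n.+1 a - g n a) <=
    modulus (g n.+1 a - h a) + (modulus (h a) + modulus (g n a)).
  apply: (le_trans (modulus_triangle _ (h a) _)); rewrite lerD2l -[modulus (g n a)]modulusN.
  exact: modulusD.
have h5 : 2 * (B (g n) + n%:R) <= 4^-1 ^+ n * q a.
  have := ler_wpM2l (exprn_ge0 n (_ : 0 <= 4^-1 :> R)) aB.
  have e : 4^-1 ^+ n * 4 ^+ n = 1 :> R by rewrite -exprMn mulVf ?expr1n.
  by rewrite mulrA (mulrCA _ 2) e mulr1; apply.
move: h1 h2 h3 h4 h5 (B0 (g n)) (ler0n R n).
have -> : 4 / 3 * 4^-1 ^+ n.+1 * q a = 3^-1 * (4^-1 ^+ n * q a).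
  by rewrite exprS; field.
move: (4^-1 ^+ n * q a) => u; lra.
Qed.

End weakly_bounded.

(** Mackey's theorem: weakly bounded sets are bounded. *)
Lemma weakly_bounded_seminorm (E : tvsType K) (A : set E) (q : E -> R) :
  continuous_seminorm q ->
  (forall chi : dual E, exists M : R, forall a, A a -> modulus (chi a) <= M) ->
  exists M : R, forall a, A a -> q a <= M.
Proof.
move=> cq wA; apply: contrapT => nM; apply: (weakly_bounded_not_unbounded cq wA) => M.
apply: contrapT => h; apply: nM; exists M => a Aa; rewrite leNgt; apply/negP => Ma.
by apply: h; exists a.
Qed.

End bounded_sets.

(** * Summable and weakly summable sequences *)

Section power_sums.
Variables (R : realType) (k : field_kind).
Local Notation K := (scalar_field R k).
Implicit Types (b : nat -> K) (p : R).

Definition power_sum p b N := \sum_(0 <= i < N) modulus (b i) `^ p.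

Lemma power_sum_ge0 p b N : 0 <= power_sum p b N.
Proof. by apply: sumr_ge0 => i _; exact: powR_ge0. Qed.

Lemma power_sum_mono p b : {homo power_sum p b : m n / (m <= n)%N >-> m <= n}.
Proof.
move=> m n mn; rewrite /power_sum (big_cat_nat _ mn)//= lerDl.
by apply: sumr_ge0 => i _; exact: powR_ge0.
Qed.

Lemma ell_normE p b : 0 < p ->
  ell_norm p%:E (b : nat -> K^o) = ((\sum_(0 <= i <oo) (modulus (b i) `^ p)%:E) `^ p^-1)%E.
Proof.
move=> p0; rewrite /ell_norm (Lnorm_counting _ p0); congr (poweR _ _).
by apply: eq_eseriesr => i _ /=; rewrite ger0_norm ?modulus_ge0// poweR_EFin.
Qed.

Let terms_ge0 p b (i : nat) : (0 <= (modulus (b i) `^ p)%:E :> \bar R)%E.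
Proof. by rewrite lee_fin powR_ge0. Qed.

(** Together with its converse, this replaces the integral norm of l_p by its
    finite partial sums. *)
Lemma power_sum_le_ell_norm p b (M : R) N : 0 < p -> 0 <= M ->
  (ell_norm p%:E (b : nat -> K^o) <= M%:E)%E -> power_sum p b N <= M `^ p.
Proof.
move=> p0 M0; rewrite ell_normE// => bM.
have X0 : (0 <= \sum_(0 <= i <oo) (modulus (b i) `^ p)%:E :> \bar R)%E.
  by apply: nneseries_ge0 => i _ _; exact: terms_ge0.
rewrite -lee_fin /power_sum -sumEFin.
apply: (le_trans (@nneseries_lim_ge R _ xpredT 0%N N _)) => [i _ _|].
  exact: terms_ge0.
rewrite -[leLHS]poweRe1// -(mulVf (lt0r_neq0 p0)) poweRrM -poweR_EFin.
by apply: gt0_ler_poweR; rewrite ?(ltW p0)// in_itv/= ?leey ?andbT ?poweR_ge0// lee_fin.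
Qed.

Lemma ell_norm_le_power_sum p b (M : R) : 0 < p -> 0 <= M ->
  (forall N, power_sum p b N <= M `^ p) -> (ell_norm p%:E (b : nat -> K^o) <= M%:E)%E.
Proof.
move=> p0 M0 bM; rewrite ell_normE//.
have X0 : (0 <= \sum_(0 <= i <oo) (modulus (b i) `^ p)%:E :> \bar R)%E.
  by apply: nneseries_ge0 => i _ _; exact: terms_ge0.
have XM : (\sum_(0 <= i <oo) (modulus (b i) `^ p)%:E <= (M `^ p)%:E)%E.
  apply: lime_le; first by apply: is_cvg_nneseries => i _ _; exact: terms_ge0.
  by apply: nearW => n; rewrite sumEFin lee_fin; exact: bM.
have -> : M%:E = ((M `^ p)%:E `^ p^-1)%E.
  by rewrite poweR_EFin -powRrM divff ?gt_eqF// powRr1.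
apply: gt0_ler_poweR; rewrite ?invr_ge0 ?(ltW p0)// in_itv/= ?leey ?andbT//.
by rewrite lee_fin powR_ge0.
Qed.

Lemma ell_norm_finP p b : 0 < p ->
  (ell_norm p%:E (b : nat -> K^o) < +oo)%E <-> exists M, forall N, power_sum p b N <= M.
Proof.
move=> p0; split=> [bfin|[M bM]].
  have bE : ell_norm p%:E (b : nat -> K^o) \is a fin_num.
    by rewrite ge0_fin_numE// Lnorm_ge0.
  exists (fine (ell_norm p%:E (b : nat -> K^o)) `^ p) => N.
  by apply: power_sum_le_ell_norm => //; rewrite ?fineK// fine_ge0// Lnorm_ge0.
have M0 : 0 <= M by apply: le_trans (bM 0%N); exact: power_sum_ge0.
apply: (@le_lt_trans _ _ (M `^ p^-1)%:E); last exact: ltry.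
apply: ell_norm_le_power_sum; rewrite ?powR_ge0// => N.
by rewrite -powRrM mulVf ?gt_eqF// powRr1.
Qed.

Lemma bounded_power_sum_cvg0 p b M : 0 < p ->
  (forall N, power_sum p b N <= M) -> (b : nat -> K^o) @ \oo --> (0 : K^o).
Proof.
move=> p0 bM; have cv : cvgn (power_sum p b).
  apply: nondecreasing_is_cvgn; first exact: power_sum_mono.
  by exists M => _ [n _ <-]; exact: bM.
have t0 : (fun i => modulus (b i) `^ p) @ \oo --> (0 : R).
  exact: cvg_series_cvg_0 cv.
apply/cvgn0_modulusP => e e0; have ep0 : 0 < e `^ p by exact: powR_gt0.
have /cvgrPdist_lt/(_ _ ep0)[N _ hN] := t0; exists N => n /hN /=.
rewrite sub0r normrN ger0_norm ?powR_ge0// => h; rewrite ltNge; apply/negP => eb.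
move: h; apply/negP; rewrite -leNgt ge0_ler_powR ?(ltW p0)// nnegrE ?modulus_ge0//.
exact: ltW.
Qed.

Lemma power_sum_subseq p b (s : nat -> nat) N :
  strictly_increasing s -> power_sum p (b \o s) N <= power_sum p b (s N).
Proof.
move=> si; elim: N => [|N ih].
  by rewrite /power_sum big_geq// sumr_ge0// => i _; exact: powR_ge0.
rewrite {1}/power_sum big_nat_recr//= -/(power_sum p (b \o s) N).
apply: (@le_trans _ _ (power_sum p b (s N).+1)).
  by rewrite /power_sum big_nat_recr//= lerD2r.
by apply: power_sum_mono; exact: si.
Qed.

End power_sums.

Lemma strictly_increasing_ge (s : nat -> nat) : strictly_increasing s ->
  forall n, (n <= s n)%N.
Proof. by move=> si; elim=> // n ih; apply: leq_ltn_trans ih (si _ _ _). Qed.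

Lemma strictly_increasing_comp (s t : nat -> nat) :
  strictly_increasing s -> strictly_increasing t -> strictly_increasing (s \o t).
Proof. by move=> si ti m n mn; apply/si/ti. Qed.

Lemma frequently_subseq (P : nat -> Prop) :
  (forall N, exists2 n, (N <= n)%N & P n) ->
  exists s, strictly_increasing s /\ forall n, P (s n).
Proof.
move=> hP; have /choice[f hf] : forall N, exists n, (N <= n)%N /\ P n.
  by move=> N; have [n Nn Pn] := hP N; exists n.
pose s := fix s n := if n is m.+1 then f (s m).+1 else f 0%N.
exists s; split; last by case=> [|n]; [exact: (hf 0%N).2|exact: (hf (s n).+1).2].
apply: homo_ltn => [m n p|n]; first exact: ltn_trans.
exact: (hf (s n).+1).1.
Qed.

Lemma eventually_subseq (P : nat -> nat -> Prop) :
  (forall j, exists N, forall n, (N <= n)%N -> P j n) ->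
  exists s, strictly_increasing s /\ forall j, P j (s j).
Proof.
move=> /choice[N hN].
pose s := fix s n := if n is m.+1 then maxn (N n) (s m).+1 else N 0%N.
exists s; split; last by case=> [|j]; apply: hN => //=; exact: leq_maxl.
apply: homo_ltn => [m n p|n]; first exact: ltn_trans.
exact: leq_maxr.
Qed.

Section weak_sequences.
Variables (R : realType) (k : field_kind).
Local Notation K := (scalar_field R k).

(** Weak summability of x is this condition on chi o x for each functional
    chi. *)
Definition scalar_summable (p : \bar R) (b : nat -> K) :=
  if p == +oo%E then (b : nat -> K^o) @ \oo --> (0 : K^o)
  else (ell_norm p (b : nat -> K^o) < +oo)%E.

Variables (p : \bar R) (p1 : (1 <= p)%E).

Lemma scalar_summableP (b : nat -> K) :
  (p = +oo%E /\ (scalar_summable p b <-> (b : nat -> K^o) @ \oo --> (0 : K^o))) \/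
  exists r, [/\ p = r%:E, 1 <= r &
    scalar_summable p b <-> exists M, forall N, power_sum r b N <= M].
Proof.
rewrite /scalar_summable; case: p p1 => [r||//]; last by left.
rewrite lee_fin => r1; right; exists r; split=> //=; apply: ell_norm_finP.
by apply: lt_le_trans r1; exact: ltr01.
Qed.

Lemma scalar_summable_cvg0 (b : nat -> K) :
  scalar_summable p b -> (b : nat -> K^o) @ \oo --> (0 : K^o).
Proof.
have [[_ ->//]|[r [_ r1 ->]] [M bM]] := scalar_summableP b.
by apply: bounded_power_sum_cvg0 bM; apply: lt_le_trans r1; exact: ltr01.
Qed.

Lemma scalar_summable_subseq (b : nat -> K) (s : nat -> nat) :
  strictly_increasing s -> scalar_summable p b -> scalar_summable p (b \o s).
Proof.
move=> si; have [[pE ->]|[r [pE r1 ->]]] := scalar_summableP b.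
  rewrite /scalar_summable pE eqxx => /cvgn0_modulusP b0; apply/cvgn0_modulusP.
  move=> e /b0[N hN]; exists N => n Nn /=; apply: hN.
  exact: leq_trans Nn (strictly_increasing_ge si n).
move=> [M bM]; rewrite /scalar_summable pE; apply/ell_norm_finP.
  by apply: lt_le_trans r1; exact: ltr01.
by exists M => N; apply: le_trans (power_sum_subseq _ _ _ si) _.
Qed.

Lemma scalar_summableB (b c : nat -> K) : scalar_summable p b ->
  scalar_summable p c -> scalar_summable p (fun n => b n - c n).
Proof.
rewrite /scalar_summable; case: ifP => [_ b0 c0|_ bp cp].
  rewrite -[X in _ --> X](subr0 (0 : K^o)); exact: cvgB.
have ib : (b : nat -> K^o) \in in_ell p1 by rewrite inE.
have ic : (c : nat -> K^o) \in in_ell p1 by rewrite inE.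
have : (b : nat -> K^o) - (c : nat -> K^o) \in in_ell p1 by rewrite rpredB.
by rewrite inE.
Qed.

Lemma scalar_summable0 : scalar_summable p (fun=> 0).
Proof.
rewrite /scalar_summable; case: ifP => _; first exact: cvg_cst.
by rewrite (ell_norm0 k p1).
Qed.

Variable E : tvsType K.
Implicit Types (x y : nat -> E).

Lemma weakly_summable_null x : weakly_summable p x -> weakly_null x.
Proof. by move=> xp chi; exact: scalar_summable_cvg0 (xp chi). Qed.

Lemma weakly_summable_subseq x (s : nat -> nat) :
  strictly_increasing s -> weakly_summable p x -> weakly_summable p (x \o s).
Proof. by move=> si xp chi; exact: scalar_summable_subseq si (xp chi). Qed.

Lemma weakly_summableB x y : weakly_summable p x -> weakly_summable p y ->
  weakly_summable p (fun n => x n - y n).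
Proof.
move=> xp yp chi; have := scalar_summableB (xp chi) (yp chi).
by rewrite (_ : (fun n => _) = chi \o (fun n => x n - y n))//;
   apply/funext => n /=; rewrite operatorB.
Qed.

Lemma weakly_summable0 : weakly_summable p (fun=> 0 : E).
Proof.
move=> chi; have := scalar_summable0.
by rewrite (_ : (fun=> 0) = chi \o (fun=> 0))//; apply/funext => n /=; rewrite operator0.
Qed.

End weak_sequences.

Section Vstar_sets.
Variables (R : realType) (k : field_kind).
Local Notation K := (scalar_field R k).

(** The limit of suprema in the extended reals is uniform convergence to 0 on
    A; on an empty set those suprema would be -oo. *)
Lemma infty_VstarP (E : tvsType K) (A : set E) : infty_Vstar A <-> A !=set0 /\
  forall chi : nat -> strong_dual E, weakly_null chi -> forall e : R, 0 < e ->
  exists N, forall n a, (N <= n)%N -> A a -> modulus (chi n a) <= e.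
Proof.
split=> -[A0 hA]; split=> // chi chi0; last first.
  have S0 n : (0 <= ereal_sup [set (modulus (chi n a))%:E | a in A])%E.
    have [a Aa] := A0; apply: (@le_trans _ _ (modulus (chi n a))%:E).
      by rewrite lee_fin modulus_ge0.
    by apply: ereal_sup_ubound; exists a.
  have Se (e : R) n : (forall a, A a -> modulus (chi n a) <= e) ->
      (ereal_sup [set (modulus (chi n a))%:E | a in A] <= e%:E)%E.
    by move=> h; apply: ge_ereal_sup => _ [a Aa <-]; rewrite lee_fin; exact: h.
  apply/fine_cvgP; split.
    have [N hN] := hA chi chi0 1 ltr01; exists N => // n Nn.
    rewrite ge0_fin_numE//; apply: le_lt_trans (ltry 1); apply: Se => a.
    exact: hN.
  apply/cvgrPdist_lt => e e0; have e20 : 0 < e / 2 by rewrite divr_gt0.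
  have [N hN] := hA chi chi0 _ e20; exists N => // n Nn /=.
  have h := Se _ _ (fun a => hN n a Nn).
  rewrite sub0r normrN ger0_norm ?fine_ge0//.
  apply: (@le_lt_trans _ _ (e / 2)); last by rewrite ltr_pdivrMr// ltr_pMr ?ltr1n.
  by rewrite -lee_fin fineK// ge0_fin_numE//; exact: le_lt_trans h (ltry _).
move=> e e0; have /fine_cvgP[[N1 _ h1] /cvgrPdist_lt/(_ _ e0)[N2 _ h2]] := hA chi chi0.
exists (maxn N1 N2) => n a; rewrite geq_max => /andP[/h1 f1 /h2 /= f2] Aa.
rewrite -lee_fin; apply: (@le_trans _ _ (ereal_sup [set (modulus (chi n a))%:E | a in A])).
  by apply: ereal_sup_ubound; exists a.
rewrite -(fineK f1) lee_fin; move: f2; rewrite sub0r normrN => /ltW.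
exact/le_trans/ler_norm.
Qed.

Lemma infty_Vstar_sub (E : tvsType K) (A B : set E) : A !=set0 -> A `<=` B ->
  infty_Vstar B -> infty_Vstar A.
Proof.
move=> A0 AB /infty_VstarP[_ hB]; apply/infty_VstarP; split=> // chi chi0 e e0.
by have [N hN] := hB chi chi0 e e0; exists N => n a Nn /AB; exact: hN.
Qed.

End Vstar_sets.

(** * Normed spaces and strong duals *)

Section normed_spaces.
Variables (R : realType) (k : field_kind).
Local Notation K := (scalar_field R k).
Local Notation rs := (@real_scalar R k).
Variable X : normedModType K.
Implicit Types x y : X.

(** The norm, whose values are scalars, as a real number. *)
Definition rnorm x : R := modulus (`|x| : K).

Lemma real_scalar_rnorm x : rs (rnorm x) = `|x|.
Proof. by rewrite real_scalar_modulus normr_id. Qed.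

Lemma rnorm_seminorm : seminorm rnorm.
Proof.
split=> [x y|c x]; last by rewrite /rnorm normrZ modulusM modulus_norm.
rewrite -(ler_real_scalar k) real_scalarD !real_scalar_rnorm; exact: ler_normD.
Qed.

Lemma rnorm_eq0 x : rnorm x = 0 -> x = 0.
Proof. by move=> /modulus_eq0 /normr0_eq0. Qed.

Lemma nbhs0_rnormP (U : set X) :
  nbhs 0 U <-> exists2 r : R, 0 < r & forall x, rnorm x <= r -> U x.
Proof.
split=> [/nbhs_ballP[d /= d0 dU]|[r r0 rU]].
  have dm := gt0_modulus d0.
  exists (modulus d / 2) => [|x xd]; first by rewrite divr_gt0.
  apply: dU; rewrite -ball_normE /= sub0r normrN (ge0_real_scalarE (ltW d0)).
  rewrite -real_scalar_rnorm ltr_real_scalar; apply: le_lt_trans xd _.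
  by rewrite ltr_pdivrMr// ltr_pMr ?ltr1n.
apply/nbhs_ballP; exists (rs r); first by rewrite /= real_scalar_gt0.
move=> x; rewrite -ball_normE /= sub0r normrN -real_scalar_rnorm ltr_real_scalar.
by move=> /ltW; exact: rU.
Qed.

Lemma rnorm_continuous_seminorm : continuous_seminorm rnorm.
Proof.
split; first exact: rnorm_seminorm.
move=> e e0; apply/nbhs0_rnormP; exists (e / 2) => [|x xe]; first by rewrite divr_gt0.
by apply: le_lt_trans xe _; rewrite ltr_pdivrMr// ltr_pMr ?ltr1n.
Qed.

Lemma seminorm_le_rnorm (q : X -> R) : continuous_seminorm q ->
  exists2 M : R, 0 <= M & forall x, q x <= M * rnorm x.
Proof.
move=> [sq q0]; have /nbhs0_rnormP[r r0 rq] := q0 1 ltr01.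
exists r^-1; first by rewrite invr_ge0 ltW.
move=> x; have [/eqP/rnorm_eq0 ->|x0] := boolP (rnorm x == 0).
  by rewrite (seminorm0 sq) (seminorm0 rnorm_seminorm) mulr0.
have xp : 0 < rnorm x by rewrite lt_def x0 (seminorm_ge0 rnorm_seminorm).
have t0 : 0 < r / rnorm x by rewrite divr_gt0.
have := rq (rs (r / rnorm x) *: x).
rewrite /= !(seminormZ sq) (seminormZ rnorm_seminorm) modulus_real ?(ltW t0)//.
rewrite divfK// => /(_ (lexx _)) /= /ltW.
by rewrite -ler_pdivlMl// mulr1 invf_div mulrC.
Qed.

Lemma cvgn0_rnormP (u : nat -> X) : u @ \oo --> (0 : X) <->
  forall e : R, 0 < e -> exists N, forall n, (N <= n)%N -> rnorm (u n) <= e.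
Proof.
split=> [u0 e e0|u0 U U0].
  have U0 : nbhs (0 : X) [set x | rnorm x <= e] by apply/nbhs0_rnormP; exists e.
  by have [N _ hN] := u0 _ U0; exists N => n; exact: hN.
have /nbhs0_rnormP[r r0 rU] : nbhs (0 : X) U by [].
by have [N hN] := u0 r r0; exists N => // n /hN; exact: rU.
Qed.

End normed_spaces.

Section bounded.
Variables (R : realType) (k : field_kind).
Local Notation K := (scalar_field R k).
Local Notation rs := (@real_scalar R k).

Lemma tvs_bounded_absorb (E : tvsType K) (B U : set E) : tvs_bounded B -> nbhs 0 U ->
  exists2 t : R, 0 < t & forall x, B x -> exists2 u, U u & x = rs t *: u.
Proof.
move=> bB /bB[s [s0 sB]]; have sm := gt0_modulus s0.
exists (modulus s + 1) => [|x Bx]; first by rewrite addr_gt0.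
have [|u Uu <-] := sB (rs (modulus s + 1)) _ x Bx; last by exists u.
by rewrite {1}(ge0_real_scalarE (ltW s0)) ltr_real_scalar ltrDl.
Qed.

Lemma tvs_bounded_seminorm (E : tvsType K) (B : set E) (q : E -> R) :
  tvs_bounded B -> continuous_seminorm q -> exists2 M : R, 0 <= M & forall x, B x -> q x <= M.
Proof.
move=> bB [sq q0]; have [t t0 tB] := tvs_bounded_absorb bB (q0 1 ltr01).
exists t; first exact: ltW.
move=> x /tB[u /= /ltW u1 ->]; rewrite (seminormZ sq) modulus_real ?(ltW t0)//.
by rewrite ler_piMr// ltW.
Qed.

Lemma seminorm_tvs_bounded (E : tvsType K) (B : set E) :
  (forall q : E -> R, continuous_seminorm q -> exists M : R, forall x, B x -> q x <= M) ->
  tvs_bounded B.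
Proof.
move=> bB U /nbhs0_seminorm[q cq qU]; have [M hM] := bB q cq.
pose s := Num.max 0 M + 1; have s0 : 0 < s by rewrite ltr_wpDl// le_max lexx.
exists (rs s); split; first by rewrite real_scalar_gt0.
move=> t st x Bx; have t0 : 0 < t by apply: lt_trans st; rewrite real_scalar_gt0.
have ts : s < modulus t by rewrite -(ltr_real_scalar k) -ge0_real_scalarE// ltW.
exists (t^-1 *: x); last by rewrite scalerA divff ?gt_eqF// scale1r.
apply: qU; rewrite /= (seminormZ cq.1) modulusV ltr_pdivrMl ?gt0_modulus// mulr1.
apply: le_lt_trans (hM x Bx) (le_lt_trans _ ts).
by rewrite /s ler_wpDr// le_max lexx orbT.
Qed.

Lemma tvs_bounded1 (E : tvsType K) (x : E) : tvs_bounded [set x].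
Proof. by apply: seminorm_tvs_bounded => q _; exists (q x) => _ ->. Qed.

Lemma tvs_bounded_rnorm (X : normedModType K) (r : R) :
  tvs_bounded [set x : X | rnorm x <= r].
Proof.
apply: seminorm_tvs_bounded => q /seminorm_le_rnorm[M M0 hM].
exists (M * r) => x /= xr; apply: le_trans (hM x) _; exact: ler_wpM2l.
Qed.

Lemma tvs_bounded_operator_image (E L : tvsType K) (f : operator E L) (B : set E) :
  tvs_bounded B -> tvs_bounded (f @` B).
Proof.
move=> bB; apply: seminorm_tvs_bounded => q cq.
have [M _ hM] := tvs_bounded_seminorm bB (continuous_seminorm_comp f cq).
by exists M => _ [x Bx <-]; exact: hM.
Qed.

Lemma strong_nbhs0P (E : tvsType K) (U : set (strong_dual E)) : nbhs 0 U <->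
  exists (B : set E) (e : R), [/\ tvs_bounded B, 0 < e &
    forall chi : strong_dual E, (forall x, B x -> modulus (chi x) < e) -> U chi].
Proof.
split=> [[[B e] [/= bB e0] BU]|[B [e [bB e0 BU]]]].
  exists B, (modulus e); split=> //; first exact: gt0_modulus.
  move=> chi hchi; apply: BU => x Bx /=.
  rewrite -[X in `|X|]/(0 - chi x) sub0r normrN (ge0_real_scalarE (ltW e0)).
  by rewrite ltr_norm_real; exact: hchi.
exists (B, rs e); first by split=> //=; rewrite real_scalar_gt0.
move=> chi /= hchi; apply: BU => x /hchi.
by rewrite -[X in `|X|]/(0 - chi x) sub0r normrN ltr_norm_real.
Qed.

Lemma cvgn0_strongP (E : tvsType K) (u : nat -> strong_dual E) :
  u @ \oo --> (0 : strong_dual E) <->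
  forall (B : set E) (e : R), tvs_bounded B -> 0 < e ->
    exists N, forall n x, (N <= n)%N -> B x -> modulus (u n x) < e.
Proof.
split=> [u0 B e bB e0|u0 U /strong_nbhs0P[B [e [bB e0 BU]]]].
  have U0 : nbhs (0 : strong_dual E) [set chi | forall x, B x -> modulus (chi x) < e].
    by apply/strong_nbhs0P; exists B, e.
  by have [N _ hN] := u0 _ U0; exists N => n x /hN /=; exact.
have [N hN] := u0 B e bB e0; exists N => // n Nn; apply: BU => x.
exact: hN.
Qed.

Lemma evaluation_is_operator (E : tvsType K) (x : E) :
  (fun chi : strong_dual E => chi x : K^o) \in @is_operator K (strong_dual E) K^o.
Proof.
rewrite inE; split=> //; apply: linear_continuous0 => // V /nbhs_ballP[d /= d0 dV].
apply/strong_nbhs0P; exists [set x], (modulus d); split.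
- exact: tvs_bounded1.
- exact: gt0_modulus.
- move=> chi /(_ x erefl) h; apply: dV; rewrite -ball_normE /= sub0r normrN.
  by rewrite (ge0_real_scalarE (ltW d0)) ltr_norm_real.
Qed.

Definition evaluation (E : tvsType K) (x : E) : dual (strong_dual E) :=
  Operator (evaluation_is_operator x).

(** Points are bounded sets, so that point evaluations are strongly continuous
    functionals. *)
Lemma weakly_null_pointwise (E : tvsType K) (chi : nat -> strong_dual E) (x : E) :
  weakly_null chi -> (fun n => chi n x : K^o) @ \oo --> (0 : K^o).
Proof. by move=> /(_ (evaluation x)). Qed.

Lemma weakly_null_subseq (E : tvsType K) (x : nat -> E) (s : nat -> nat) :
  strictly_increasing s -> weakly_null x -> weakly_null (x \o s).
Proof.
move=> si x0 chi; apply/cvgn0_modulusP => e e0.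
have [N hN] := (cvgn0_modulusP _).1 (x0 chi) e e0; exists N => n Nn; apply: hN.
exact: leq_trans Nn (strictly_increasing_ge si n).
Qed.

End bounded.

(** * Precompact sets and their images *)

Section compactness.
Variables (R : realType) (k : field_kind).
Local Notation K := (scalar_field R k).
Variables (E : tvsType K) (p : \bar R) (p1 : (1 <= p)%E).

Lemma weakly_convergent_cauchy (x : nat -> E) (l : E) :
  weakly_convergent p x l -> weakly_p_cauchy p x.
Proof.
move=> xl s t si ti.
have h u : strictly_increasing u -> weakly_summable p (fun n => x (u n) - l).
  by move=> ui; exact: (weakly_summable_subseq p1 ui xl).
have := weakly_summableB p1 (h s si) (h t ti).
by under eq_fun do rewrite opprB addrA subrK.
Qed.

Lemma rel_compact_precompact (A : set E) :
  rel_weakly_seq_compact p A -> weakly_seq_p_precompact p A.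
Proof.
move=> cA a /cA[s [l [si sl]]]; exists s; split=> //.
exact: weakly_convergent_cauchy sl.
Qed.

Lemma compact_rel_compact (A : set E) :
  weakly_seq_compact p A -> rel_weakly_seq_compact p A.
Proof. by move=> cA a /cA[s [l [si _ sl]]]; exists s, l. Qed.

Lemma precompact_sub (A B : set E) : A `<=` B ->
  weakly_seq_p_precompact p B -> weakly_seq_p_precompact p A.
Proof. by move=> AB pB a Aa; apply: pB => n; exact: AB. Qed.

Lemma increasing_subseq (f : nat -> nat) :
  (forall M, exists N, forall n, (N <= n)%N -> (M <= f n)%N) ->
  exists s, strictly_increasing s /\ strictly_increasing (f \o s).
Proof.
move=> /choice[N hN].
pose s := fix s n := if n is m.+1 then maxn (N (f (s m)).+1) (s m).+1 else 0%N.
exists s; split; apply: homo_ltn => [m n q|n]; first exact: ltn_trans.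
- exact: leq_maxr.
- exact: ltn_trans.
- by apply: hN; exact: leq_maxl.
Qed.

(** The limit 0 has to be adjoined to the range. A sequence in this set either
    takes one value infinitely often, or avoids each given value from some
    index on and then contains a subsequence of x. *)
Lemma summable_range_compact (x : nat -> E) : weakly_summable p x ->
  weakly_seq_compact p (range x `|` [set 0]).
Proof.
move=> xp a Aa.
have [[v [Av hv]]|nv] := pselect (exists v, (range x `|` [set 0]) v /\
    forall N, exists2 n, (N <= n)%N & a n = v).
  have [s [si sv]] := frequently_subseq hv; exists s, v; split=> //.
  have := @weakly_summable0 R k p p1 E; rewrite /weakly_convergent.
  by congr weakly_summable; apply/funext => n /=; rewrite sv subrr.
have avoid v : (range x `|` [set 0]) v -> exists N, forall n, (N <= n)%N -> a n <> v.
  move=> Av; apply: contrapT => h; apply: nv; exists v; split=> // N.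
  apply: contrapT => h'; apply: h; exists N => n Nn an; apply: h'.
  by exists n.
have [N0 hN0] := avoid 0 (or_intror erefl).
have /choice[f hf] n : exists i, a (N0 + n)%N = x i.
  case: (Aa (N0 + n)%N) => [[i _ xi]|]; first by exists i.
  by move=> a0; case: (hN0 _ (leq_addr n N0)).
(* Each x i being avoided eventually, f tends to infinity. *)
have [M|s [si fsi]] := @increasing_subseq f.
  elim: M => [|M [N hN]]; first by exists 0%N.
  have [N' hN'] := avoid (x M) (or_introl (imageT x M)).
  exists (maxn N N') => n; rewrite geq_max => /andP[/hN Mf Nn].
  rewrite ltn_neqAle Mf andbT; apply/eqP => ME; apply: (hN' (N0 + n)%N).
    exact: leq_trans Nn (leq_addl _ _).
  by rewrite hf -ME.
exists (fun n => N0 + s n)%N, 0; split; first by move=> m n /si; rewrite ltn_add2l.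
  by right.
have := weakly_summable_subseq p1 fsi xp; rewrite /weakly_convergent.
by congr weakly_summable; apply/funext => n /=; rewrite hf subr0.
Qed.

End compactness.

Section precompact_ranges.
Variables (R : realType) (k : field_kind).
Local Notation K := (scalar_field R k).
Local Notation rs := (@real_scalar R k).
Variables (E L : tvsType K) (p : \bar R) (p1 : (1 <= p)%E) (T : operator E L).

(** Otherwise some weakly null functionals stay large at points of T A; along
    a subsequence they are eta_j, large at T y_j, with y weakly p-Cauchy. As
    eta is pointwise null, an increasing m makes eta_(m j) small at T y_j.
    Then eta_(m j) stays large at T (y_(m j) - y_j), while these differences
    are weakly p-summable. *)
Lemma assertion_i_implies_ii : assertion_i p T -> assertion_ii p T.
Proof.
move=> hi A A0 pA; apply/infty_VstarP; split.
  by have [a Aa] := A0; exists (T a), a.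
move=> chi chi0 e e0; apply: contrapT => nN.
have [N|s [si /choice[a sa]]] :=
    @frequently_subseq (fun n => exists a, A a /\ e < modulus (chi n (T a))).
  apply: contrapT => h; apply: nN; exists N => n _ Nn [a Aa <-].
  by rewrite leNgt; apply/negP => ea; apply: h; exists n => //; exists a.
have [t [ti ct]] := pA a (fun n => (sa n).1).
pose eta := chi \o (s \o t); pose y := a \o t.
have eta0 : weakly_null eta.
  exact: weakly_null_subseq (strictly_increasing_comp si ti) chi0.
have ey j : e < modulus (eta j (T (y j))) by exact: (sa (t j)).2.
have e20 : 0 < e / 2 by rewrite divr_gt0.
have [j|m [mi hm]] := @eventually_subseq (fun j n => modulus (eta n (T (y j))) < e / 2).
  by have /cvgn0_modulusP/(_ _ e20) := weakly_null_pointwise (T (y j)) eta0.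
have := hi _ _ (weakly_null_subseq mi eta0) (ct m id mi (fun _ _ => id)).
move=> /cvgn0_modulusP/(_ _ e20)[N /(_ N (leqnn N))] /=; rewrite !operatorB => h.
have := ey (m N); apply/negP; rewrite -leNgt.
have -> : eta (m N) (T (y (m N))) =
    eta (m N) (T (y (m N))) - eta (m N) (T (y N)) + eta (m N) (T (y N)) by rewrite subrK.
rewrite (splitr e); apply: le_trans (modulusD _ _) _.
by apply: lerD; apply: ltW => //; exact: hm.
Qed.

Lemma assertion_ii_implies_iii : assertion_ii p T -> assertion_iii p T.
Proof.
move=> hii A A0 cA; apply: hii => //.
exact/(rel_compact_precompact p1)/compact_rel_compact.
Qed.

Lemma assertion_iii_implies_iv : assertion_iii p T -> assertion_iv p T.
Proof.
move=> hiii x xp; apply: infty_Vstar_sub (hiii _ _ (summable_range_compact p1 xp)).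
- by exists (T (x 0%N)); exists (x 0%N) => //; exists 0%N.
- by apply: image_subset => y; left.
- by exists 0; right.
Qed.

Lemma assertion_iv_implies_i : assertion_iv p T -> assertion_i p T.
Proof.
move=> hiv eta x eta0 /hiv/infty_VstarP[_ hV]; apply/cvgn0_modulusP => e e0.
have e20 : 0 < e / 2 by rewrite divr_gt0.
have [N hN] := hV eta eta0 _ e20; exists N => n Nn.
apply: (@le_lt_trans _ _ (e / 2)); last by rewrite ltr_pdivrMr// ltr_pMr ?ltr1n.
by apply: hN => //; exists (x n) => //; exists n.
Qed.

Lemma assertion_ii_implies_viii : assertion_ii p T -> assertion_viii p T.
Proof.
move=> hii X S [U U0 SU]; exists U => //; rewrite -image_comp.
by apply: hii => //; exists (S 0); exists 0 => //; exact: nbhs_singleton.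
Qed.

Lemma weakly_summable_pinfty (F : tvsType K) (x : nat -> F) :
  weakly_summable +oo x <-> weakly_null x.
Proof. by rewrite /weakly_summable eqxx. Qed.

(** Both sides say that a weakly null sequence of functionals, composed with T
    o S, tends to 0 uniformly on bounded sets: in a normed space every
    neighbourhood of 0 absorbs the bounded sets, and the unit ball is a
    bounded neighbourhood. *)
Lemma Vstar_map_adjoint (X : normedModType K) (S : operator X E) :
  infty_Vstar_map (T \o S) <-> p_convergent_map +oo%E (adjoint S \o adjoint T).
Proof.
split=> [[U U0 /infty_VstarP[_ UV]] chi /weakly_summable_pinfty chi0|hc].
  apply/cvgn0_strongP => B e /tvs_bounded_absorb/(_ U0)[t t0 tB] e0.
  have d0 : 0 < e / 2 / t by rewrite !divr_gt0.
  have [N hN] := UV chi chi0 _ d0; exists N => n x Nn /tB[u Uu ->] /=.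
  rewrite !operatorZ modulusM modulus_real ?ltW// mulrC -ltr_pdivlMr//.
  apply: le_lt_trans (hN n (T (S u)) Nn _) _; first by exists u.
  by rewrite ltr_pM2r ?invr_gt0// ltr_pdivrMr// ltr_pMr ?ltr1n.
exists [set x | rnorm x <= 1]; first by apply/nbhs0_rnormP; exists 1.
apply/infty_VstarP; split.
  exists (T (S 0)), 0 => //=.
  by rewrite (seminorm0 (@rnorm_seminorm R k X)).
move=> chi /weakly_summable_pinfty/hc/cvgn0_strongP h e e0.
have [N hN] := h _ e (@tvs_bounded_rnorm R k X 1) e0.
by exists N => n _ Nn [x x1 <-]; exact/ltW/(hN n x).
Qed.

Lemma assertion_viii_iff_ix : assertion_viii p T <-> assertion_ix p T.
Proof.
split=> h X S hS; first exact/Vstar_map_adjoint/h.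
by apply/Vstar_map_adjoint/h.
Qed.

Lemma assertion_ix_implies_x : assertion_ix p T -> assertion_x p T.
Proof. by move=> /assertion_viii_iff_ix h S; exact: h. Qed.

Lemma assertion_viii_implies_xi : assertion_viii p T -> assertion_xi p T.
Proof.
move=> h Z S [U U0 cU]; apply: h; exists U => //.
exact: rel_compact_precompact.
Qed.

(** This is how an operator that sends unit vectors to the terms of a given
    sequence brings back the convergence asked for by assertion_i. *)
Lemma Vstar_map_unit_vectors (X : normedModType K) (S : operator X E)
    (u : nat -> X) (eta : nat -> strong_dual L) :
  (forall n, rnorm (u n) <= 1) -> infty_Vstar_map (T \o S) -> weakly_null eta ->
  (fun n => eta n (T (S (u n))) : K^o) @ \oo --> (0 : K^o).
Proof.
move=> u1 [U /nbhs0_rnormP[r r0 rU] /infty_VstarP[_ UV]] eta0.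
apply/cvgn0_modulusP => e e0; have d0 : 0 < r * (e / 2) by rewrite mulr_gt0// divr_gt0.
have [N hN] := UV eta eta0 _ d0; exists N => n Nn.
have := hN n (T (S (rs r *: u n))) Nn; rewrite !operatorZ modulusM modulus_real ?(ltW r0)//.
rewrite ler_pM2l// => h; apply: (@le_lt_trans _ _ (e / 2)); last first.
  by rewrite ltr_pdivrMr// ltr_pMr ?ltr1n.
apply: h; exists (rs r *: u n); last by rewrite /= !operatorZ.
apply: rU; rewrite (seminormZ (@rnorm_seminorm R k X)) modulus_real ?(ltW r0)//.
by rewrite ler_piMr// ltW.
Qed.

End precompact_ranges.

(** * Operators on the span of the unit vectors *)

Lemma cvgn0_bounded (R : realType) (k : field_kind) (u : nat -> (scalar_field R k)^o) :
  u @ \oo --> (0 : (scalar_field R k)^o) ->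
  exists M : R, forall n, modulus (u n : scalar_field R k) <= M.
Proof.
move=> /cvgn0_modulusP/(_ 1 ltr01)[N hN].
exists (1 + \sum_(0 <= i < N) modulus (u i : scalar_field R k)) => n.
have s0 (P : pred nat) : 0 <= \sum_(0 <= i < N | P i) modulus (u i : scalar_field R k).
  by apply: sumr_ge0 => i _; exact: modulus_ge0.
have [Nn|nN] := leqP N n.
  by apply: le_trans (ltW (hN n Nn)) _; rewrite lerDl.
rewrite (@bigD1_seq _ _ _ _ _ n)/= ?mem_index_iota ?iota_uniq//.
by rewrite addrCA lerDl addr_ge0.
Qed.

Section ell_spaces.
Variables (R : realType) (k : field_kind).
Local Notation K := (scalar_field R k).
Variables (q : \bar R) (q1 : (1 <= q)%E).
Implicit Types a : ell k q1.

Lemma rnorm_ellE a : ((rnorm a)%:E = ell_norm q a)%E.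
Proof.
rewrite -ell_norm_fine; congr EFin; rewrite /rnorm.
by rewrite -[X in modulus X]/(ell_norm_scalar a) modulus_real// fine_ge0 ?ell_norm_ge0.
Qed.

Variables (r : R) (qE : q = r%:E).

Lemma ell_exponent_gt0 : 0 < r.
Proof. by apply: lt_le_trans ltr01 _; rewrite -lee_fin -qE. Qed.

Lemma ell_norm_rnormE a : ell_norm r%:E (a : nat -> K^o) = (rnorm a)%:E.
Proof. by rewrite rnorm_ellE -qE. Qed.

Lemma power_sum_le_rnorm a N : power_sum r (a : nat -> K) N <= rnorm a `^ r.
Proof.
apply: power_sum_le_ell_norm; first exact: ell_exponent_gt0.
  exact: (seminorm_ge0 (@rnorm_seminorm R k _)).
by rewrite ell_norm_rnormE.
Qed.

Lemma rnorm_le_power_sum a (M : R) : 0 <= M ->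
  (forall N, power_sum r (a : nat -> K) N <= M `^ r) -> rnorm a <= M.
Proof.
move=> M0 h; rewrite -lee_fin -ell_norm_rnormE.
by apply: ell_norm_le_power_sum => //; exact: ell_exponent_gt0.
Qed.

Lemma in_ell_power_sum (b : nat -> K) (M : R) :
  (forall N, power_sum r b N <= M) -> (b : nat -> K^o) \in in_ell q1.
Proof.
move=> bM; rewrite inE /= qE; apply/(ell_norm_finP _ ell_exponent_gt0).
by exists M.
Qed.

Lemma power_sum_unit_seq i N : power_sum r (@unit_seq R k i : nat -> K) N = (i < N)%:R.
Proof.
elim: N => [|N ih]; first by rewrite /power_sum big_geq.
rewrite /power_sum big_nat_recr//= -/(power_sum r (@unit_seq R k i : nat -> K) N) ih.
rewrite /unit_seq ltnS; case: ltngtP => _ /=; rewrite ?modulus1 ?powR1 ?add0r//;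
  by rewrite modulus0 powR0 ?addr0// gt_eqF ?ell_exponent_gt0.
Qed.

Lemma unit_seq_in_ell i : (@unit_seq R k i : nat -> K^o) \in in_ell q1.
Proof.
by apply: (@in_ell_power_sum _ 1) => N; rewrite power_sum_unit_seq lern1 leq_b1.
Qed.

Definition unit_ell i : ell k q1 := Ell (unit_seq_in_ell i).

Lemma rnorm_unit_ell i : rnorm (unit_ell i) <= 1.
Proof.
by apply: rnorm_le_power_sum => // N; rewrite powR1 power_sum_unit_seq lern1 leq_b1.
Qed.

End ell_spaces.

(** By induction on N: the first N terms add up to t times a combination of
    the same kind, where t is the sum of the moduli of their coefficients. *)
Lemma absolutely_convex_sum (R : realType) (k : field_kind)
    (E : tvsType (scalar_field R k)) (C : set E) (x : nat -> E)
    (c : nat -> scalar_field R k) (N : nat) :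
  absolutely_convex C -> (forall i, C (x i)) ->
  \sum_(0 <= i < N) modulus (c i) <= 1 -> C (\sum_(0 <= i < N) c i *: x i).
Proof.
move=> aC Cx; elim: N c => [|N ih] c.
  move=> _; rewrite big_geq// -(addr0 0) -[X in X + _](scale0r (x 0%N)).
  by rewrite -[X in _ + X](scale0r (x 0%N)); apply: aC => //; rewrite normr0 addr0.
rewrite !big_nat_recr//=; set t := \sum_(0 <= i < N) _ => tc.
have t0 : 0 <= t by apply: sumr_ge0 => i _; exact: modulus_ge0.
have n1 (d : scalar_field R k) : modulus d <= t ->
    `|d| + `|c N| <= 1.
  move=> dt; rewrite -!real_scalar_modulus -real_scalarD -(real_scalar1 R k).
  by rewrite ler_real_scalar; apply: le_trans tc; rewrite lerD2r.
have [tE|tn] := eqVneq t 0.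
  have c0 i : (i < N)%N -> c i = 0.
    move=> iN; apply/modulus_eq0/le_anti; rewrite modulus_ge0 andbT -tE /t.
    rewrite big_mkord (bigD1 (Ordinal iN))//= lerDl.
    by apply: sumr_ge0 => j _; exact: modulus_ge0.
  rewrite big_nat big1 => [|i /andP[_ iN]]; last by rewrite c0// scale0r.
  by rewrite -[X in X + _](scale0r (x N)); apply: aC => //; apply: n1; rewrite modulus0.
have rt0 : real_scalar k t != 0.
  by rewrite -(real_scalar0 R k); apply: contraNN tn => /eqP/real_scalar_inj ->.
have -> : \sum_(0 <= i < N) c i *: x i =
    real_scalar k t *: \sum_(0 <= i < N) (c i / real_scalar k t) *: x i.
  rewrite scaler_sumr; apply: eq_bigr => i _.
  by rewrite scalerA mulrC divfK.
apply: aC => //; last by apply: n1; rewrite modulus_real.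
apply: ih; under eq_bigr do rewrite modulusM modulusV modulus_real//.
by rewrite -mulr_suml divff.
Qed.

Lemma subspace_val_linear (K : numFieldType) (V : normedModType K) (S : submodClosed V)
    (c : K) (a b : Defs.subspace S) :
  subspace_val (c *: a + b) = c *: subspace_val a + subspace_val b.
Proof. by []. Qed.

Section finitely_supported.
Variables (R : realType) (k : field_kind).
Local Notation K := (scalar_field R k).

Definition coord1 (a : ell1_0 R k) (n : nat) : K := (subspace_val a : ell1 R k) n.

Lemma coord1_linear c a b n : coord1 (c *: a + b) n = c * coord1 a n + coord1 b n.
Proof.
have /(congr1 (fun z : ell1 R k => z n)) :=
  @subspace_val_linear K (ell1 R k) (@unit_span R k) c a b.
exact.
Qed.

Lemma coord1_sum_le a N : \sum_(0 <= i < N) modulus (coord1 a i) <= rnorm a.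
Proof.
have := @power_sum_le_rnorm R k _ (lexx (1%E : \bar R)) 1 erefl (subspace_val a) N.
rewrite powRr1; last exact: (seminorm_ge0 (@rnorm_seminorm R k _)).
by rewrite /power_sum; under eq_bigr do rewrite powRr1 ?modulus_ge0//.
Qed.

Lemma coord1_finite a : exists N, forall n, (N <= n)%N -> coord1 a n = 0.
Proof.
case: a => a aP; have := aP; rewrite inE => -[N [c ac]]; exists N => n Nn.
rewrite /coord1 /= ac fct_sumE big1// => i _.
by rewrite -[LHS]/(c i * (n == i)%:R) gtn_eqF ?mulr0//; exact: leq_trans (ltn_ord i) Nn.
Qed.

Lemma unit1_subproof i :
  @unit_ell R k _ (lexx (1%E : \bar R)) 1 erefl i \in @unit_span R k.
Proof.
rewrite inE; exists i.+1, (fun j => (j == i)%:R); apply/funext => n.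
rewrite fct_sumE (bigD1 ord_max)//= eqxx scale1r big1 ?addr0// => j /negPf ji.
by rewrite -[LHS]/((nat_of_ord j == i)%:R * (n == j)%:R) -[(j : nat) == i]/(j == ord_max) ji mul0r.
Qed.

Definition unit1 i : ell1_0 R k := Subspace (unit1_subproof i).

Lemma rnorm_unit1 i : rnorm (unit1 i) <= 1.
Proof. exact: (@rnorm_unit_ell R k _ (lexx (1%E : \bar R)) 1 erefl). Qed.

Variables (E : tvsType K) (x : nat -> E).
Hypothesis x0 : weakly_null x.

(** A weakly null sequence is weakly bounded, hence bounded for every
    continuous seminorm, and this makes the linear map sending the i-th unit
    vector to x i continuous for the l_1 norm. *)
Lemma finite_combination_operator : exists S : operator (ell1_0 R k) E,
  forall a N, (forall n, (N <= n)%N -> coord1 a n = 0) ->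
    S a = \sum_(0 <= i < N) coord1 a i *: x i.
Proof.
have [N hN] := choice coord1_finite.
pose S a := \sum_(0 <= i < N a) coord1 a i *: x i.
have SE a M : (forall n, (M <= n)%N -> coord1 a n = 0) ->
    S a = \sum_(0 <= i < M) coord1 a i *: x i.
  move=> hM; rewrite /S.
  have [le|/ltnW le] := leqP (N a) M; rewrite (big_cat_nat _ le)//=;
    rewrite [X in _ + X]big_nat [X in _ + X]big1 ?addr0// => i /andP[h _].
    by rewrite hN// scale0r.
  by rewrite hM// scale0r.
have lS : linear S.
  move=> c a b; pose M := maxn (N (c *: a + b)) (maxn (N a) (N b)).
  have hM z : (N z <= M)%N -> S z = \sum_(0 <= i < M) coord1 z i *: x i.
    by move=> zM; apply: SE => n Mn; apply: hN; exact: leq_trans zM Mn.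
  rewrite !hM ?leq_maxl// ?leq_max ?leqnn ?orbT//.
  rewrite scaler_sumr -big_split; apply: eq_bigr => i _ /=.
  by rewrite coord1_linear scalerDl scalerA.
have cS : continuous S.
  apply: dominated_linear_continuous => // q cq.
  have [|M hM] := @weakly_bounded_seminorm R k E (range x) q cq.
    move=> chi; have [M hM] := cvgn0_bounded (x0 chi).
    by exists M => _ [n _ <-]; exact: hM.
  pose M' := Num.max M 0 + 1.
  have M'0 : 0 < M' by rewrite ltr_wpDl// le_max lexx orbT.
  have qM n : q (x n) <= M'.
    by apply: le_trans (hM _ (imageT x n)) _; rewrite /M' ler_wpDr// le_max lexx.
  exists (fun a => M' * rnorm a).
    exact/continuous_seminormZ/rnorm_continuous_seminorm.
  move=> a; apply: le_trans (seminorm_sum cq.1 _ _ _) _.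
  apply: (@le_trans _ _ (\sum_(0 <= i < N a) M' * modulus (coord1 a i))).
    by apply: ler_sum => i _; rewrite (seminormZ cq.1) mulrC ler_wpM2r ?modulus_ge0.
  by rewrite -mulr_sumr ler_wpM2l ?(ltW M'0)// coord1_sum_le.
have oS : S \in @is_operator K (ell1_0 R k) E by rewrite inE.
by exists (Operator oS).
Qed.

End finitely_supported.

(** The operator sending unit vectors to the terms of x maps the unit ball
    into the absolutely convex hull of x, so that local completeness of E is
    its precompactness. *)
Lemma assertion_x_implies_i (R : realType) (k : field_kind) (E L : tvsType (scalar_field R k))
    (p : \bar R) (p1 : (1 <= p)%E) (T : operator E L) :
  weakly_seq_locally_complete E p -> assertion_x p T -> assertion_i p T.
Proof.
move=> cE hx eta x eta0 xp.
have [S SE] := finite_combination_operator (weakly_summable_null p1 xp).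
have Su n : S (@unit1 R k n) = x n.
  rewrite (SE _ n.+1) => [|m nm]; last by rewrite /coord1/= /unit_seq gtn_eqF.
  rewrite big_nat_recr//= big_nat big1 => [|i /andP[_ ni]].
    by rewrite add0r /coord1/= /unit_seq eqxx scale1r.
  by rewrite /coord1/= /unit_seq ltn_eqF// scale0r.
have -> : (fun n => eta n (T (x n)) : (scalar_field R k)^o) =
    (fun n => eta n (T (S (@unit1 R k n)))) by apply/funext => n; rewrite Su.
apply: Vstar_map_unit_vectors => //; first exact: rnorm_unit1.
apply: hx; exists [set a | rnorm a <= 1]; first by apply/nbhs0_rnormP; exists 1.
apply: precompact_sub (cE x xp) => _ [a a1 <-] C [[cC aC] xC].
have [N hN] := coord1_finite a; rewrite (SE _ _ hN).
apply: absolutely_convex_sum => //; first by move=> i; apply: xC; exists i.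
exact: le_trans (coord1_sum_le a N) a1.
Qed.

(** * The space c0 *)

Section c0_space.
Variables (R : realType) (k : field_kind).
Local Notation K := (scalar_field R k).
Local Notation c0 := (c0 R k).
Local Notation coord := (c0_coord R k).
Implicit Types x y : c0.

Lemma modulus_coord_le x n : modulus (coord n x) <= rnorm x.
Proof.
rewrite -ler_norm_real real_scalar_rnorm.
exact: (le_modulus_ell_infty (subspace_val x)).
Qed.

Lemma ell_infty_norm_le (b : nat -> K) (M : R) :
  (forall n, modulus (b n) <= M) -> (ell_norm +oo (b : nat -> K^o) <= M%:E)%E.
Proof.
move=> bM; have M0 : 0 <= M := le_trans (modulus_ge0 _) (bM 0%N).
rewrite /ell_norm unlock; case: ifP => _; last by rewrite lee_fin.
apply/ess_sup_inf.ess_supP; apply: nearW => n /=.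
by rewrite lee_fin ger0_norm ?modulus_ge0.
Qed.

Lemma rnorm_c0_le x (M : R) : (forall n, modulus (coord n x) <= M) -> rnorm x <= M.
Proof.
move=> xM; rewrite -lee_fin.
rewrite -[rnorm x]/(rnorm (subspace_val x : ell k (leey (1%E : \bar R)))) rnorm_ellE.
exact: ell_infty_norm_le.
Qed.

Lemma cvg0_diagonal_coord (u : nat -> c0) : u @ \oo --> (0 : c0) ->
  (fun n => coord n (u n) : K^o) @ \oo --> (0 : K^o).
Proof.
move=> /cvgn0_rnormP u0; apply/cvgn0_modulusP => e e0.
have [N hN] := u0 _ (divr_gt0 e0 (ltr0n _ 2)); exists N => n /hN h.
apply: le_lt_trans (modulus_coord_le _ _) (le_lt_trans h _).
by rewrite ltr_pdivrMr// ltr_pMr ?ltr1n.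
Qed.

Lemma c0_ext x y : (forall n, coord n x = coord n y) -> x = y.
Proof. by move=> xy; apply/val_inj/val_inj/funext => n; exact: xy. Qed.

Lemma coord_cvg0 x : (fun n => coord n x : K^o) @ \oo --> (0 : K^o).
Proof. by case: x => x xP; have := xP; rewrite inE. Qed.

Section build.
Variables (b : nat -> K) (b0 : (b : nat -> K^o) @ \oo --> (0 : K^o)).

Lemma null_seq_in_ell_infty : (b : nat -> K^o) \in in_ell (leey (1%E : \bar R)).
Proof.
have [M bM] := cvgn0_bounded b0; rewrite inE /=.
exact: le_lt_trans (ell_infty_norm_le bM) (ltry _).
Qed.

Lemma null_seq_in_c0 : (Ell null_seq_in_ell_infty : ell_infty R k) \in @null_seq R k.
Proof. by rewrite inE. Qed.

Definition c0_of : c0 := Subspace null_seq_in_c0.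

Lemma coord_c0_of n : coord n c0_of = b n.
Proof. by []. Qed.

End build.

(** Choose x m within 1 / (m + 1) of the filter. Norms in c0 bound
    coordinates, so the coordinates of x m converge uniformly, and a uniform
    limit of null sequences is a null sequence. *)
Lemma c0_cauchy_cvg (F : set_system c0) : ProperFilter F -> cauchy F -> cvg F.
Proof.
move=> FF /cauchy_ballP cF.
have hF (e : R) : 0 < e -> exists x, F [set y | rnorm (x - y) < e].
  move=> e0; have re0 : 0 < real_scalar k e by rewrite real_scalar_gt0.
  have [[A B] /= [FA FB] AB] := cF _ re0.
  have [a [Aa Ba]] := filter_ex (filterI FA FB).
  exists a; apply: filterS FB => y By; have := AB (a, y) (conj Aa By).
  by rewrite -ball_normE /= -real_scalar_rnorm ltr_real_scalar.
have /choice[x hx] (m : nat) : exists x, F [set y | rnorm (x - y) < m.+1%:R^-1].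
  by apply: hF; rewrite invr_gt0.
have xx m l : rnorm (x m - x l) <= m.+1%:R^-1 + l.+1%:R^-1.
  have [y [/= my ly]] := filter_ex (filterI (hx m) (hx l)).
  rewrite -(subrKA y); apply: le_trans (seminormD (@rnorm_seminorm R k _) _ _) _.
  by rewrite -[rnorm (y - _)](seminormN (@rnorm_seminorm R k _)) opprB lerD// ltW.
have inv_small (e : R) : 0 < e -> exists N, forall m, (N <= m)%N -> m.+1%:R^-1 < e.
  move=> e0; have := near_infty_natSinv_lt (PosNum e0) => -[N _ hN].
  by exists N => m; exact: hN.
have coordB n y z : modulus (coord n y - coord n z) <= rnorm (y - z).
  by rewrite -operatorB; exact: modulus_coord_le.
have /choice[a ha] (n : nat) : exists l : K, (fun m => coord n (x m) : K^o) @ \oo --> (l : K^o).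
  apply: scalar_seq_complete => e e0; have [N hN] := inv_small _ (divr_gt0 e0 (ltr0n _ 2)).
  exists N => m l Nm Nl; apply: le_lt_trans (coordB n _ _) (le_lt_trans (xx m l) _).
  by rewrite [ltRHS]splitr ltrD// hN.
have ax n m : modulus (a n - coord n (x m)) <= m.+1%:R^-1.
  apply/ler_addgt0Pr => e e0.
  have [N1 h1] := (cvgn_modulusP _ _).1 (ha n) _ (divr_gt0 e0 (ltr0n _ 2)).
  have [N2 h2] := inv_small _ (divr_gt0 e0 (ltr0n _ 2)).
  pose l := maxn N1 N2.
  apply: le_trans (modulus_triangle _ (coord n (x l)) _) _.
  rewrite addrC (splitr e) addrA; apply: lerD; last first.
    by rewrite modulusC; apply/ltW/h1; exact: leq_maxl.
  apply: le_trans (coordB n _ _) (le_trans (xx l m) _).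
  by rewrite [leRHS]addrC lerD2r; apply/ltW/h2; exact: leq_maxr.
have a0 : (a : nat -> K^o) @ \oo --> (0 : K^o).
  apply/cvgn0_modulusP => e e0; have e20 : 0 < e / 2 by rewrite divr_gt0.
  have [m hm] := inv_small _ e20.
  have [N hN] := (cvgn0_modulusP _).1 (coord_cvg0 (x m)) _ e20.
  exists N => n Nn; rewrite -[a n](subrK (coord n (x m))).
  apply: le_lt_trans (modulusD _ _) _; rewrite (splitr e) ltr_leD//; last exact/ltW/hN.
  by apply: le_lt_trans (ax n m) _; exact: hm.
apply: (cvgP (c0_of a0)); apply/cvgrPdist_lt => e e0.
have e20 : 0 < modulus e / 2 by rewrite divr_gt0// gt0_modulus.
have [m hm] := inv_small _ e20.
apply: filterS (hx m) => y /= xy.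
rewrite (ge0_real_scalarE (ltW e0)) -real_scalar_rnorm ltr_real_scalar.
rewrite -(subrKA (x m)) (splitr (modulus e)).
apply: le_lt_trans (seminormD (@rnorm_seminorm R k _) _ _) _.
rewrite ler_ltD//; last by apply: lt_trans xy _; exact: hm.
apply: (@le_trans _ _ m.+1%:R^-1); last exact/ltW/hm.
by apply: rnorm_c0_le => n; rewrite operatorB coord_c0_of.
Qed.

(** This makes c0 one of the Banach spaces over which assertion_v ranges. *)
HB.instance Definition _ := Uniform_isComplete.Build c0 c0_cauchy_cvg.

Lemma unit_seq_cvg0 i : (@unit_seq R k i : nat -> K^o) @ \oo --> (0 : K^o).
Proof.
apply/cvgn0_modulusP => e e0; exists i.+1 => n ni.
by rewrite /unit_seq gtn_eqF// modulus0.
Qed.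

Definition unit_c0 i : c0 := c0_of (unit_seq_cvg0 i).

Lemma coord_sum_unit (c : nat -> K) N n :
  coord n (\sum_(0 <= i < N) c i *: unit_c0 i) = if (n < N)%N then c n else 0.
Proof.
rewrite operator_sum; under eq_bigr do rewrite operatorZ coord_c0_of.
elim: N => [|N ih]; first by rewrite big_geq.
rewrite big_nat_recr//= ih /unit_seq ltnS -[_ *: _]/(c N * (n == N)%:R).
by case: ltngtP => [_|_|->]; rewrite ?mulr0 ?addr0 ?mulr1 ?add0r.
Qed.

Lemma c0_truncation x (e : R) : 0 < e -> exists N, forall N', (N <= N')%N ->
  rnorm (x - \sum_(0 <= i < N') coord i x *: unit_c0 i) <= e.
Proof.
move=> e0; have [N hN] := (cvgn0_modulusP _).1 (coord_cvg0 x) e e0.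
exists N => N' NN'; apply: rnorm_c0_le => n; rewrite operatorB coord_sum_unit.
case: ltnP => [_|N'n]; first by rewrite subrr modulus0 ltW.
by rewrite subr0; apply/ltW/hN; exact: leq_trans N'n.
Qed.

(** Evaluate chi at the vector of the unit ball whose i-th coordinate c i
    turns chi (c i *: unit_c0 i) into the modulus of chi (unit_c0 i). *)
Lemma c0_functional_sum (chi : dual c0) (M : R) N :
  (forall x, rnorm x <= 1 -> modulus (chi x) <= M) ->
  \sum_(0 <= i < N) modulus (chi (unit_c0 i)) <= M.
Proof.
move=> chiM; pose c i : K := `|chi (unit_c0 i)| / chi (unit_c0 i).
have c1 i : modulus (c i) <= 1.
  rewrite modulusM modulus_norm modulusV.
  have [->|n0] := eqVneq (modulus (chi (unit_c0 i))) 0; first by rewrite mul0r.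
  by rewrite divff.
have cE i : c i * chi (unit_c0 i) = real_scalar k (modulus (chi (unit_c0 i))).
  rewrite /c real_scalar_modulus; have [->|n0] := eqVneq (chi (unit_c0 i)) 0.
    by rewrite normr0 mulr0.
  by rewrite divfK.
have := chiM (\sum_(0 <= i < N) c i *: unit_c0 i); rewrite operator_sum.
rewrite (eq_bigr (fun i => real_scalar k (modulus (chi (unit_c0 i))))); last first.
  by move=> i _; rewrite (operatorZ chi); exact: cE.
rewrite -(big_morph _ (@real_scalarD R k) (real_scalar0 R k)) modulus_real; last first.
  by apply: sumr_ge0 => i _; exact: modulus_ge0.
apply; apply: rnorm_c0_le => n; rewrite coord_sum_unit.
by case: ifP => // _; rewrite modulus0.
Qed.

End c0_space.

(** * Operators into c0 *)

Lemma tvs_cvg_sub0 (K : numFieldType) (E : tvsType K) (u : nat -> E) (l : E) :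
  (fun n => u n - l) @ \oo --> (0 : E) -> u @ \oo --> l.
Proof.
move=> ul A Al; have A0 : nbhs 0 [set y | A (l + y)].
  apply: filterS (_ : nbhs 0 (+%R (- l) @` A)) => [_ [y Ay <-]|].
    by rewrite /= addNKr.
  by rewrite -(addNr l); exact: nbhsB.
by have [N _ hN] := ul _ A0; exists N => // n /hN /=; rewrite addrC subrK.
Qed.

Section operators_into_c0.
Variables (R : realType) (k : field_kind).
Local Notation K := (scalar_field R k).
Variables (L : tvsType K) (eta : nat -> strong_dual L).
Hypotheses (barL : c0_barrelled L) (eta0 : weakly_null eta).

(** The operator sends y to the null sequence of the eta n y. Its continuity
    is the equicontinuity of the eta n, which c0-barrelledness provides. *)
Lemma sequence_operator : exists S : operator L (c0 R k),
  forall n y, c0_coord R k n (S y) = eta n y.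
Proof.
pose S y := c0_of (weakly_null_pointwise y eta0).
have SE n y : c0_coord R k n (S y) = eta n y by exact: coord_c0_of.
have lS : linear S.
  move=> c y z; apply: c0_ext => n.
  by rewrite operatorD operatorZ !SE operatorD operatorZ.
have cS : continuous S.
  apply: linear_continuous0 => // V /nbhs0_rnormP[r r0 rV].
  have re0 : 0 < real_scalar k r by rewrite real_scalar_gt0.
  have := @barL eta (fun y => weakly_null_pointwise y eta0) 0 _
    (@entourage_ball K K^o (PosNum re0)).
  apply: filterS => y hy; apply: rV; apply: rnorm_c0_le => n; rewrite SE.
  have := hy n I; rewrite /= -ball_normE /= operator0 sub0r normrN ltr_norm_real.
  exact: ltW.
have oS : S \in @is_operator K L (c0 R k) by rewrite inE.
by exists (Operator oS).
Qed.

Variable (S : operator L (c0 R k)).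
Hypothesis SE : forall n y, c0_coord R k n (S y) = eta n y.

Lemma adjoint_sequence_operator n : adjoint S (c0_coord R k n) = eta n.
Proof. by apply/val_inj/funext => y; exact: SE. Qed.

(** The image of chi is the sum of the series of the chi (unit_c0 i) *: eta i.
    Its partial sums are absolutely convex combinations of the eta i. They
    converge uniformly on a bounded set B because the eta i are uniformly
    bounded on B and the moduli of the coefficients have a finite sum. *)
Lemma adjoint_in_hull (chi : strong_dual (c0 R k)) :
  (forall x, rnorm x <= 1 -> modulus (chi x) <= 1) ->
  closed_abs_convex_hull (range eta) (adjoint S chi).
Proof.
move=> chi1 C [[cC aC] etaC].
pose al i : K := chi (unit_c0 R k i).
pose u N : strong_dual L := \sum_(0 <= i < N) al i *: eta i.
have sum_al N := c0_functional_sum N chi1.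
have uC N : C (u N).
  by apply: absolutely_convex_sum => // [i|]; [apply: etaC; exists i|exact: sum_al].
suff /(closed_cvg (F := \oo) C cC) : u @ \oo --> adjoint S chi.
  by apply; exists 0%N => // N _; exact: uC.
have uE N y : u N y = \sum_(0 <= i < N) al i * eta i y.
  by rewrite -[LHS]/(evaluation y (u N)) operator_sum.
have suml N y : chi (\sum_(0 <= i < N) c0_coord R k i (S y) *: unit_c0 R k i) = u N y.
  rewrite operator_sum uE; apply: eq_bigr => i _.
  by rewrite (operatorZ chi) SE mulrC.
pose A N := \sum_(0 <= i < N) modulus (al i).
have A_tail (d : R) : 0 < d -> exists N0, forall N N', (N0 <= N)%N -> (N <= N')%N ->
    \sum_(N <= i < N') modulus (al i) <= d.
  move=> d0; have cA : cvgn A.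
    apply: nondecreasing_is_cvgn; last by exists 1 => _ [N _ <-]; exact: sum_al.
    move=> m n mn; rewrite /A (big_cat_nat _ mn)//= lerDl.
    by apply: sumr_ge0 => i _; exact: modulus_ge0.
  have /cvgrPdist_lt/(_ _ (divr_gt0 d0 (ltr0n _ 2)))[N0 _ hN0] := cA.
  exists N0 => N N' N0N NN'.
  have -> : \sum_(N <= i < N') modulus (al i) = A N' - A N.
    by rewrite /A [X in _ = X - _](big_cat_nat _ NN')//= [RHS]addrC addKr.
  apply: le_trans (ler_norm _) _; rewrite -(subrKA (lim (A @ \oo))).
  apply: le_trans (ler_normD _ _) _; rewrite (splitr d) lerD//.
    by rewrite distrC; apply/ltW/hN0; exact: leq_trans NN'.
  exact/ltW/hN0.
apply: tvs_cvg_sub0; apply/cvgn0_strongP => B e bB e0.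
have [M M0 hM] := tvs_bounded_seminorm (tvs_bounded_operator_image S bB)
  (@rnorm_continuous_seminorm R k _).
have [C' C'0 hC'] := seminorm_le_rnorm (functional_seminorm chi).
have M1 : 0 < M + 1 by rewrite ltr_wpDl.
have C1 : 0 < C' + 1 by rewrite ltr_wpDl.
have e20 : 0 < e / 2 by rewrite divr_gt0.
have [N0 hN0] := A_tail _ (divr_gt0 e20 M1).
exists N0 => N y N0N By.
have [N1 hN1] := c0_truncation (S y) (divr_gt0 e20 C1).
pose N' := maxn N N1.
rewrite -[X in modulus X]/(u N y - chi (S y)).
apply: le_lt_trans (modulus_triangle _ (u N' y) _) _; rewrite [ltRHS]splitr ltr_leD//.
  rewrite modulusC !uE (big_cat_nat _ (leq_maxl N N1 : (N <= N')%N))//= [X in modulus X]addrC addKr.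
  apply: le_lt_trans (modulus_sum _ _ _) _.
  apply: (@le_lt_trans _ _ (\sum_(N <= i < N') M * modulus (al i))).
    apply: ler_sum => i _; rewrite modulusM mulrC ler_wpM2r ?modulus_ge0//.
    rewrite -SE; apply: le_trans (modulus_coord_le _ _) (hM _ _).
    by exists y.
  rewrite -mulr_sumr; apply: (@le_lt_trans _ _ (M * (e / 2 / (M + 1)))).
    by rewrite ler_wpM2l// hN0// leq_maxl.
  by rewrite mulrA ltr_pdivrMr// mulrC ltr_pM2l// ltrDl.
rewrite modulusC -suml -operatorB; apply: le_trans (hC' _) _.
apply: (@le_trans _ _ (C' * (e / 2 / (C' + 1)))).
  by rewrite ler_wpM2l// hN1// leq_maxr.
by rewrite mulrA ler_pdivrMr// mulrC ler_pM2l// lerDl.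
Qed.

End operators_into_c0.

Section composition_with_c0.
Variables (R : realType) (k : field_kind).
Local Notation K := (scalar_field R k).
Local Notation rs := (@real_scalar R k).
Variables (E L : tvsType K) (p : \bar R) (p1 : (1 <= p)%E) (T : operator E L).

(** The n-th coordinate of S (T (x j)) is the n-th functional of a weakly null
    sequence at T (x j). It is small for large n uniformly in j, because T
    maps the range of x to an infty_Vstar set, and each of the finitely many
    other coordinates tends to 0 with j. *)
Lemma assertion_i_implies_vii : assertion_i p T -> assertion_vii p T.
Proof.
move=> hi S S0 x xp; apply/cvgn0_rnormP => e e0.
have := assertion_iii_implies_iv p1 (assertion_ii_implies_iii p1 (assertion_i_implies_ii hi)) xp.
move=> /infty_VstarP[_ /(_ _ S0 e e0)[N1 h1]].
have coordE n y : c0_coord R k n (S y) = adjoint S (c0_coord R k n) y by [].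
have [N2 h2] : exists N2, forall n j, (n < N1)%N -> (N2 <= j)%N ->
    modulus (c0_coord R k n (S (T (x j)))) <= e.
  elim: N1 {h1} => [|N1 [N2 h2]]; first by exists 0%N.
  have chi0 := weakly_summable_null p1 xp (adjoint T (adjoint S (c0_coord R k N1))).
  have [N3 h3] := (cvgn0_modulusP _).1 chi0 e e0.
  exists (maxn N2 N3) => n j; rewrite ltnS leq_eqVlt geq_max.
  by move=> /predU1P[->|nN1] /andP[j2 j3]; [exact/ltW/h3|exact: h2].
exists N2 => j N2j; apply: rnorm_c0_le => n.
have [nN1|N1n] := ltnP n N1; first exact: h2.
by rewrite coordE; apply: h1 => //; exists (x j) => //; exists j.
Qed.

Lemma assertion_vii_implies_i : c0_barrelled L -> assertion_vii p T -> assertion_i p T.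
Proof.
move=> barL hvii eta x eta0 xp; have [S SE] := sequence_operator barL eta0.
have Sx : (S \o T \o x) @ \oo --> (0 : c0 R k).
  apply: (hvii S) => //; rewrite (_ : (fun n => _) = eta)//; apply/funext => n.
  exact: adjoint_sequence_operator.
by under eq_fun do rewrite -SE; exact: cvg0_diagonal_coord Sx.
Qed.

Lemma weakly_cauchy_differences (F : tvsType K) (x : nat -> F) (m : nat -> nat) :
  strictly_increasing m -> weakly_cauchy x -> weakly_null (fun n => x (m n) - x n).
Proof.
move=> mi cx chi; apply/cvgn0_modulusP => e e0.
have re0 : 0 < rs e by rewrite real_scalar_gt0.
have /cauchy_ballP/(_ _ re0)[[A B] /= [[N1 _ h1] [N2 _ h2]] AB] := cx chi.
exists (maxn N1 N2) => n; rewrite geq_max => /andP[N1n N2n].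
rewrite operatorB modulusC -ltr_norm_real distrC.
have := AB (chi (x (m n)), chi (x n)); rewrite -ball_normE /=; apply; split.
  by apply: h1; exact: leq_trans N1n (strictly_increasing_ge mi n).
exact: h2.
Qed.

(** If S (T (x n)) does not tend to 0, take norming functionals at these
    points, scaled into U. Along a subsequence y of x, their images eta under
    the adjoint are weakly Cauchy and large at T (y n). For an increasing m
    with eta_j small at T (y_(m j)), the weakly null differences
    eta_(m j) - eta_j stay large at T (y_(m j)). *)
Lemma assertion_i_implies_v : assertion_i p T -> assertion_v p T.
Proof.
move=> hi Z S [U /strong_nbhs0P[B [d [bB d0 BU]]] cU] x xp.
apply/cvgn0_rnormP => e e0; apply: contrapT => nN.
have [N|s [si hs]] := @frequently_subseq (fun n => e < rnorm (S (T (x n)))).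
  apply: contrapT => h; apply: nN; exists N => n Nn; rewrite leNgt; apply/negP => en.
  by apply: h; exists n.
have [M M0 hM] := tvs_bounded_seminorm bB (@rnorm_continuous_seminorm R k Z).
have M1 : 0 < M + 1 by rewrite ltr_wpDl.
pose r := d / (M + 1); have r0 : 0 < r by rewrite divr_gt0.
have /choice[f hf] n : exists f : dual Z, (forall z, modulus (f z) <= rnorm z) /\
    rnorm (S (T (x (s n)))) <= modulus (f (S (T (x (s n))))).
  exact/seminorm_functional/rnorm_continuous_seminorm.
(* The factor r brings the norming functionals, bounded by M on B, into U. *)
have rfU n : U (rs r *: (f n : strong_dual Z)).
  apply: BU => z Bz; rewrite -[X in modulus X]/(rs r * f n z) modulusM.
  rewrite modulus_real ?(ltW r0)//; apply: (@le_lt_trans _ _ (r * M)).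
    by rewrite ler_wpM2l ?(ltW r0)//; apply: le_trans ((hf n).1 z) (hM z Bz).
  by rewrite /r mulrAC ltr_pdivrMr// ltr_pM2l// ltrDl.
pose chi n : strong_dual L := adjoint S (rs r *: (f n : strong_dual Z)).
have [t [ti ct]] := cU chi (fun n => ex_intro2 _ _ _ (rfU n) erefl).
pose y := x \o (s \o t); pose eta := chi \o t.
have yp : weakly_summable p y.
  by apply: (weakly_summable_subseq p1 _ xp); exact: strictly_increasing_comp.
have big n : r * e < modulus (eta n (T (y n))).
  rewrite -[X in modulus X]/(rs r * f (t n) (S (T (x (s (t n)))))) modulusM.
  rewrite modulus_real ?(ltW r0)// ltr_pM2l//.
  exact: lt_le_trans (hs (t n)) (hf (t n)).2.
have re0 : 0 < r * e / 2 by rewrite divr_gt0// mulr_gt0.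
have [j|m [mi hm]] := @eventually_subseq (fun j n => modulus (eta j (T (y n))) < r * e / 2).
  have yn := weakly_summable_null p1 yp.
  by have /cvgn0_modulusP/(_ _ re0) := yn (adjoint T (eta j)).
have := hi _ _ (weakly_cauchy_differences mi ct) (weakly_summable_subseq p1 mi yp).
move=> /cvgn0_modulusP/(_ _ re0)[N /(_ N (leqnn N))].
rewrite -[X in modulus X]/(eta (m N) (T (y (m N))) - eta N (T (y (m N)))) => h.
have := big (m N); apply/negP; rewrite -leNgt.
have -> : eta (m N) (T (y (m N))) =
    eta (m N) (T (y (m N))) - eta N (T (y (m N))) + eta N (T (y (m N))) by rewrite subrK.
rewrite (splitr (r * e)); apply: le_trans (modulusD _ _) _.
by apply: lerD; apply: ltW => //; exact: hm.
Qed.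

Lemma assertion_v_implies_vi : assertion_v p T -> assertion_vi p T.
Proof. by move=> hv S; exact: (hv (c0 R k) S). Qed.

(** Failure of the Cauchy condition gives pairs of arbitrarily large indices
    with distant values; spaced out, they form two strictly increasing
    sequences. *)
Lemma weakly_infty_cauchy (F : tvsType K) (x : nat -> F) :
  weakly_p_cauchy +oo x -> weakly_cauchy x.
Proof.
move=> cx chi; apply/cauchy_ballP => e e0.
have [N hN] : exists N, forall m n, (N <= m)%N -> (N <= n)%N ->
    modulus (chi (x m) - chi (x n)) < modulus e.
  apply: contrapT => nN.
  have /choice[f hf] (N : nat) : exists mn : nat * nat, [/\ (N <= mn.1)%N, (N <= mn.2)%N &
      modulus e <= modulus (chi (x mn.1) - chi (x mn.2))].
    apply: contrapT => h; apply: nN; exists N => m n Nm Nn; rewrite ltNge.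
    by apply/negP => emn; apply: h; exists (m, n).
  pose g := fix g i := if i is j.+1 then (maxn (f (g j)).1 (f (g j)).2).+1 else 0%N.
  have gf i : ((f (g i)).1 < (f (g i.+1)).1)%N /\ ((f (g i)).2 < (f (g i.+1)).2)%N.
    have [h1 h2 _] := hf (g i.+1).
    split; [apply: leq_trans h1|apply: leq_trans h2]; rewrite ltnS.
      exact: leq_maxl.
    exact: leq_maxr.
  have i1 : strictly_increasing (fun i => (f (g i)).1).
    by apply: homo_ltn => [a b c|i]; [exact: ltn_trans|exact: (gf i).1].
  have i2 : strictly_increasing (fun i => (f (g i)).2).
    by apply: homo_ltn => [a b c|i]; [exact: ltn_trans|exact: (gf i).2].
  have /weakly_summable_pinfty/(_ chi) := cx _ _ i1 i2.
  move=> /cvgn0_modulusP/(_ _ (gt0_modulus e0))[N /(_ N (leqnn N))].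
  rewrite operatorB; apply/negP; rewrite -leNgt.
  by have [_ _] := hf (g N).
pose A := [set z | exists2 n, (N <= n)%N & z = chi (x n)].
exists (A, A); first by split; exists N => // n Nn; exists n.
move=> [_ _] [/= [m Nm ->] [n Nn ->]]; rewrite -ball_normE /=.
by rewrite (ge0_real_scalarE (ltW e0)) ltr_norm_real; exact: hN.
Qed.

(** The adjoint of the operator with coordinates eta n maps the unit ball of
    the dual of c0 into the closed absolutely convex hull of the eta n, which
    is precompact because the dual of L is locally complete. *)
Lemma assertion_vi_implies_i : c0_barrelled L ->
  weakly_seq_locally_complete (strong_dual L) +oo%E -> assertion_vi p T -> assertion_i p T.
Proof.
move=> barL cL hvi eta x eta0 xp; have [S SE] := sequence_operator barL eta0.
have Sx : (S \o T \o x) @ \oo --> (0 : c0 R k).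
  apply: (hvi S) => //.
  exists [set chi : strong_dual (c0 R k) | forall y, rnorm y <= 1 -> modulus (chi y) <= 1].
    apply/strong_nbhs0P; exists [set y | rnorm y <= 1], 1; split=> //.
      exact: tvs_bounded_rnorm.
    by move=> chi h y /h /ltW.
  move=> a aS; have /cL/(_ a)[|s [si ca]] : weakly_summable +oo eta.
  - exact/weakly_summable_pinfty.
  - by move=> n; have [chi chi1 <-] := aS n; exact: adjoint_in_hull chi1.
  by exists s; split=> //; exact: weakly_infty_cauchy.
by under eq_fun do rewrite -SE; exact: cvg0_diagonal_coord Sx.
Qed.

End composition_with_c0.

(** * Limits of scalars along an ultrafilter *)

Section ultrafilter_limits.
Variables (R : realType) (G : set_system nat).
Hypothesis UG : UltraFilter G.

(** The limit is the supremum of the t such that t <= u n for G-almost all n: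
    an ultrafilter decides each of these conditions. *)
Lemma ultra_real_limit (u : nat -> R) (M : R) : (forall n, `|u n| <= M) ->
  exists l : R, forall e : R, 0 < e -> G [set n | `|u n - l| < e].
Proof.
move=> uM; pose S := [set t | G [set n | t <= u n]].
have SM : S (- M).
  by apply: filterS filterT => n _ /=; have := uM n; rewrite ler_norml => /andP[].
have Sub : ubound S M.
  move=> t St; rewrite leNgt; apply/negP => Mt.
  have [n /= tn] := filter_ex St; have := lt_le_trans Mt tn.
  by rewrite ltNge (le_trans (ler_norm _) (uM n)).
have supS : has_sup S by split; [exists (- M)|exists M].
exists (sup S) => e e0.
have [t St te] := sup_adherent e0 supS.
have [h|h] := @in_ultra_setVsetC _ G [set n | sup S + e / 2 <= u n] UG.
  have := ub_le_sup supS.2 h; rewrite -subr_ge0 opprD addrA subrr add0r oppr_ge0.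
  by rewrite leNgt divr_gt0.
apply: filterS (filterI St h) => n [/= tn /negP]; rewrite -ltNge => nS.
rewrite ltr_distl (lt_le_trans te tn)/=; apply: lt_trans nS _.
by rewrite ltrD2l ltr_pdivrMr// ltr_pMr ?ltr1n.
Qed.

Lemma ultra_scalar_limit (k : field_kind) (u : nat -> scalar_field R k) (M : R) :
  (forall n, modulus (u n) <= M) ->
  exists l, forall e : R, 0 < e -> G [set n | modulus (u n - l) < e].
Proof.
case: k u => u uM; first exact: ultra_real_limit uM.
have [|a ha] := @ultra_real_limit (fun n => complex.Re (u n)) M.
  by move=> n; exact: le_trans (le_modulus_Re _) (uM n).
have [|b hb] := @ultra_real_limit (fun n => complex.Im (u n)) M.
  by move=> n; exact: le_trans (le_modulus_Im _) (uM n).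
exists (a +i* b)%C => e e0; have e20 : 0 < e / 2 by rewrite divr_gt0.
apply: filterS (filterI (ha _ e20) (hb _ e20)) => n [/= h1 h2].
apply: le_lt_trans (modulus_le_ReIm _) _; rewrite [ltRHS]splitr ltrD//.
  by rewrite raddfB.
by rewrite raddfB.
Qed.

End ultrafilter_limits.

(** * Conjugate exponents *)

Section conjugate_exponents.
Variables (R : realType) (k : field_kind).
Local Notation K := (scalar_field R k).
Variables (r s : R) (r0 : 0 < r) (s0 : 0 < s) (rs1 : r^-1 + s^-1 = 1).
Implicit Types (b c : nat -> K).

Lemma power_sum_young b c N :
  modulus (\sum_(0 <= i < N) c i * b i) <= power_sum s c N / s + power_sum r b N / r.
Proof.
apply: le_trans (modulus_sum _ _ _) _; rewrite /power_sum !mulr_suml -big_split/=.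
apply: ler_sum => i _; rewrite modulusM.
by apply: conjugate_powR; rewrite ?modulus_ge0// addrC.
Qed.

(** Test the hypothesis on c i = |b i| ^ (r - 1) B ^ (- 1 / s) times the phase
    that makes c i b i nonnegative, where B is the power sum of b: as (r - 1)
    s = r, its power sum is 1, and the sum of the c i b i is B ^ (1 - 1 / s) =
    B ^ (1 / r). *)
Lemma power_sum_dual b N (M : R) : 0 <= M ->
  (forall c, power_sum s c N <= 1 -> modulus (\sum_(0 <= i < N) c i * b i) <= M) ->
  power_sum r b N <= M `^ r.
Proof.
move=> M0 hM; set B := power_sum r b N.
have [->|Bn0] := eqVneq B 0; first exact: powR_ge0.
have Bp : 0 < B by rewrite lt_def Bn0 power_sum_ge0.
have r1 : 0 < r - 1.
  rewrite subr_gt0 -invf_lt1// -rs1 ltrDl invr_gt0//.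
have rsE : (r - 1) * s = r.
  have -> : r - 1 = r / s.
    by rewrite -(addKr r^-1 s^-1) rs1 mulrDr mulr1 mulrN divff ?gt_eqF// addrC.
  by rewrite divfK// gt_eqF.
pose c i : K := real_scalar k (modulus (b i) `^ (r - 1) / B `^ s^-1) * (`|b i| / b i).
have t0 i : 0 <= modulus (b i) `^ (r - 1) / B `^ s^-1 by rewrite divr_ge0 ?powR_ge0.
have cs i : modulus (c i) `^ s <= modulus (b i) `^ r / B.
  rewrite modulusM modulus_real// modulusM modulus_norm modulusV.
  have [->|bn0] := eqVneq (modulus (b i)) 0.
    by rewrite mul0r mulr0 (powR0 (lt0r_neq0 s0)) divr_ge0 ?powR_ge0 ?(ltW Bp).
  rewrite divff// mulr1 powRM ?invr_ge0 ?powR_ge0// -powRN -!powRrM rsE.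
  by rewrite mulNr mulVf ?gt_eqF// powR_inv1// ltW.
have c1 : power_sum s c N <= 1.
  apply: (@le_trans _ _ (\sum_(0 <= i < N) modulus (b i) `^ r / B)).
    by apply: ler_sum => i _; exact: cs.
  by rewrite -mulr_suml divff.
have cb i : c i * b i = real_scalar k (modulus (b i) `^ r / B `^ s^-1).
  have -> : modulus (b i) `^ r / B `^ s^-1 =
      modulus (b i) `^ (r - 1) / B `^ s^-1 * modulus (b i).
    by rewrite -(mulr_powRB1 (modulus_ge0 (b i)) r0) [RHS]mulrAC [modulus _ * _]mulrC.
  rewrite real_scalarM real_scalar_modulus /c -mulrA; congr (_ * _).
  have [->|bn0] := eqVneq (b i) 0; first by rewrite normr0 mulr0.
  by rewrite divfK.
have := hM c c1.
rewrite (eq_bigr (fun i => real_scalar k (modulus (b i) `^ r / B `^ s^-1))); last first.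
  by move=> i _; exact: cb.
rewrite -(big_morph _ (@real_scalarD R k) (real_scalar0 R k)) modulus_real; last first.
  by apply: sumr_ge0 => i _; rewrite divr_ge0 ?powR_ge0.
rewrite -mulr_suml -/(power_sum r b N) -/B => BM.
have BE : B / B `^ s^-1 = B `^ r^-1.
  rewrite -{1}(powRr1 (ltW Bp)) -powRB ?Bn0 ?implybT//; congr (_ `^ _).
  by rewrite -rs1 addrK.
rewrite -[leLHS](powRr1 (ltW Bp)) -(mulVf (lt0r_neq0 r0)) powRrM -BE.
by apply: ge0_ler_powR; rewrite ?nnegrE ?(ltW r0)// divr_ge0 ?powR_ge0// ltW.
Qed.

End conjugate_exponents.

(** * Upper estimates for sequences in l_q *)

Section ell_blocks.
Variables (R : realType) (k : field_kind).
Local Notation K := (scalar_field R k).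
Variables (q : \bar R) (q1 : (1 <= q)%E) (s : R) (qE : q = s%:E).
Local Notation ell := (ell k q1).
Local Notation e_ := (unit_ell k q1 qE).
Implicit Types (a d : ell).

Let s0 : 0 < s := ell_exponent_gt0 q1 qE.
Let sn := @rnorm_seminorm R k ell.

Definition ell_coord a (n : nat) : K := a n.

Lemma ell_ext a d : (forall n, ell_coord a n = ell_coord d n) -> a = d.
Proof. by move=> ad; apply/val_inj/funext => n; exact: ad. Qed.

Lemma ell_coordD a d n : ell_coord (a + d) n = ell_coord a n + ell_coord d n.
Proof. by []. Qed.

Lemma ell_coordZ c a n : ell_coord (c *: a) n = c * ell_coord a n.
Proof. by []. Qed.

Lemma ell_coord0 n : ell_coord 0 n = 0.
Proof. by []. Qed.

Lemma ell_coordB a d n : ell_coord (a - d) n = ell_coord a n - ell_coord d n.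
Proof. by []. Qed.

Lemma ell_coord_sum (I : Type) (t : seq I) (P : pred I) (F : I -> ell) n :
  ell_coord (\sum_(i <- t | P i) F i) n = \sum_(i <- t | P i) ell_coord (F i) n.
Proof.
exact: (big_morph (fun a => ell_coord a n) (fun a d => ell_coordD a d n) (ell_coord0 n)).
Qed.

(** The restriction of a to the indices of the interval from m to n - 1. *)
Definition block m n a : ell := \sum_(m <= i < n) ell_coord a i *: e_ i.

Lemma block_coord m n a j :
  ell_coord (block m n a) j = if (m <= j < n)%N then ell_coord a j else 0.
Proof.
rewrite ell_coord_sum.
have E i : ell_coord (ell_coord a i *: e_ i) j = if j == i then ell_coord a j else 0.
  rewrite ell_coordZ -[ell_coord (e_ i) j]/((j == i)%:R).
  by case: eqP => [->|]; rewrite ?mulr1 ?mulr0.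
under eq_bigr do rewrite E.
case: ifP => [mjn|mjn].
  rewrite (@bigD1_seq _ _ _ _ _ j)/= ?mem_index_iota ?iota_uniq// eqxx.
  by rewrite big1 ?addr0// => i /negPf; rewrite eq_sym => ->.
rewrite big_seq big1// => i; rewrite mem_index_iota => min.
by case: eqP => // ji; rewrite ji min in mjn.
Qed.

Lemma rnorm_block_le m n a : rnorm (block m n a) <= \sum_(m <= i < n) modulus (ell_coord a i).
Proof.
apply: le_trans (seminorm_sum sn _ _ _) _; apply: ler_sum => i _.
by rewrite (seminormZ sn) ler_piMr ?modulus_ge0// rnorm_unit_ell.
Qed.

Lemma rnorm_le_coord a d : (forall i, modulus (ell_coord a i) <= modulus (ell_coord d i)) ->
  rnorm a <= rnorm d.
Proof.
move=> ad; apply: (rnorm_le_power_sum qE) => [|N]; first exact: (seminorm_ge0 sn).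
apply: le_trans (power_sum_le_rnorm qE d N); apply: ler_sum => i _.
by apply: ge0_ler_powR; rewrite ?nnegrE ?modulus_ge0 ?(ltW s0)//; exact: ad.
Qed.

Lemma ell_tail_small d (e : R) : 0 < e -> exists N, forall N', (N <= N')%N ->
  rnorm (d - block 0 N' d) <= e.
Proof.
move=> e0; pose A := power_sum s (ell_coord d).
have cA : cvgn A.
  apply: nondecreasing_is_cvgn; first exact: power_sum_mono.
  by exists (rnorm d `^ s) => _ [N _ <-]; exact: power_sum_le_rnorm.
have es0 : 0 < e `^ s / 2 by rewrite divr_gt0 ?powR_gt0.
have /cvgrPdist_lt/(_ _ es0)[N _ hN] := cA.
exists N => N' NN'; apply: (rnorm_le_power_sum qE) => [|n]; first exact: ltW.
have E i : modulus (ell_coord (d - block 0 N' d) i) `^ s =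
    if (i < N')%N then 0 else modulus (ell_coord d i) `^ s.
  rewrite ell_coordB block_coord /=; case: ifP => _; last by rewrite subr0.
  by rewrite subrr modulus0 powR0// gt_eqF.
rewrite /power_sum (eq_bigr _ (fun i _ => E i)).
pose n' := maxn N' n.
apply: (@le_trans _ _ (A n' - A N')).
  have E0 i : 0 <= (if (i < N')%N then 0 else modulus (ell_coord d i) `^ s).
    by case: ifP => // _; exact: powR_ge0.
  apply: (@le_trans _ _ (\sum_(0 <= i < n')
      (if (i < N')%N then 0 else modulus (ell_coord d i) `^ s))).
    rewrite [leRHS](big_cat_nat _ (leq_maxr N' n : (n <= n')%N))//= lerDl.
    by apply: sumr_ge0 => i _; exact: E0.
  rewrite (big_cat_nat _ (leq_maxl N' n : (N' <= n')%N))//=.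
  rewrite big_nat big1 => [|i /andP[_ ->]//]; rewrite add0r.
  rewrite /A /power_sum [X in _ <= X - _](big_cat_nat _ (leq_maxl N' n : (N' <= n')%N))//=.
  rewrite [leRHS]addrC addKr big_nat [leRHS]big_nat; apply: ler_sum => i /andP[N'i _].
  by rewrite ltnNge N'i.
apply: le_trans (ler_norm _) _; rewrite -(subrKA (lim (A @ \oo))).
apply: le_trans (ler_normD _ _) _; rewrite (splitr (e `^ s)) lerD//.
  by rewrite distrC; apply/ltW/hN/(leq_trans NN'); exact: leq_maxl.
exact/ltW/hN.
Qed.

Lemma ell_coord_le a i : modulus (ell_coord a i) <= rnorm a.
Proof.
rewrite leNgt; apply/negP => h.
have : rnorm a `^ s < modulus (ell_coord a i) `^ s.
  by apply: gt0_ltr_powR; rewrite ?nnegrE ?modulus_ge0 ?(seminorm_ge0 sn).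
apply/negP; rewrite -leNgt; apply: le_trans (power_sum_le_rnorm qE a i.+1).
rewrite /power_sum big_nat_recr//= lerDr; apply: sumr_ge0 => j _; exact: powR_ge0.
Qed.

Lemma powR_add_le (x y : R) : 0 <= x -> 0 <= y ->
  (x + y) `^ s <= 2 `^ s * (x `^ s + y `^ s).
Proof.
move=> x0 y0; wlog xy : x y x0 y0 / x <= y.
  move=> h; have [/h|/ltW/h] := leP x y; first exact.
  by rewrite addrC [_ `^ s + _]addrC; exact.
apply: (@le_trans _ _ ((2 * y) `^ s)).
  apply: ge0_ler_powR; rewrite ?nnegrE ?(ltW s0) ?addr_ge0 ?mulr_ge0//.
  by rewrite mulr_natl mulr2n lerD2r.
by rewrite powRM// ler_wpM2l ?powR_ge0// lerDr powR_ge0.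
Qed.

(** Taking the coordinates of l as limits along an ultrafilter spares the
    diagonal extraction of subsequences. *)
Lemma bounded_ell_limit (G : set_system nat) (a : nat -> ell) (M : R) :
  UltraFilter G -> (forall n, rnorm (a n) <= M) ->
  exists l : ell, forall N (e : R), 0 < e ->
    G [set n | \sum_(0 <= i < N) modulus (ell_coord (a n - l) i) <= e].
Proof.
move=> UG aM.
have /choice[al hal] (i : nat) : exists l : K, forall e : R, 0 < e ->
    G [set n | modulus (ell_coord (a n) i - l) < e].
  by apply: (@ultra_scalar_limit R G UG k _ M) => n; exact: le_trans (ell_coord_le _ _) (aM n).
have hN N (e : R) : 0 < e ->
    G [set n | forall i, (i < N)%N -> modulus (ell_coord (a n) i - al i) < e].
  move=> e0; elim: N => [|N ih]; first by apply: filterS filterT => n _ i.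
  apply: filterS (filterI ih (hal N e e0)) => n [/= h1 h2] i.
  by rewrite ltnS leq_eqVlt => /predU1P[->//|]; exact: h1.
have al_ell : (al : nat -> K^o) \in in_ell q1.
  (* Up to index N the coordinates of l are those of some a n up to an error
     whose power sum is at most 1. *)
  apply: (@in_ell_power_sum R k q q1 s qE al (2 `^ s * (M `^ s + 1))) => N.
  pose de : R := N.+1%:R^-1 `^ s^-1.
  have de0 : 0 < de by rewrite powR_gt0 ?invr_gt0.
  have [n /= hn] := filter_ex (hN N de de0).
  apply: (@le_trans _ _ (\sum_(0 <= i < N) 2 `^ s * (modulus (ell_coord (a n) i) `^ s + de `^ s))).
    rewrite /power_sum !big_nat; apply: ler_sum => i /andP[_ iN].
    apply: le_trans (powR_add_le _ (ltW de0)); last exact: modulus_ge0.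
    apply: ge0_ler_powR; rewrite ?nnegrE ?(ltW s0) ?addr_ge0 ?modulus_ge0 ?(ltW de0)//.
    rewrite -[al i](subrK (ell_coord (a n) i)) addrC; apply: le_trans (modulusD _ _) _.
    by rewrite lerD2l modulusC ltW// hn.
  rewrite -mulr_sumr ler_wpM2l ?powR_ge0// big_split/= lerD//.
    apply: le_trans (power_sum_le_rnorm qE (a n) N) _.
    have M0 : 0 <= M := le_trans (seminorm_ge0 sn _) (aM n).
    by apply: ge0_ler_powR; rewrite ?nnegrE ?(ltW s0) ?(seminorm_ge0 sn).
  rewrite -powRrM mulVf ?gt_eqF// powRr1 ?invr_ge0//.
  by rewrite sumr_const_nat subn0 -[_ *+ N]mulr_natl ler_pdivrMr// mul1r ler_nat.
exists (Ell al_ell) => N e e0; have de0 : 0 < e / N.+1%:R by rewrite divr_gt0.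
apply: filterS (hN N _ de0) => n h; rewrite /mkset.
apply: (@le_trans _ _ (\sum_(0 <= i < N) e / N.+1%:R)).
  rewrite !big_nat; apply: ler_sum => i /andP[_ iN]; rewrite ell_coordB.
  exact/ltW/h.
rewrite sumr_const_nat subn0 -[_ *+ N]mulr_natl mulrCA ler_piMr ?(ltW e0)//.
by rewrite ler_pdivrMr// mul1r ler_nat.
Qed.

(** For the coordinates of a combination of disjointly supported vectors. *)
Lemma powR_single_sum (z : nat -> K) n :
  (forall i j, z i != 0 -> z j != 0 -> i = j) ->
  modulus (\sum_(0 <= i < n) z i) `^ s <= \sum_(0 <= i < n) modulus (z i) `^ s.
Proof.
move=> z1; have [[i [i_n zi]]|h] := pselect (exists i, (i < n)%N /\ z i != 0).
  rewrite !(@bigD1_seq _ _ _ _ _ i)/= ?mem_index_iota ?iota_uniq//.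
  rewrite big1 => [|j ji]; last first.
    by apply/eqP; apply: contraNT ji => zj; apply/eqP/z1.
  by rewrite addr0 lerDl; apply: sumr_ge0 => j _; exact: powR_ge0.
rewrite big_nat big1 => [|i /andP[_ i_n]]; last first.
  by apply/eqP; apply: contraPT h => zi; apply; exists i.
by rewrite modulus0 powR0 ?gt_eqF//; apply: sumr_ge0 => j _; exact: powR_ge0.
Qed.

(** Gliding blocks. Indices t i and disjoint consecutive intervals are chosen
    in turn, so that d (t i) differs by at most 2 * 2 ^- i from its
    restriction u i to the i-th interval. The u i being disjointly supported,
    the s-th power of the norm of a combination of them is at most the sum of
    the powers |c i| ^ s M ^ s. *)
Lemma coordinate_null_upper_estimate (d : nat -> ell) (M : R) :
  (forall n, rnorm (d n) <= M) ->
  (forall N (e : R) m, 0 < e -> exists2 n, (m <= n)%N &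
     \sum_(0 <= i < N) modulus (ell_coord (d n) i) <= e) ->
  exists t, strictly_increasing t /\ exists2 C : R, 0 <= C &
    forall c n, power_sum s c n <= 1 ->
      rnorm (\sum_(0 <= i < n) c i *: d (t i)) <= C.
Proof.
move=> dM d0; have M0 : 0 <= M := le_trans (seminorm_ge0 sn _) (dM 0%N).
pose ep (i : nat) : R := 2^-1 ^+ i.
have ep0 i : 0 < ep i by rewrite exprn_gt0.
(* The state x holds the step number, the previous index and the left end of
   the next interval. *)
have /choice[F hF] (x : nat * (nat * nat)) : exists y : nat * nat,
    [/\ (x.2.1 < y.1)%N, (x.2.2 <= y.2)%N,
      rnorm (block 0 x.2.2 (d y.1)) <= ep x.1 &
      rnorm (d y.1 - block 0 y.2 (d y.1)) <= ep x.1].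
  have [n mn hn] := d0 x.2.2 _ x.2.1.+1 (ep0 x.1).
  have [N hN] := ell_tail_small (d n) (ep0 x.1).
  exists (n, maxn x.2.2 N); split=> //=; first exact: leq_maxl.
    exact: le_trans (rnorm_block_le _ _ _) hn.
  by apply: hN; exact: leq_maxr.
pose st := fix st i := if i is j.+1 then F (j, st j) else (0, 0)%N.
pose t i := (st i.+1).1; pose N_ i := (st i).2.
have stS i : [/\ ((st i).1 < t i)%N, (N_ i <= N_ i.+1)%N,
    rnorm (block 0 (N_ i) (d (t i))) <= ep i &
    rnorm (d (t i) - block 0 (N_ i.+1) (d (t i))) <= ep i] by exact: hF (i, st i).
have N_mono : {homo N_ : i j / (i <= j)%N}.
  by apply: homo_leq => [|i j l|i]; [by []|exact: leq_trans|by case: (stS i)].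
exists t; split.
  by apply: homo_ltn => [i j l|i]; [exact: ltn_trans|by case: (stS i.+1)].
pose u i : ell := block (N_ i) (N_ i.+1) (d (t i)).
pose v i : ell := block 0 (N_ i) (d (t i)) + (d (t i) - block 0 (N_ i.+1) (d (t i))).
have uv i : d (t i) = u i + v i.
  apply: ell_ext => j; rewrite /u /v.
  rewrite 2!ell_coordD ell_coordB !block_coord /=.
  have [_ NN _ _] := stS i.
  have [jN|Nj] := ltnP j (N_ i).
    by rewrite (leq_trans jN NN) subrr addr0 add0r.
  by case: ifP => _; rewrite ?subrr ?subr0 ?addr0 ?add0r.
have vep i : rnorm (v i) <= 2 * ep i.
  have [_ _ h1 h2] := stS i; apply: le_trans (seminormD sn _ _) _.
  by rewrite mulr_natl mulr2n lerD.
have geo n : \sum_(0 <= i < n) ep i <= 2.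
  suff -> : \sum_(0 <= i < n) ep i = 2 - 2 * ep n by rewrite gerBl mulr_ge0// ltW.
  elim: n => [|n ih]; first by rewrite big_geq// /ep expr0 mulr1 subrr.
  by rewrite big_nat_recr//= ih /ep exprS; field.
(* M bounds the combination of the u i, and 4 is twice the sum of the 2 ^- i.
   *)
exists (M + 4); first by rewrite addr_ge0.
move=> c n cn.
have c1 i : (i < n)%N -> modulus (c i) <= 1.
  move=> i_n; rewrite leNgt; apply/negP => h.
  have : 1 `^ s < modulus (c i) `^ s.
    by apply: gt0_ltr_powR; rewrite ?nnegrE ?modulus_ge0.
  rewrite powR1; apply/negP; rewrite -leNgt; apply: le_trans cn.
  rewrite /power_sum (@bigD1_seq _ _ _ _ _ i)/= ?mem_index_iota ?iota_uniq//.
  by rewrite lerDl; apply: sumr_ge0 => j _; exact: powR_ge0.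
under eq_bigr do rewrite uv scalerDr.
rewrite big_split /=; apply: le_trans (seminormD sn _ _) _; apply: lerD; last first.
  apply: le_trans (seminorm_sum sn _ _ _) _.
  apply: (@le_trans _ _ (\sum_(0 <= i < n) 2 * ep i)).
    rewrite !big_nat; apply: ler_sum => i /andP[_ i_n]; rewrite (seminormZ sn).
    by apply: le_trans (vep i); rewrite ler_piMl ?(seminorm_ge0 sn)// c1.
  by rewrite -mulr_sumr (_ : 4 = 2 * 2 :> R) ?ler_wpM2l// -natrM.
apply: (rnorm_le_power_sum qE) => // N.
have disj j i l : c i * ell_coord (u i) j != 0 -> c l * ell_coord (u l) j != 0 -> i = l.
  rewrite !block_coord; case: ifP => [/andP[h1 h2]|]; last by rewrite mulr0 eqxx.
  case: ifP => [/andP[h3 h4]|]; last by rewrite mulr0 eqxx.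
  move=> _ _; apply/eqP; rewrite eqn_leq; apply/andP; split; rewrite leqNgt; apply/negP => lt.
    by have := leq_trans h4 (N_mono _ _ lt); rewrite ltnNge h1.
  by have := leq_trans h2 (N_mono _ _ lt); rewrite ltnNge h3.
apply: (@le_trans _ _ (\sum_(0 <= j < N) \sum_(0 <= i < n)
    modulus (c i) `^ s * modulus (ell_coord (u i) j) `^ s)).
  apply: ler_sum => j _; rewrite -[X in modulus X]/(ell_coord (\sum_(0 <= i < n) c i *: u i) j).
  rewrite ell_coord_sum; under eq_bigr do rewrite ell_coordZ.
  apply: le_trans (powR_single_sum n (disj j)) _.
  by apply: ler_sum => i _; rewrite modulusM powRM ?modulus_ge0.
rewrite exchange_big /=; apply: (@le_trans _ _ (\sum_(0 <= i < n) modulus (c i) `^ s * M `^ s)).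
  apply: ler_sum => i _; rewrite -mulr_sumr ler_wpM2l ?powR_ge0//.
  apply: le_trans (power_sum_le_rnorm qE (u i) N) _.
  apply: ge0_ler_powR; rewrite ?nnegrE ?(ltW s0) ?(seminorm_ge0 sn)//.
  apply: le_trans (dM (t i)); apply: rnorm_le_coord => j.
  by rewrite block_coord; case: ifP => // _; rewrite modulus0 modulus_ge0.
by rewrite -mulr_suml ler_piMl ?powR_ge0.
Qed.

End ell_blocks.

(** * Operators on l_q for a finite conjugate exponent *)

Lemma hoelder_conjugate_real (R : realType) (r : R) : 1 < r -> exists s : R,
  [/\ hoelder_conjugate r%:E = s%:E, 0 < s & r^-1 + s^-1 = 1].
Proof.
move=> r1; have r0 : 0 < r := lt_trans ltr01 r1.
have d0 : 0 < 1 - r^-1 by rewrite subr_gt0 invf_lt1.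
exists (1 - r^-1)^-1; split; rewrite ?invr_gt0//; last by rewrite invrK addrC subrK.
apply/esym/hoelder_conjugateP; rewrite ?eqe ?gt_eqF ?ltNyr//.
by rewrite !inver ?invr_eq0 !gt_eqF// invrK -EFinD addrC subrK.
Qed.

(** After subtraction of its coordinatewise limit, a bounded sequence of l_q
    has a subsequence d satisfying an upper q-estimate. Applied to d, a
    functional chi o S inherits the estimate, which by duality of power sums
    says that the scalars chi (S (d n)) belong to l_r. *)
Lemma ell_operator_compact (R : realType) (k : field_kind)
    (E : tvsType (scalar_field R k)) (r s : R) (q : \bar R) (q1 : (1 <= q)%E) :
  0 < r -> r^-1 + s^-1 = 1 -> q = s%:E ->
  forall S : operator (ell k q1) E, weakly_seq_compact_map r%:E S.
Proof.
move=> r0 rs1 qE S; have s0 := ell_exponent_gt0 q1 qE.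
have sn := @rnorm_seminorm R k (ell k q1).
exists [set a | rnorm a <= 1]; first by apply/nbhs0_rnormP; exists 1.
move=> b bU; have /choice[a /all_and2[a1 Sa]] n : exists a, rnorm a <= 1 /\ S a = b n.
  by have [a a1 ab] := bU n; exists a.
have [G [UG Goo]] := @ultraFilterLemma nat \oo _.
have [l hl] := bounded_ell_limit qE UG a1.
have [n|N e m e0|t [ti [C C0 hC]]] :=
    @coordinate_null_upper_estimate R k q q1 s qE (fun n => a n - l) (1 + rnorm l).
- by apply: le_trans (seminormB sn _ _) _; rewrite lerD2r a1.
- have Gm : G [set n | (m <= n)%N] by apply: Goo; exists m.
  by have [n [mn hn]] := filter_ex (filterI Gm (hl N e e0)); exists n.
exists t, (S l); split=> // chi; rewrite /=.
apply/(ell_norm_finP _ r0).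
have [D D0 hD] := seminorm_le_rnorm (functional_seminorm (adjoint S chi)).
exists ((D * C) `^ r) => N; apply: (power_sum_dual r0 s0 rs1); first exact: mulr_ge0.
move=> c c1.
have -> : \sum_(0 <= i < N) c i * (chi \o (fun n => (b \o t) n - S l)) i =
    adjoint S chi (\sum_(0 <= i < N) c i *: (a (t i) - l)).
  rewrite operator_sum; apply: eq_bigr => i _; rewrite operatorZ.
  by rewrite -[adjoint S chi _]/(chi (S (a (t i) - l))) operatorB Sa.
by apply: le_trans (hD _) _; rewrite ler_wpM2l// hC.
Qed.

Section series_operator.
Variables (R : realType) (k : field_kind).
Local Notation K := (scalar_field R k).

Lemma hausdorff_seminorm_eq0 (E : tvsType K) (z : E) : hausdorff_space E ->
  (forall (q : E -> R) (e : R), continuous_seminorm q -> 0 < e -> q z <= e) -> z = 0.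
Proof.
move=> hE hz; apply: hE => A B Az /nbhs0_seminorm[q cq qB].
exists z; split; first exact: nbhs_singleton.
apply: qB; apply: le_lt_trans (hz q 2^-1 cq _) _ => //.
by rewrite invf_lt1// ltr1n.
Qed.

Lemma cvg_seminorm (E : tvsType K) (u : nat -> E) (l : E) (q : E -> R) (e : R) :
  u @ \oo --> l -> continuous_seminorm q -> 0 < e ->
  exists N, forall n, (N <= n)%N -> q (u n - l) < e.
Proof.
move=> ul [sq q0] e0; have [N _ hN] := ul _ (nbhsT l (q0 e e0)).
by exists N => n /hN[y /= ye <-]; rewrite addrC addKr.
Qed.

Variables (E : tvsType K) (hE : hausdorff_space E) (cE : sequentially_complete E).
Variables (r s : R) (q : \bar R) (q1 : (1 <= q)%E).
Hypotheses (r0 : 0 < r) (rs1 : r^-1 + s^-1 = 1) (qE : q = s%:E).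
Variable x : nat -> E.
Hypothesis xr : weakly_summable r%:E x.
Local Notation ell := (ell k q1).

Let s0 : 0 < s := ell_exponent_gt0 q1 qE.
Let sn := @rnorm_seminorm R k ell.

(** By Young's inequality each functional is bounded on the combinations of
    the x i with coefficients in the unit ball of l_q; being weakly bounded,
    they form a bounded set. *)
Lemma combinations_bounded (h : E -> R) : continuous_seminorm h ->
  exists2 M : R, 0 < M & forall (c : nat -> K) N (t : R), 0 < t ->
    power_sum s c N <= t `^ s -> h (\sum_(0 <= i < N) c i *: x i) <= M * t.
Proof.
move=> ch; pose A := [set z | exists c N, power_sum s c N <= 1 /\
  z = \sum_(0 <= i < N) c i *: x i].
have [|M hM] := @weakly_bounded_seminorm R k E A h ch.
  move=> chi; have := xr chi; rewrite /= => /(ell_norm_finP _ r0)[M hM].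
  exists (1 / s + M / r) => _ [c [N [c1 ->]]].
  rewrite operator_sum (eq_bigr (fun i => c i * chi (x i))); last first.
    by move=> i _; rewrite operatorZ.
  apply: le_trans (power_sum_young r0 s0 rs1 (chi \o x) c N) _.
  by apply: lerD; rewrite ler_pM2r ?invr_gt0.
exists (Num.max M 0 + 1) => [|c N t t0 ct]; first by rewrite ltr_wpDl// le_max lexx orbT.
have rt : real_scalar k t != 0 by rewrite gt_eqF// real_scalar_gt0.
have -> : \sum_(0 <= i < N) c i *: x i =
    real_scalar k t *: \sum_(0 <= i < N) (real_scalar k t^-1 * c i) *: x i.
  rewrite scaler_sumr; apply: eq_bigr => i _; rewrite scalerA mulrA -real_scalarM.
  by rewrite divff ?gt_eqF// real_scalar1 mul1r.
rewrite (seminormZ ch.1) modulus_real ?(ltW t0)// mulrC ler_pM2r//.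
apply: (@le_trans _ _ M); last by rewrite ler_wpDr// le_max lexx.
apply: hM; exists (fun i => real_scalar k t^-1 * c i), N; split=> //.
rewrite /power_sum; under eq_bigr => i _.
  rewrite modulusM modulus_real ?invr_ge0 ?(ltW t0)// powRM ?invr_ge0 ?(ltW t0) ?modulus_ge0//.
  over.
rewrite -mulr_sumr -/(power_sum s c N).
apply: (@le_trans _ _ (t^-1 `^ s * t `^ s)); first by rewrite ler_wpM2l ?powR_ge0.
by rewrite -powRM ?invr_ge0 ?(ltW t0)// mulVf ?gt_eqF// powR1.
Qed.

(** The operator is the sum of the series a i *: x i. By combinations_bounded
    its tails are dominated by the norms of the tails of a, so that it
    converges in a sequentially complete space, and its sum is dominated by
    the norm of a. *)
Lemma series_operator : exists S : operator ell E, forall n, S (unit_ell k q1 qE n) = x n.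
Proof.
pose P (a : ell) N := \sum_(0 <= i < N) ell_coord a i *: x i.
have PD a N m : (m <= N)%N -> P a N - P a m = P (a - block qE 0 m a) N.
  move=> mN.
  have Pcat b : P b N = P b m + \sum_(m <= i < N) ell_coord b i *: x i.
    by rewrite /P (big_cat_nat _ mN).
  have -> : P (a - block qE 0 m a) N = \sum_(m <= i < N) ell_coord a i *: x i.
    rewrite Pcat {1}/P big_nat big1 => [|i /andP[_ im]].
      rewrite add0r !big_nat; apply: eq_bigr => i /andP[mi _].
      by rewrite ell_coordB block_coord ltnNge mi subr0.
    by rewrite ell_coordB block_coord /= im subrr scale0r.
  by rewrite Pcat addrC addKr.
have PM (h : E -> R) : continuous_seminorm h -> exists2 M : R, 0 < M &
    forall a N (t : R), 0 < t -> rnorm a <= t -> h (P a N) <= M * t.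
  move=> /combinations_bounded[M M0 hM]; exists M => // a N t t0 at_.
  apply: hM => //; apply: le_trans (power_sum_le_rnorm qE a N) _.
  by apply: ge0_ler_powR; rewrite ?nnegrE ?(ltW s0) ?(seminorm_ge0 sn) ?(ltW t0).
have cP a : tvs_cauchy (P a).
  move=> U /nbhs0_seminorm[h ch hU]; have [M M0 hM] := PM h ch.
  have t0 : 0 < (2 * M)^-1 by rewrite invr_gt0 mulr_gt0.
  have [N hN] := ell_tail_small qE a t0.
  have Phalf m n : (N <= m)%N -> (m <= n)%N -> h (P a n - P a m) < 1.
    move=> Nm mn; rewrite PD//; apply: le_lt_trans (hM _ _ _ t0 (hN _ Nm)) _.
    by rewrite invfM mulrCA divff ?gt_eqF// mulr1 invf_lt1// ltr1n.
  exists N => m n Nm Nn; apply: hU => /=.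
  have [mn|/ltnW nm] := leqP m n; last exact: Phalf.
  by rewrite -(seminormN ch.1) opprB; exact: Phalf.
have /choice[S PS] a := cE (cP a).
have approx a (h : E -> R) (e : R) : continuous_seminorm h -> 0 < e ->
    exists N, forall n, (N <= n)%N -> h (P a n - S a) < e.
  exact: cvg_seminorm.
have lS : linear S.
  move=> c a b; apply/eqP; rewrite -subr_eq0; apply/eqP.
  apply: hausdorff_seminorm_eq0 => // h e ch e0.
  pose d := e / (1 + modulus c + 1).
  have m0 : 0 < 1 + modulus c + 1 by rewrite ltr_wpDl// addr_ge0// modulus_ge0.
  have d0 : 0 < d by rewrite divr_gt0.
  have [N1 h1] := approx (c *: a + b) h d ch d0.
  have [N2 h2] := approx a h d ch d0.
  have [N3 h3] := approx b h d ch d0.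
  pose n := maxn N1 (maxn N2 N3).
  have Pl : P (c *: a + b) n = c *: P a n + P b n.
    rewrite /P scaler_sumr -big_split; apply: eq_bigr => i _.
    by rewrite ell_coordD ell_coordZ scalerDl scalerA.
  have -> : S (c *: a + b) - (c *: S a + S b) =
      - (P (c *: a + b) n - S (c *: a + b)) + c *: (P a n - S a) + (P b n - S b).
    by rewrite opprB Pl scalerBr -[RHS]addrA [X in _ = _ + X]addrACA -opprD subrKA.
  apply: le_trans (seminormD ch.1 _ _) _.
  have -> : e = d + modulus c * d + d by rewrite /d; field; rewrite gt_eqF.
  apply: lerD; last by apply/ltW/h3; rewrite !leq_max leqnn !orbT.
  apply: le_trans (seminormD ch.1 _ _) _; rewrite (seminormN ch.1) (seminormZ ch.1).
  apply: lerD; first by apply/ltW/h1; rewrite leq_maxl.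
  by rewrite ler_wpM2l ?modulus_ge0//; apply/ltW/h2; rewrite !leq_max leqnn !orbT.
have cS : continuous S.
  apply: dominated_linear_continuous => // h ch; have [M M0 hM] := PM h ch.
  exists (fun a => M * rnorm a).
    exact/continuous_seminormZ/rnorm_continuous_seminorm.
  move=> a; apply/ler_addgt0Pr => e e0; have e20 : 0 < e / 2 by rewrite divr_gt0.
  have [N hN] := approx a h (e / 2) ch e20.
  rewrite -[S a](subKr (P a N)); apply: le_trans (seminormB ch.1 _ _) _.
  rewrite (splitr e) addrA; apply: lerD; last exact/ltW/hN.
  have t0 : 0 < rnorm a + e / 2 / M by rewrite ltr_wpDl ?(seminorm_ge0 sn)// divr_gt0.
  apply: le_trans (hM a N _ t0 _) _; first by rewrite lerDl divr_ge0// ltW.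
  by rewrite mulrDr [X in _ + X]mulrC divfK// gt_eqF.
have oS : S \in @is_operator K ell E by rewrite inE.
exists (Operator oS) => n; rewrite -[LHS]/(S (unit_ell k q1 qE n)).
apply/eqP; rewrite -subr_eq0; apply/eqP; apply: hausdorff_seminorm_eq0 => // h e ch e0.
have [N hN] := approx (unit_ell k q1 qE n) h e ch e0.
have := hN (maxn N n.+1) (leq_maxl _ _); rewrite -(seminormN ch.1) opprB.
suff -> : P (unit_ell k q1 qE n) (maxn N n.+1) = x n by move/ltW.
rewrite /P (@bigD1_seq _ _ _ _ _ n)/= ?mem_index_iota ?iota_uniq ?leq_maxr//.
rewrite big1 => [|i /negPf ni].
  by rewrite addr0 /unit_seq eqxx scale1r.
by rewrite /unit_seq ni scale0r.
Qed.

End series_operator.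

Section finite_exponent.
Variables (R : realType) (k : field_kind).
Local Notation K := (scalar_field R k).
Variables (E L : tvsType K) (p : \bar R) (p1 : (1 <= p)%E) (T : operator E L).

Lemma assertion_xi_implies_xii : (1 < p)%E -> (p < +oo)%E -> assertion_xi p T -> assertion_xii p1 T.
Proof.
move=> p_gt1 p_fin hxi S; apply: hxi.
case: p p1 p_gt1 p_fin S => [r||]// r1; rewrite lte_fin => r_gt1 _ S.
have [s [qE s0 rs1]] := hoelder_conjugate_real r_gt1.
by apply: ell_operator_compact rs1 qE S; exact: lt_trans r_gt1.
Qed.

Lemma assertion_xii_implies_i : hausdorff_space E -> sequentially_complete E ->
  (1 < p)%E -> (p < +oo)%E -> assertion_xii p1 T -> assertion_i p T.
Proof.
move=> hE cE p_gt1 p_fin hxii eta x eta0.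
case: p p1 p_gt1 p_fin hxii => [r||]// r1; rewrite lte_fin => r_gt1 _ hxii xr.
have r0 : 0 < r := lt_trans ltr01 r_gt1.
have [s [qE s0 rs1]] := hoelder_conjugate_real r_gt1.
have [S Sx] := series_operator hE cE (hoelder_conj_ge1 r1) r0 rs1 qE xr.
under eq_fun do rewrite -Sx.
apply: Vstar_map_unit_vectors eta0 => [n|]; first exact: rnorm_unit_ell.
exact: hxii.
Qed.

End finite_exponent.

(** * The equivalences *)

Theorem theorem3p14 (R : realType) (k : field_kind)
    (E L : tvsType (scalar_field R k))
    (hE : hausdorff_space E) (hL : hausdorff_space L)
    (p : \bar R) (p1 : (1 <= p)%E) (T : operator E L) :
  [/\ (* (A) *)
      [/\ assertion_i p T <-> assertion_ii p T,
          assertion_ii p T <-> assertion_iii p T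
        & assertion_iii p T <-> assertion_iv p T],
      (* (B) *)
      [/\ assertion_i p T -> assertion_v p T,
          assertion_v p T -> assertion_vi p T
        & c0_barrelled L ->
          weakly_seq_locally_complete (strong_dual L) +oo%E ->
          assertion_vi p T -> assertion_i p T],
      (* (C) *)
      (assertion_i p T -> assertion_vii p T) /\
      (c0_barrelled L -> assertion_vii p T -> assertion_i p T),
      (* (D) *)
      [/\ assertion_ii p T -> assertion_viii p T,
          assertion_viii p T <-> assertion_ix p T,
          assertion_ix p T -> assertion_x p T
        & weakly_seq_locally_complete E p ->
          assertion_x p T -> assertion_i p T]
    & (* (E) *)
      (1 < p)%E -> (p < +oo)%E ->
      [/\ assertion_i p T -> assertion_viii p T,
          assertion_viii p T -> assertion_xi p T,
          assertion_xi p T -> assertion_xii p1 T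
        & sequentially_complete E -> assertion_xii p1 T -> assertion_i p T]].
Proof.
have i_ii : assertion_i p T -> assertion_ii p T by exact: assertion_i_implies_ii.
have ii_iii : assertion_ii p T -> assertion_iii p T by exact: assertion_ii_implies_iii.
have iii_iv : assertion_iii p T -> assertion_iv p T by exact: assertion_iii_implies_iv.
have iv_i : assertion_iv p T -> assertion_i p T by exact: assertion_iv_implies_i.
split.
- by split; split; tauto.
- split; [exact: assertion_i_implies_v|exact: assertion_v_implies_vi|exact: assertion_vi_implies_i].
- split; [exact: assertion_i_implies_vii|exact: assertion_vii_implies_i].
- split; [exact: assertion_ii_implies_viii|exact: assertion_viii_iff_ix|
    exact: assertion_ix_implies_x|].
  exact: assertion_x_implies_i.
- move=> p_gt1 p_fin; split.
  + by move=> /i_ii; exact: assertion_ii_implies_viii.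
  + exact: assertion_viii_implies_xi.
  + exact: assertion_xi_implies_xii.
  + by move=> cE; exact: assertion_xii_implies_i.
Qed.
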